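(* Let $\alpha\in\,]0,1[$, let $\Lambda=z_0+\vec\Lambda$ be a $\mathbb{Z}$-grid in $\mathbb{C}$, and let $\phi,\psi:\mathbb{N}\to\,]0,+\infty[$ with $\phi(N)\to+\infty$, $\frac{\phi(N)}{N^{1-\alpha}}\to\lambda\in[0,+\infty]$ and $\psi(N)=\big(\frac{N^{2-\alpha}}{\phi(N)}\big)^2$. Let $f\in C^1_c(\mathbb{C})$ and $A>1$ with $\mathrm{supp}\,f\subset D(0,A)$. Let $\mathcal{R}^{\alpha,\Lambda,\mathrm{lvl}}_{N,N',N''}$ be the measure $$\mathcal{R}^{\alpha,\Lambda,\mathrm{lvl}}_{N,N',N''}=\frac{1}{(N'+N'')\psi(N)}\sum_{k=-N'}^{N''-1}\ \sum_{\substack{n,m\in\Lambda,\ n\neq m\\ 0<|n|,|m|\leq N}}\Delta_{\phi(N)(n^{[\alpha,k]}-m^{[\alpha,k]})}.$$ (i) If $\lambda=+\infty$, there is an integer $N_0$ depending on $\alpha,\Lambda,A$ such that $\mathcal{R}^{\alpha,\Lambda,\mathrm{lvl}}_{N,N',N''}(f)=0$ for all $N\geq N_0$ and all admissible $N',N''$. (ii) If $\lambda=0$, then as $N\to\infty$, $$\mathcal{R}^{\alpha,\Lambda,\mathrm{lvl}}_{N,N',N''}(f)=\int_{\mathbb{C}}f\rho_{\alpha,\vec\Lambda,\lambda}\,d\mathrm{Leb}+O_{\alpha,\Lambda}\Big(A^4(\|f\|_\infty+\|df\|_\infty)\Big(\frac{\phi(N)}{N^{1-\alpha}}+\frac{1}{N^\alpha\phi(N)}+\frac{1}{N'+N''}\Big)\Big).$$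 (iii) If $\lambda\in\,]0,+\infty[$, then as $N\to\infty$, $$\mathcal{R}^{\alpha,\Lambda,\mathrm{lvl}}_{N,N',N''}(f)=\int_{\mathbb{C}}f\rho_{\alpha,\vec\Lambda,\lambda}\,d\mathrm{Leb}+O_{\alpha,\Lambda}\Big((\|f\|_\infty+\|df\|_\infty)\big(\lambda+\tfrac1\lambda\big)^{\frac{10-8\alpha}{1-\alpha}}\Big(A^{\frac{8-6\alpha}{1-\alpha}}\Big|\frac{\phi(N)}{\lambda N^{1-\alpha}}-1\Big|+\frac{A^4}{N}+\frac{A^2}{N'+N''}\Big)\Big).$$
   Context: $N\geq1$ and $N',N''\geq0$ are integers with $N'+N''\geq1$. For $z\in\mathbb{C}^*$, $z^{[\beta,k]}=|z|^\beta e^{i\beta\omega_k}$ with $\omega_k$ the representative of $\arg z$ in $[2\pi k,2\pi(k+1)[$. $\Delta_w$ is the Dirac mass at $w$; $D(0,A)$ is the open disk. $\|f\|_\infty=\sup|f|$, $\|df\|_\infty=\sup_z\|df(z)\|$ (operator norm of the $\mathbb{R}$-linear differential). $\mathrm{covol}_{\vec\Lambda}$ is the area of a fundamental parallelogram. $\rho_{\alpha,\vec\Lambda,\lambda}$ is the constant $\frac{\pi}{\alpha^2(2-\alpha)\mathrm{covol}_{\vec\Lambda}^2}$ if $\lambda=0$ and, for $\lambda\in\,]0,\infty[$, $\rho(z)=\frac{\alpha^{\frac{2}{1-\alpha}}}{(1-\alpha)\mathrm{covol}_{\vec\Lambda}}(|z|/\lambda)^{-\frac{4-2\alpha}{1-\alpha}}\sum_{p\in\vec\Lambda,\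 |p|\leq|z|/(\alpha\lambda)}|p|^{\frac{2}{1-\alpha}}$ (with $\rho(0)=0$). Landau convention: $F(N)=O_{\alpha,\Lambda}(G(N))$ means there exist a constant $c>0$ depending only on $\alpha,\Lambda$ and an integer $N_0$ depending only on $\alpha,\Lambda,\phi,\psi,A$ (in particular not on $N',N'',\|f\|_\infty,\|df\|_\infty$) such that $|F(N)|\leq c|G(N)|$ for all $N\geq N_0$. *)

(* Defs.v *)
(* MathComp-Analysis, over an arbitrary R : realType. Complex numbers are the
   type R[i] of mathcomp-real-closed. *)
From HB Require Import structures.
From mathcomp Require Import all_boot all_order all_algebra finmap.
From mathcomp Require Import all_classical all_reals all_analysis.
From mathcomp Require Import measurable_realfun complex ring lra.

Set Implicit Arguments.
Unset Strict Implicit.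
Unset Printing Implicit Defensive.

Import Order.TTheory GRing.Theory Num.Theory.
Import numFieldNormedType.Exports.

Local Open Scope classical_set_scope.
Local Open Scope ring_scope.
Local Open Scope complex_scope.

(* R[i] carries neither a topology over R nor a sigma-algebra in the libraries:
   topology, differentiability and measures live on the plane R * R, which
   plane_of and complex_of identify with R[i]. *)
Notation plane R := (measurableTypeR R * measurableTypeR R)%type.

Definition complex_of (R : realType) (p : R * R) : R[i] := p.1 +i* p.2.
Definition plane_of (R : realType) (z : R[i]) : R * R := (complex.Re z, complex.Im z).

(* The library norm `|z| of R[i] has values in R[i]; this one is real. *)
Definition cmod (R : realType) (z : R[i]) : R := ComplexField.Normc.normc z.

Definition Leb (R : realType) : {measure set (plane R) -> \bar R} :=
  (@lebesgue_measure R \x @lebesgue_measure R)%E.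

Definition cintegral (R : realType) (mu : {measure set (plane R) -> \bar R})
    (g : R[i] -> R[i]) : R[i] :=
  (\int[mu]_p complex.Re (g (complex_of p))) +i* (\int[mu]_p complex.Im (g (complex_of p))).

Section ComplexPowers.
Context {R : realType}.

Definition expi (t : R) : R[i] := cos t +i* sin t.

(* For z != 0 the set below is a singleton. *)
Definition branch_arg (k : int) (z : R[i]) : R :=
  xget 0 [set w : R | [/\ 2 * pi * k%:~R <= w, w < 2 * pi * (k + 1)%:~R &
                          z = (cmod z)%:C * expi w]].

Definition branch_pow (beta : R) (k : int) (z : R[i]) : R[i] :=
  (cmod z `^ beta)%:C * expi (beta * branch_arg k z).

End ComplexPowers.

Section Grids.
Context {R : realType}.
Implicit Types (u v : R[i]) (L : set R[i]).

Definition R_independent u v :=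
  forall s t : R, s%:C * u + t%:C * v = 0 -> s = 0 /\ t = 0.

Definition is_Zbasis L (b : R[i] * R[i]) :=
  R_independent b.1 b.2 /\
  L = [set z | exists x y : int, z = b.1 *~ x + b.2 *~ y].

Definition is_Zlattice L := exists b, is_Zbasis L b.

Definition Zgrid (z0 : R[i]) L : set R[i] := [set z0 + p | p in L].

Definition fundamental_parallelogram (b : R[i] * R[i]) : set R[i] :=
  [set z | exists s t : R,
     [/\ 0 <= s < 1, 0 <= t < 1 & z = s%:C * b.1 + t%:C * b.2]].

(* The area does not depend on the basis; an arbitrary one is chosen. *)
Definition covol L : R :=
  fine (Leb R (@plane_of R @`
    fundamental_parallelogram (xget (0, 0) (is_Zbasis L)))).

End Grids.

Section Functions.
Context {R : realType}.
Implicit Types (f : R[i] -> R[i]).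

Definition plane_map f (p : R * R) : R * R := plane_of (f (complex_of p)).

Definition plane_norm (p : R * R) : R := cmod (complex_of p).

Definition supp f : set (R * R) := closure [set p | f (complex_of p) != 0].

Definition C1c f : Prop :=
  [/\ forall p, differentiable (plane_map f) p,
      forall h, continuous (fun p => 'd (plane_map f) p h) &
      compact (supp f)].

(* Operator norm for the Euclidean norm; the library norm on R * R is the max
   norm. *)
Definition op_norm (A : R * R -> R * R) : R :=
  sup [set plane_norm (A h) | h in [set h | plane_norm h <= 1]].

(* For f in C^1_c, both suprema are over nonempty bounded sets. *)
Definition sup_norm f : R := sup [set cmod (f z) | z in [set: R[i]]].

Definition diff_sup_norm f : R :=
  sup [set op_norm ('d (plane_map f) p) | p in [set: R * R]].

End Functions.

(* Sum of Dirac masses at the terms of a sequence, with multiplicity. *)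
Section DiracSum.
Context {d : measure_display} {T : measurableType d} {R : realType}.
Local Open Scope ereal_scope.

Definition dirac_sum (s : seq T) (B : set T) : \bar R := \sum_(w <- s) \d_w B.

Let dirac_sum_msum (s : seq T) :
  dirac_sum s =
    msum (fun i => dirac (nth point s i) : {measure set T -> \bar R}) (size s).
Proof. by apply/funext => B; rewrite /dirac_sum (big_nth point) big_mkord. Qed.

Let dirac_sum0 s : dirac_sum s set0 = 0.
Proof. by rewrite dirac_sum_msum measure0. Qed.

Let dirac_sum_ge0 s B : 0 <= dirac_sum s B.
Proof. by rewrite dirac_sum_msum measure_ge0. Qed.

Let dirac_sum_sigma_additive s : semi_sigma_additive (dirac_sum s).
Proof. by rewrite dirac_sum_msum; exact: measure_semi_sigma_additive. Qed.

HB.instance Definition _ (s : seq T) :=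
  isMeasure.Build _ _ _ (dirac_sum s) (dirac_sum0 s) (dirac_sum_ge0 s)
    (@dirac_sum_sigma_additive s).

End DiracSum.

Section PairCorrelation.
Context {R : realType}.

Definition grid_pairs (Lam : set R[i]) (N : nat) : set (R[i] * R[i]) :=
  [set nm | [/\ Lam nm.1, Lam nm.2, nm.1 != nm.2,
                0 < cmod nm.1 <= N%:R & 0 < cmod nm.2 <= N%:R]].

(* The integers -N', ..., N'' - 1. *)
Definition levels (N' N'' : nat) : seq int :=
  [seq i%:Z - N'%:Z | i <- iota 0 (N' + N'')].

(* fset_set enumerates a finite set; grid_pairs (Zgrid z0 L) N is finite when L
   is a lattice (lemma finite_grid_pairs). *)
Definition lvl_points (alpha : R) (Lam : set R[i]) (scaling : R)
    (N N' N'' : nat) : seq (plane R) :=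
  [seq plane_of (scaling%:C *
         (branch_pow alpha k nm.1 - branch_pow alpha k nm.2))
  | k <- levels N' N'', nm <- fset_set (grid_pairs Lam N)].

Definition lvl_measure (alpha : R) (Lam : set R[i]) (phi psi : nat -> {posnum R})
    (N N' N'' : nat) : {measure set (plane R) -> \bar R} :=
  mscale (((N' + N'')%:R * (psi N)%:num)^-1)%:nng
    (dirac_sum (lvl_points alpha Lam (phi N)%:num N N' N'')).

Definition rho (alpha : R) (L : set R[i]) (lam : R) (z : R[i]) : R :=
  if lam == 0 then pi / (alpha ^+ 2 * (2 - alpha) * covol L ^+ 2)
  else if z == 0 then 0
  else alpha `^ (2 / (1 - alpha)) / ((1 - alpha) * covol L)
    * (cmod z / lam) `^ (- ((4 - 2 * alpha) / (1 - alpha)))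
    * \sum_(p \in [set p | L p /\ cmod p <= cmod z / (alpha * lam)])
        cmod p `^ (2 / (1 - alpha)).

End PairCorrelation.

Lemma finite_int_ball (M : nat) : finite_set [set x : int | (`|x| <= M)%N].
Proof.
apply: (@sub_finite_set _ _ ((Posz @` `I_M.+1) `|` ((fun n => - Posz n) @` `I_M.+1))).
  move=> [n|n] /= h; first by left; exists n.
  by right; exists n.+1 => //; rewrite NegzE.
by rewrite finite_setU; split; apply: finite_image; exact: finite_II.
Qed.

Section FiniteGridPairs.
Context {R : realType}.

Lemma cmod_Re_Im (z : R[i]) :
  `|complex.Re z| <= cmod z /\ `|complex.Im z| <= cmod z.
Proof.
case: z => x y; rewrite /cmod /=.
by split; rewrite -(sqrtr_sqr) ler_wsqrtr// ?lerDl ?lerDr sqr_ge0.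
Qed.

Lemma int_bound (x : int) (D a : R) : D != 0 -> `|x%:~R * D| <= a ->
  (`|x| <= `|Num.ceil (a / `|D|)|)%N.
Proof.
move=> D0; rewrite normrM -ler_pdivlMr ?normr_gt0// => h.
rewrite -lez_nat !abszE -(ler_int R) intr_norm.
apply: (le_trans h); apply: le_trans (ceil_ge _) _.
by rewrite ler_int ler_norm.
Qed.

Lemma complex_mulrz (p q : R) (n : int) :
  (p +i* q) *~ n = (p * n%:~R) +i* (q * n%:~R).
Proof.
rewrite -mulrzr -[n%:~R](rmorph_int (real_complex R)).
apply/eqP; rewrite eq_complex /= !mulr0 subr0 add0r.
by apply/andP; split; apply/eqP; lra.
Qed.

Lemma finite_lattice_ball (L : set R[i]) (r : R) : is_Zlattice L ->
  finite_set [set p | L p /\ cmod p <= r].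
Proof.
case=> [[[u1 u2] [v1 v2]] [/= ind ->]].
pose D := u1 * v2 - u2 * v1.
have D0 : D != 0.
  apply/eqP => D0; rewrite /D in D0.
  have e1 : v2%:C * (u1 +i* u2) + (- u2)%:C * (v1 +i* v2) = 0.
    by apply/eqP; rewrite eq_complex /=; apply/andP; split; apply/eqP; lra.
  have e2 : v1%:C * (u1 +i* u2) + (- u1)%:C * (v1 +i* v2) = 0.
    by apply/eqP; rewrite eq_complex /=; apply/andP; split; apply/eqP; lra.
  have [v20 /eqP] := ind _ _ e1; rewrite oppr_eq0 => /eqP u20.
  have [v10 /eqP] := ind _ _ e2; rewrite oppr_eq0 => /eqP u10.
  have e3 : 1%:C * (u1 +i* u2) + 1%:C * (v1 +i* v2) = 0.
    by apply/eqP; rewrite eq_complex /= u10 u20 v10 v20; apply/andP; split; apply/eqP; lra.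
  by have [/eqP] := ind _ _ e3; rewrite oner_eq0.
pose M1 := `|Num.ceil ((r * (`|v1| + `|v2|)) / `|D|)|%N.
pose M2 := `|Num.ceil ((r * (`|u2| + `|u1|)) / `|D|)|%N.
apply: (@sub_finite_set _ _ ((fun ab : int * int => (u1 +i* u2) *~ ab.1 + (v1 +i* v2) *~ ab.2) @`
   ([set x : int | (`|x| <= M1)%N] `*` [set x : int | (`|x| <= M2)%N]))); last first.
  by apply: finite_image; apply: finite_setX; exact: finite_int_ball.
move=> _ [[x [y ->]]].
have -> : (u1 +i* u2) *~ x + (v1 +i* v2) *~ y
    = (u1 * x%:~R + v1 * y%:~R) +i* (u2 * x%:~R + v2 * y%:~R).
  by rewrite !complex_mulrz.
set z := (_ +i* _) => zr.
have [/= h1 h2] := cmod_Re_Im z.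
exists (x, y) => //=; last first.
  by rewrite !complex_mulrz.
have k1 := le_trans h1 zr; have k2 := le_trans h2 zr.
have key (a b c d : R) : `|a| <= r -> `|b| <= r -> `|a * c - b * d| <= r * (`|d| + `|c|).
  move=> ha hb; apply: le_trans (ler_normB _ _) _; rewrite !normrM mulrDr addrC.
  by apply: lerD; exact: ler_wpM2r.
split => /=; apply: (int_bound D0).
- have -> : x%:~R * D = (u1 * x%:~R + v1 * y%:~R) * v2 - (u2 * x%:~R + v2 * y%:~R) * v1
    by rewrite /D; ring.
  exact: key.
- have -> : y%:~R * D = (u2 * x%:~R + v2 * y%:~R) * u1 - (u1 * x%:~R + v1 * y%:~R) * u2
    by rewrite /D; ring.
  exact: key.
Qed.

Lemma finite_grid_pairs (z0 : R[i]) (L : set R[i]) (N : nat) :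
  is_Zlattice L -> finite_set (grid_pairs (Zgrid z0 L) N).
Proof.
move=> hL.
pose B := [set z0 + p | p in [set p | L p /\ cmod p <= N%:R + cmod z0]].
have fB : finite_set B by apply: finite_image; exact: finite_lattice_ball.
apply: sub_finite_set (finite_setX fB fB).
have sub z : Zgrid z0 L z -> cmod z <= N%:R -> B z.
  case=> p Lp <- h; exists p => //=; split=> //.
  have -> : p = (z0 + p) + - z0 by rewrite addrC addKr.
  apply: le_trans (le_normcD _ _) _.
  by rewrite normcN lerD2r.
by move=> [n m] [/= Ln Lm _ /andP[_ hn] /andP[_ hm]]; split => /=; exact: sub.
Qed.

End FiniteGridPairs.

Lemma Rintegral_mscale_dirac_sum d (T : measurableType d) (R : realType)
  (k : {nonneg R}) (s : seq T) (g : T -> R) : measurable_fun setT g ->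
  Rintegral (mscale k (dirac_sum s)) setT g = k%:num * \sum_(w <- s) g w.
Proof.
move=> mg.
have ge0 (h : T -> R) : measurable_fun setT h -> (forall x, 0 <= h x) ->
   (\int[mscale k (dirac_sum s)]_x (h x)%:E)%E = (k%:num * \sum_(w <- s) h w)%:E.
  move=> mh h0; rewrite ge0_integral_mscale//=; last 2 first.
    exact/measurable_EFinP. by move=> x _; rewrite lee_fin.
  rewrite EFinM; congr (_ * _)%E.
  transitivity (\int[msum (fun i => dirac (nth point s i) : {measure set T -> \bar R}) (size s)]_x (h x)%:E)%E.
    by apply: eq_measure_integral => A _ _; rewrite /= /dirac_sum (big_nth point) big_mkord.
  rewrite ge0_integral_measure_sum//; last 2 first.
    by move=> x _; rewrite lee_fin. exact/measurable_EFinP.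
  rewrite (big_nth point) big_mkord -sumEFin; apply: eq_bigr => i _.
  by rewrite integral_dirac ?diracT ?mul1e//; exact/measurable_EFinP.
rewrite /Rintegral integralE.
have -> : ((fun x => (g x)%:E)^\+)%E = (fun x => (Num.max (g x) 0)%:E).
  by apply/funext => x; rewrite funeposE -EFin_max.
have -> : ((fun x => (g x)%:E)^\-)%E = (fun x => (Num.max (- g x) 0)%:E).
  by apply/funext => x; rewrite funenegE -EFinN -EFin_max.
rewrite !ge0 ?fineB//=; last 4 first.
  by apply: measurable_maxr => //; exact: measurableT_comp.
  by move=> x; rewrite le_max lexx orbT.
  exact: measurable_maxr.
  by move=> x; rewrite le_max lexx orbT.
rewrite -mulrBr -sumrB; congr (_ * _); apply: eq_bigr => w _.
have [h|] := boolP (0 <= g w); last rewrite -ltNge => h.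
  by rewrite (@max_l _ _ (g w))// (@max_r _ _ (- g w)) ?subr0// oppr_le0.
have h' := ltW h.
by rewrite (@max_r _ _ (g w))// (@max_l _ _ (- g w)) ?sub0r ?opprK// oppr_ge0.
Qed.

Lemma cintegral_lvl_measure (R : realType) (alpha : R) (Lam : set R[i])
    (phi psi : nat -> {posnum R}) (N N' N'' : nat) (f : R[i] -> R[i]) :
  measurable_fun setT (fun p : plane R => complex.Re (f (complex_of p))) ->
  measurable_fun setT (fun p : plane R => complex.Im (f (complex_of p))) ->
  cintegral (lvl_measure alpha Lam phi psi N N' N'') f =
  (((N' + N'')%:R * (psi N)%:num)^-1)%:C *
  \sum_(k <- levels N' N'') \sum_(nm <- fset_set (grid_pairs Lam N))
    f ((phi N)%:num%:C * (branch_pow alpha k nm.1 - branch_pow alpha k nm.2)).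
Proof.
move=> mRe mIm; rewrite /cintegral !Rintegral_mscale_dirac_sum//=.
rewrite /lvl_points !big_allpairs_dep.
set F := fun k nm => (phi N)%:num%:C *
  (branch_pow alpha k nm.1 - branch_pow alpha k nm.2).
have K z : complex_of (plane_of z) = z by case: z.
transitivity ((((N' + N'')%:R * (psi N)%:num)^-1)%:C *
   ((\sum_(k <- levels N' N'') \sum_(nm <- fset_set (grid_pairs Lam N))
       complex.Re (f (F k nm))) +i*
    (\sum_(k <- levels N' N'') \sum_(nm <- fset_set (grid_pairs Lam N))
       complex.Im (f (F k nm))))).
  apply/eqP; rewrite eq_complex /= !mul0r subr0 addr0.
  by apply/andP; split; apply/eqP; congr (_ * _); apply: eq_bigr => k _;
    apply: eq_bigr => nm _; rewrite K.
congr (_ * _); apply/eqP; rewrite eq_complex /=.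
by apply/andP; split; apply/eqP; rewrite raddf_sum; apply: eq_bigr => k _;
  rewrite raddf_sum.
Qed.

(* Main.v *)
(* Fix a nonnegative Lipschitz test function u vanishing outside the disk of
   radius A, and put x = phi(N) / N^(1-alpha).  Writing a pair of grid points as
   (n, n - p) with p in the lattice, the increment of the power is alpha p
   n^[alpha-1,k] up to a second order error, except when n is close to the branch
   cut or to the circle |z| = N; only |p| <= C A / x contributes.  For fixed p the
   sum over n is compared, tile by tile, with an integral over the disk.  There
   n^[alpha-1,k] has argument (alpha-1)(theta + 2 pi k), so the sum over the levels
   k makes this argument sweep an interval of length 2 pi (1-alpha) (N'+N''), that
   is whole circles up to a bounded number of turns.  The normalised sum is thus
   close to x^2 / covol times the sum over p of I(alpha x |p|), where I(c) is the
   integral of u(c |z|^(alpha-1) z/|z|) over the unit disk.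

   If lambda is infinite, no p satisfies |p| <= C A / x once x is large.  If lambda
   is finite and positive, the substitution s = c r^(alpha-1) turns I(c) into an
   integral of u against a density supported on |z| >= c, the sum over p of these
   densities is rho, and the sum over p is a Lipschitz function of x.  If lambda is
   0, the sum over p is itself a Riemann sum, of step x, of the integral of
   s I(s) ds.  A C^1 function f is reduced to such u through the positive and
   negative parts of its real and imaginary parts. *)
From HB Require Import structures.
Require Import Defs.
From mathcomp Require Import all_boot all_order all_algebra finmap.
From mathcomp Require Import all_classical all_reals all_analysis.
From mathcomp Require Import measurable_realfun complex ring lra.

Set Implicit Arguments.
Unset Strict Implicit.
Unset Printing Implicit Defensive.

Import Order.TTheory GRing.Theory Num.Theory.
Import numFieldNormedType.Exports.

Local Open Scope classical_set_scope.
Local Open Scope ring_scope.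
Local Open Scope complex_scope.

(** * Polar coordinates *)

(** The constant of the error terms may depend on alpha and the grid only, so each estimate fixes
    its constants before the test function, [A] and the levels. What is left to N0 is the behaviour
    of x, a lower bound on N and the condition phi(N) >= Cs A. The latter comes from inverting the
    power: an increment of size A / phi(N) controls n - m only if it is small against |n|^alpha, and
    nonzero grid points have a positive minimal modulus.

    About (A/x)^2 vectors p contribute. For each of them the tile comparison costs a multiple of A
    |p| N per level, with |p| at most of order A/x, and the incomplete turns cost N^2 once for all
    levels. Multiplied by x^2 / ((N'+N'') N^2), these costs become A^4 / (x N) and A^2 / (N'+N''),
    where x N = N^alpha phi(N).

    Nonnegative test functions keep all integrals in the extended nonnegative reals, where
    substitution, Tonelli and comparison ask for measurability alone. Polar coordinates are built
    from one-dimensional substitutions of this kind. *)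

Section WeightedPushforward.
Context {R : realType} d (X : measurableType d).
Variables (mu : {measure set X -> \bar R}) (w : X -> R) (T : X -> measurableTypeR R).
Hypotheses (mw : measurable_fun setT w) (w0 : forall x, 0 <= w x).
Hypothesis mT : measurable_fun setT T.
Local Open Scope ereal_scope.

Definition weighted (A : set (measurableTypeR R)) : \bar R :=
  \int[mu]_x (w x * \1_A (T x))%:E.

Let ge0_wind (A : set R) x : 0 <= (w x * \1_A (T x))%:E.
Proof. by rewrite lee_fin mulr_ge0. Qed.

Let weighted0 : weighted set0 = 0.
Proof. by rewrite /weighted integral0_eq// => x _; rewrite indic0 mulr0. Qed.

Let weighted_ge0 A : 0 <= weighted A.
Proof. by apply: integral_ge0 => x _; exact: ge0_wind. Qed.

Let mwind (A : set (measurableTypeR R)) : measurable A ->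
  measurable_fun setT (fun x => (w x * \1_A (T x))%:E).
Proof.
move=> mA; apply/measurable_EFinP; apply: measurable_funM => //.
exact: measurableT_comp.
Qed.

Let weighted_sigma : semi_sigma_additive weighted.
Proof.
move=> F mF tF mUF; rewrite [X in _ --> X](_ : _ = \sum_(n <oo) weighted (F n)).
  by apply: is_cvg_ereal_nneg_natsum => n _; exact: weighted_ge0.
rewrite /weighted -integral_nneseries//; last by move=> n; exact: mwind.
apply: eq_integral => x _; rewrite EFinM.
under [RHS]eq_eseriesr do rewrite EFinM.
rewrite nneseriesZl; last by move=> n _; rewrite lee_fin.
by congr (_ * _); rewrite -indic_bigcup.
Qed.

HB.instance Definition _ := isMeasure.Build _ _ _ weighted
  weighted0 weighted_ge0 weighted_sigma.

Hypothesis wE : forall A, ocitv A -> lebesgue_measure A = weighted A.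

Import HBNNSimple.

(** By uniqueness of Lebesgue measure, agreement on half-open intervals makes [weighted] the
    Lebesgue measure; simple functions and monotone convergence do the rest. A substitution is thus
    reduced to the weighted measure of preimages of intervals. *)
Lemma integral_weighted (G : measurableTypeR R -> \bar R) :
  measurable_fun setT G -> (forall y, 0 <= G y) ->
  \int[lebesgue_measure]_y G y = \int[mu]_x ((w x)%:E * G (T x)).
Proof.
move=> mG G0.
have lE (A : set (measurableTypeR R)) : measurable A -> lebesgue_measure A = weighted A.
  exact: (@lebesgue_measure_unique R weighted).
pose g := nnsfun_approx measurableT mG.
have cg y : EFin \o g ^~ y @ \oo --> G y by exact: cvg_nnsfun_approx.
transitivity (limn (fun n => \int[lebesgue_measure]_y (g n y)%:E)).
  rewrite -monotone_convergence//.
  - by apply: eq_integral => y _; apply/esym/cvg_lim => //; exact: cg.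
  - by move=> n; exact/measurable_EFinP.
  - by move=> n y _; rewrite lee_fin.
  - by move=> y _ a b ab; rewrite lee_fin; exact/lefP/nd_nnsfun_approx.
transitivity (limn (fun n => \int[mu]_x ((w x)%:E * (g n (T x))%:E))); last first.
  rewrite -monotone_convergence//.
  - apply: eq_integral => x _; apply/cvg_lim => //.
    exact: cvgeZl (cg (T x)).
  - move=> n; apply: emeasurable_funM; first exact/measurable_EFinP.
    by apply/measurable_EFinP; exact: measurableT_comp.
  - by move=> n y _; rewrite mule_ge0// lee_fin.
  - by move=> y _ a b ab; rewrite lee_wpmul2l// ?lee_fin//; exact/lefP/nd_nnsfun_approx.
congr (limn _); apply/funext => n.
transitivity (\int[lebesgue_measure]_y
   \sum_(k \in range (g n)) (k * \1_(g n @^-1` [set k]) y)%:E).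
  by apply: eq_integral => y _; rewrite fimfunE -fsumEFin.
rewrite ge0_integral_fsum//; last 2 first.
  by move=> k; exact/measurable_EFinP/measurable_funM.
  by move=> k y _; rewrite nnfun_muleindic_ge0.
transitivity (\int[mu]_x
   \sum_(k \in range (g n)) (k%:E * (w x * \1_(g n @^-1` [set k]) (T x))%:E)); last first.
  apply: eq_integral => x _; rewrite (fimfunE (g n) (T x)) -fsumEFin//.
  rewrite ge0_mule_fsumr; last by move=> k; rewrite nnfun_muleindic_ge0.
  by apply: eq_fsbigr => k _; rewrite !EFinM muleCA.
have k0 k : k \in range (g n) -> (0 <= k)%R.
  by rewrite inE => -[y _ <-].
rewrite ge0_integral_fsum//; last 2 first.
- move=> k; apply: emeasurable_funM => //; exact: mwind.
- move=> k x _; have [k0'|] := leP 0%R k; first by rewrite mule_ge0// ge0_wind.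
  by move=> k0'; rewrite preimage_nnfun0// indic0 mulr0 mule0.
apply: eq_fsbigr => k kg.
rewrite integralZl_indic_nnsfun//= integral_indic// setIT.
have mgk : measurable (g n @^-1` [set k]) by [].
transitivity (k%:E * weighted (g n @^-1` [set k])); first by congr (_ * _); exact: lE.
rewrite /weighted ge0_integralZl//; first exact: mwind.
by rewrite lee_fin k0.
Qed.

End WeightedPushforward.

Section OneDim.
Context {R : realType}.
Notation mu := (@lebesgue_measure R).
Implicit Types (G : R -> \bar R).

Lemma integral_affine (k b : R) G : k != 0 ->
  measurable_fun [set: measurableTypeR R] G -> (forall y, 0 <= G y)%E ->
  (\int[mu]_y G y = \int[mu]_x (`|k|%:E * G (k * x + b)%R))%E.
Proof.
move=> k0 mG G0.
apply: (@integral_weighted R _ _ mu (cst `|k|) (fun x => k * x + b)) => //.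
  by apply: measurable_funD => //; apply: measurable_funM.
move=> _ [[c d] _ <-] /=.
have mT : measurable_fun [set: measurableTypeR R] (fun x : R => k * x + b).
  by apply: measurable_funD => //; apply: measurable_funM.
transitivity (\int[mu]_x (`|k|%:E * (\1_`]c, d] (k * x + b)%R : R)%:E))%E; last first.
  by apply: eq_integral => x _; rewrite -EFinM.
rewrite ge0_integralZl//; last by apply/measurable_EFinP; apply: measurableT_comp.
transitivity (`|k|%:E * mu ((fun x : R => (k * x + b)%R) @^-1` `]c, d]))%E; last first.
  congr (_ * _)%E; rewrite -[RHS]/(\int[mu]_x (\1_((fun x : R => (k * x + b)%R) @^-1` `]c, d]) x)%:E)%E.
  rewrite integral_indic// ?setIT//.
  by rewrite -[X in measurable X]setTI; exact: mT.
have [kp|kn|/eqP] := ltgtP 0 k; last by rewrite eq_sym (negbTE k0).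
  have -> : (fun x : R => k * x + b) @^-1` `]c, d] = `](c - b) / k, (d - b) / k]%classic.
    apply/seteqP; split => x /=; rewrite !in_itv/= ltr_pdivrMr// ler_pdivlMr//;
    by rewrite ltrBlDr lerBrDr [x * k]mulrC.
  rewrite !lebesgue_measure_itv/= !lte_fin ltr_pM2r ?invr_gt0// ltrD2r.
  case: ifPn => _; last by rewrite mule0.
  by rewrite -!EFinD -EFinM gtr0_norm// -mulrBl; congr EFin; field.
have -> : (fun x : R => k * x + b) @^-1` `]c, d] = `[(d - b) / k, (c - b) / k[%classic.
  apply/seteqP; split => x /=; rewrite !in_itv/= ltr_ndivlMr// ler_ndivrMr//;
  by rewrite ltrBlDr lerBrDr [x * k]mulrC andbC.
rewrite !lebesgue_measure_itv/= !lte_fin ltr_nM2r ?invr_lt0// ltrD2r.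
case: ifPn => _; last by rewrite mule0.
by rewrite -!EFinD -EFinM ltr0_norm// -mulrBl; congr EFin; field.
Qed.

(* The Jacobian of [y = tan t]. *)
Definition tan_weight (t : R) : R := \1_(`]- (pi / 2), pi / 2[) t * cos t `^ (-2).

Lemma measurable_tan_weight : measurable_fun [set: measurableTypeR R] tan_weight.
Proof.
apply: measurable_funM; first exact: measurable_indic.
exact: (measurableT_comp (measurable_powR (-2))
  (continuous_measurable_fun (@continuous_cos R))).
Qed.

Lemma tan_weight_ge0 t : 0 <= tan_weight t.
Proof. by rewrite mulr_ge0// powR_ge0. Qed.

Lemma tan_weightE t : t \in `]- (pi / 2), pi / 2[%R -> 
  tan_weight t = (cos t) ^- 2.
Proof.
move=> tI; rewrite /tan_weight indicE mem_set//= mul1r powRN powR_mulrn//.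
by apply/ltW/cos_gt0_pihalf; rewrite in_itv in tI.
Qed.

(** The inverse is written as a real power, measurable on the whole line. This agrees with [tan]
    where the cosine is positive; elsewhere [tan_weight] vanishes or multiplies a value that never
    matters. *)
Definition tanM (t : R) : R := sin t * cos t `^ (-1).

Lemma measurable_tanM : measurable_fun [set: measurableTypeR R] tanM.
Proof.
apply: measurable_funM; first exact: (continuous_measurable_fun (@continuous_sin R)).
exact: (measurableT_comp (measurable_powR (-1))
  (continuous_measurable_fun (@continuous_cos R))).
Qed.

Lemma tanME t : t \in `]- (pi / 2), pi / 2[%R -> tanM t = tan t.
Proof.
move=> tI; rewrite /tanM /tan powR_inv1//.
by apply/ltW/cos_gt0_pihalf; rewrite in_itv in tI.
Qed.

(** Where the weight is nonzero, the preimage of []c, d]] is the interval between the two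
    arctangents, and the weight is there the derivative of [tan], so the fundamental theorem of
    calculus returns d - c. *)
Lemma integral_tan G :
  measurable_fun [set: measurableTypeR R] G -> (forall y, 0 <= G y)%E ->
  (\int[mu]_y G y = \int[mu]_t ((tan_weight t)%:E * G (tanM t)))%E.
Proof.
move=> mG G0; apply: integral_weighted => //.
- exact: measurable_tan_weight.
- exact: tan_weight_ge0.
- exact: measurable_tanM.
move=> _ [[c d] _ <-] /=; rewrite /weighted.
have [dc|cd] := leP d c.
  rewrite set_itv_ge ?measure0; last by rewrite bnd_simp -leNgt.
  by rewrite integral0_eq// => x _; rewrite indic0 mulr0.
have acd : atan c < atan d by exact: lt_atan.
have sub x : x \in `[atan c, atan d]%R -> x \in `]- (pi / 2), pi / 2[%R.
  rewrite !in_itv/= => /andP[cx xd].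
  by rewrite (lt_le_trans (atan_gtNpi2 c) cx) (le_lt_trans xd (atan_ltpi2 d)).
have E : (fun x => (tan_weight x * \1_`]c, d] (tanM x))%:E) =
   (fun t => ((cos t) ^- 2)%:E) \_ `]atan c, atan d].
  apply/funext => t; rewrite /patch; case: ifPn => [/set_mem tI|tI].
    have tI2 := subset_itv_oc_cc tI.
    rewrite tan_weightE ?sub// tanME ?sub// indicE mem_set ?mulr1//=.
    move: tI; rewrite /= !in_itv/= => /andP[h1 h2].
    rewrite -(atanK c) -(atanK d) ltr_tan ?le_tan// ?sub ?bound_itvE ?(ltW acd)//.
    by rewrite h1 leNgt ltr_tan ?sub ?bound_itvE ?(ltW acd)// -leNgt.
  rewrite /tan_weight [in X in X * _]indicE.
  have [tp|] := boolP (t \in _); last by rewrite !mul0r.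
  rewrite mul1r [\1_(`]c, d]) _]indicE; case: (boolP (tanM t \in _)) => [|]; last by rewrite mulr0.
  move=> /set_mem; move/set_mem : tp => /= tp.
  rewrite tanME//= in_itv/= => /andP[h1 h2].
  case/negP : tI; apply/mem_set => /=.
  rewrite in_itv/= -(tanK tp) lt_atan//=; exact: le_atan.
have cos0 x : x \in `[atan c, atan d]%R -> cos x != 0.
  by move=> /sub; rewrite in_itv/= => /cos_gt0_pihalf/lt0r_neq0.
have cc : {within `[atan c, atan d], continuous (fun t : R => (cos t) ^- 2)}.
  apply: continuous_in_subspaceT => x /set_mem xI.
  apply: cvgV; first by rewrite expf_neq0// cos0.
  apply: (@continuous_comp _ _ _ (@cos R) (fun y => y ^+ 2)); [exact: continuous_cos|exact: exprn_continuous].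
rewrite E -integral_mkcond integral_itv_obnd_cbnd; last first.
  apply/measurable_EFinP; apply: measurable_funS (subspace_continuous_measurable_fun _ cc) => //.
  exact: subset_itv_oc_cc.
rewrite (@continuous_FTC2 _ _ tan)//.
- by rewrite !atanK lebesgue_measure_itv/= lte_fin cd.
- split.
  + by move=> x xI; apply: derivable_tan; apply: cos0; exact: subset_itv_oo_cc.
  + apply: cvg_at_right_filter; apply: continuous_tan; apply: cos0.
    by rewrite bound_itvE ltW.
  + apply: cvg_at_left_filter; apply: continuous_tan; apply: cos0.
    by rewrite bound_itvE ltW.
move=> x xI; rewrite derive1E; apply: derive_val.
by apply: is_derive_tan; apply: cos0; exact: subset_itv_oo_cc.
Qed.

End OneDim.

Definition pol {R : realType} (r t : R) : R * R := (r * cos t, r * sin t).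

Section Polar.
Context {R : realType}.
Notation mu := (@lebesgue_measure R).
Implicit Types (F : plane R -> \bar R).

Let pos (x : R) : R := \1_(`]0, +oo[) x.

Let posE x : pos x = (0 < x)%R%:R :> R.
Proof.
rewrite /pos indicE; congr ((nat_of_bool _)%:R).
by apply/idP/idP => [/set_mem|h]; rewrite ?inE /= in_itv/= andbT.
Qed.

Let mpos : measurable_fun [set: measurableTypeR R] pos.
Proof. exact: measurable_indic. Qed.

Lemma measurable_cosR : measurable_fun [set: measurableTypeR R] (@cos R).
Proof. exact: (continuous_measurable_fun (@continuous_cos R)). Qed.

Lemma measurable_sinR : measurable_fun [set: measurableTypeR R] (@sin R).
Proof. exact: (continuous_measurable_fun (@continuous_sin R)). Qed.

Let mid : measurable_fun [set: measurableTypeR R] (@id R).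
Proof. exact: measurable_id. Qed.

Let mfst (h : R -> R) : measurable_fun [set: measurableTypeR R] h ->
  measurable_fun [set: plane R] (fun z => h z.1).
Proof. by move=> mh; exact: (measurableT_comp mh (@measurable_fst _ _ _ _)). Qed.

Let msnd (h : R -> R) : measurable_fun [set: measurableTypeR R] h ->
  measurable_fun [set: plane R] (fun z => h z.2).
Proof. by move=> mh; exact: (measurableT_comp mh (@measurable_snd _ _ _ _)). Qed.

(** Two one-dimensional substitutions: y = x tan t at fixed x, then, after exchanging the integrals,
    x = r cos t at fixed t. The Jacobian x / cos^2 t times cos t is r. *)
Lemma polar_half F : measurable_fun setT F -> (forall z, 0 <= F z)%E ->
  (\int[Leb R]_z ((pos z.1)%:E * F z) =
   \int[mu]_t \int[mu]_r
     ((\1_(`]- (pi / 2), pi / 2[) t * (pos r * r))%:E * F (pol r t)))%E.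
Proof.
move=> mF F0.
have pos0 x : 0 <= pos x by rewrite posE ler0n.
rewrite /Leb fubini_tonelli1/=; last 2 first.
- apply: emeasurable_funM => //; apply/measurable_EFinP; exact: mfst.
- by move=> z; rewrite mule_ge0// lee_fin.
rewrite /fubini_F/=.
pose K (z : R * R) : \bar R :=
  ((pos z.1 * z.1 * tan_weight z.2)%:E * F (z.1, z.1 * tanM z.2)%R)%E.
have K0 z : (0 <= K z)%E.
  rewrite mule_ge0// lee_fin mulr_ge0 ?tan_weight_ge0// posE.
  by case: ltP => [/ltW|]; rewrite ?mul1r ?mul0r.
have mK : measurable_fun [set: plane R] K.
  apply: emeasurable_funM.
    apply/measurable_EFinP; apply: measurable_funM; last exact: (msnd measurable_tan_weight).
    by apply: measurable_funM; [exact: mfst|exact: (mfst mid)].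
  apply: measurableT_comp => //; apply: measurable_fun_pair => /=.
    exact: (mfst mid).
  by apply: measurable_funM; [exact: (mfst mid)|exact: (msnd measurable_tanM)].
transitivity (\int[mu]_x \int[mu]_t K (x, t))%E.
  apply: eq_integral => x _; rewrite /K/=.
  have [x0|x0] := leP x 0.
    rewrite posE ltNge x0/= integral0_eq//; last by move=> y _; rewrite mul0e.
    by rewrite integral0_eq// => t _; rewrite !mul0r mul0e.
  rewrite posE x0/=.
  have mFx : measurable_fun [set: measurableTypeR R] (fun y : R => F (x, y)).
    by apply: measurableT_comp => //; exact: pair1_measurable.
  under eq_integral do rewrite mul1e.
  rewrite (@integral_affine R x 0 (fun y => F (x, y)))// ?gt_eqF//.
  rewrite integral_tan; first last.
  - by move=> y; rewrite mule_ge0// lee_fin.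
  - apply: emeasurable_funM => //.
    apply: (@measurableT_comp _ _ _ _ _ _ (fun y : R => F (x, y))) => //.
    by apply: measurable_funD => //; apply: measurable_funM.
  apply: eq_integral => t _; rewrite addr0 mul1r gtr0_norm// muleA -EFinM.
  by rewrite [_ * x]mulrC.
transitivity (\int[mu]_t \int[mu]_x K (x, t))%E; first exact: fubini_tonelli.
apply: eq_integral => t _.
have [tI|tI] := boolP (t \in `]- (pi / 2), pi / 2[%R); last first.
  rewrite integral0_eq; last first.
    by move=> x _; rewrite /K/= /tan_weight [\1_ _ t]indicE memNset ?mul0r ?mulr0 ?mul0e//; apply/negP.
  by rewrite integral0_eq// => x _; rewrite indicE memNset ?mul0r ?mul0e//; apply/negP.
have c0 : 0 < cos t by apply: cos_gt0_pihalf; rewrite in_itv in tI.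
rewrite (@integral_affine R (cos t) 0 (fun x => K (x, t))) ?gt_eqF//; last first.
  by apply: measurableT_comp => //; exact: pair2_measurable.
apply: eq_integral => r _; rewrite /K/= addr0.
rewrite tan_weightE// tanME// gtr0_norm// muleA -EFinM [\1_ _ t]indicE mem_set//.
congr (_%:E * F _)%E.
  rewrite !posE pmulr_rgt0//= mul1r; case: ltP => //= _; rewrite ?mul0r ?mulr0 ?mul1r//.
  by field; rewrite gt_eqF.
rewrite /pol /tan; congr pair; first by rewrite mulrC.
by field; rewrite gt_eqF.
Qed.

End Polar.

(** * Integrals of periodic functions *)

Section Periodic.
Context {R : realType}.
Notation mu := (@lebesgue_measure R).
Variable G : R -> \bar R.
Hypotheses (mG : measurable_fun [set: measurableTypeR R] G)
  (G0 : forall t, (0 <= G t)%E).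
Local Open Scope ereal_scope.

Let mGD (D : set (measurableTypeR R)) : measurable_fun D G.
Proof. exact: measurable_funTS. Qed.

Let mGres (D : set (measurableTypeR R)) : measurable D ->
  measurable_fun [set: measurableTypeR R] (G \_ D).
Proof. by move=> mD; apply/(measurable_restrictT _ _).1. Qed.

Let Gres0 (D : set R) t : 0 <= (G \_ D) t.
Proof. exact: erestrict_ge0. Qed.

Lemma integral_itv_shift (a b c : R) :
  \int[mu]_(t in `[a, b[) G (t + c)%R = \int[mu]_(t in `[(a + c)%R, (b + c)%R[) G t.
Proof.
rewrite [RHS]integral_mkcond.
rewrite (integral_affine c (oner_neq0 R) (mGres _) (Gres0 _))//.
rewrite integral_mkcond; apply: eq_integral => t _.
rewrite normr1 mul1e mul1r /patch; congr (if _ then _ else _).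
by apply/idP/idP => /set_mem h; apply/mem_set; move: h;
  rewrite /= !in_itv/= lerD2r ltrD2r.
Qed.

Lemma integral_itv_cat (a b c : R) : (a <= b)%R -> (b <= c)%R ->
  \int[mu]_(t in `[a, c[) G t =
  \int[mu]_(t in `[a, b[) G t + \int[mu]_(t in `[b, c[) G t.
Proof.
move=> ab bc.
have E : `[a, c[%classic = `[a, b[ `|` `[b, c[ :> set R.
  by rewrite -itv_bndbnd_setU.
rewrite E ge0_integral_setU//.
apply/disj_setPS => t [/=]; rewrite !in_itv/= => /andP[_ tb] /andP[bt _].
by move: (lt_le_trans tb bt); rewrite ltxx.
Qed.

Variable T : R.
Hypotheses (T0 : (0 < T)%R) (GT : forall t, G (t + T)%R = G t).

Let Gn (n : nat) t : G (t + T *+ n)%R = G t.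
Proof. by elim: n => [|n ih]; rewrite ?mulr0n ?addr0// mulrSr addrA GT ih. Qed.

Let Gz (n : int) t : G (t + T *~ n)%R = G t.
Proof.
case: n => n; first exact: Gn.
by rewrite NegzE mulrNz -[in RHS](subrK (T *~ n.+1) t) -[in RHS]pmulrn Gn.
Qed.

Lemma integral_period (a : R) :
  \int[mu]_(t in `[a, (a + T)%R[) G t = \int[mu]_(t in `[0%R, T[) G t.
Proof.
pose n := Num.floor (a / T); pose a' := (a - T *~ n)%R.
have a'0 : (0 <= a')%R.
  by rewrite subr_ge0 -mulrzr mulrC -ler_pdivlMr// ge_floor.
have a'T : (a' < T)%R.
  rewrite ltrBlDr -[X in (_ < X + _)%R]mulr1 -mulrzr -mulrDr mulrC -ltr_pdivrMr//.
  by rewrite addrC; have := lt_succ_floor (a / T); rewrite intrD.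
transitivity (\int[mu]_(t in `[a', (a' + T)%R[) G t).
  rewrite [RHS](_ : _ = \int[mu]_(t in `[a', (a' + T)%R[) G (t + T *~ n)%R); last first.
    by apply: eq_integral => t _; rewrite Gz.
  by rewrite integral_itv_shift /a' subrK addrAC subrK.
rewrite (@integral_itv_cat a' T) ?lerDr ?(ltW a'T)//.
rewrite (@integral_itv_cat 0%R a' T) ?(ltW a'T)// addeC; congr (_ + _).
rewrite [RHS](_ : _ = \int[mu]_(t in `[0%R, a'[) G (t + T)%R); last first.
  by apply: eq_integral => t _; rewrite GT.
by rewrite integral_itv_shift add0r.
Qed.

(** Meant for h = pi / 2: the two terms are the contributions of the right half-plane and of the
    left one, reflected into the right one. *)
Lemma integral_half_periods (a h : R) : (0 < h)%R -> T = (4 * h)%R ->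
  \int[mu]_(t in `](- h)%R, h[) G t + \int[mu]_(t in `](- h)%R, h[) G (t + 2 * h)%R
  = \int[mu]_(t in `[a, (a + T)%R[) G t.
Proof.
move=> h0 Th; rewrite integral_period -(integral_period (- h)).
have e1 : (- h <= h)%R by lra.
have e2 : (h <= - h + T)%R by lra.
rewrite [RHS](integral_itv_cat e1 e2); congr (_ + _).
  by rewrite integral_itv_obnd_cbnd; last exact: mGD.
rewrite integral_itv_obnd_cbnd; last first.
  apply: measurable_funTS; apply: (@measurableT_comp _ _ _ _ _ _ G) => //.
  exact: measurable_funD.
rewrite integral_itv_shift (_ : - h + 2 * h = h)%R; last by ring.
by rewrite (_ : h + 2 * h = - h + T)%R // Th; ring.
Qed.

Lemma integral_periodn (a : R) (n : nat) :
  \int[mu]_(t in `[a, (a + T *+ n)%R[) G t = n%:R%:E * \int[mu]_(t in `[0%R, T[) G t.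
Proof.
elim: n => [|n ih].
  by rewrite mulr0n addr0 set_itvco0 integral_set0 mul0e.
have -> : (a + T *+ n.+1 = (a + T *+ n) + T)%R by rewrite mulrSr addrA.
rewrite (@integral_itv_cat a (a + T *+ n)%R) ?lerDl ?mulrn_wge0 ?(ltW T0)//.
rewrite ih integral_period -[in RHS]natr1 EFinD ge0_muleDl ?mul1e ?lee_fin//.
Qed.

(* The substitution maps K periods onto an interval of length K T |k|, which
   contains at least floor (K |k|) periods and is covered by one more. *)
Lemma average_period (k b a : R) (K : nat) : (k < 0)%R ->
  let w := \int[mu]_(t in `[0%R, T[) G t in
  let I := \int[mu]_(t in `[a, (a + T *+ K)%R[) G (k * t + b)%R in
  I <= (K%:R + `|k|^-1)%:E * w /\ K%:R%:E * w <= I + `|k|^-1%:E * w.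
Proof.
move=> k0 w I.
have k0' : (0 < `|k|)%R by rewrite normr_gt0 lt_eqF.
have w0 : 0 <= w by apply: integral_ge0.
pose q := (k * (a + T *+ K) + b)%R.
pose l := (T * (K%:R * `|k|))%R.
have IE : I = `|k|^-1%:E * \int[mu]_(t in `[q, (q + l)%R[) G t.
  (* As [k] is negative, the affine map reverses the interval and moves the closed end to the right;
     both ends are null and are exchanged afterwards. *)
  have H : \int[mu]_(t in `](q : R), (q + l)%R]) G t = `|k|%:E * I.
    rewrite integral_mkcond.
    rewrite (@integral_affine R k b _ _ (mGres _) (Gres0 _)) ?lt_eqF//.
    rewrite /I -ge0_integralZl//; last first.
      apply: measurable_funTS; apply: (@measurableT_comp _ _ _ _ _ _ G) => //.
      by apply: measurable_funD => //; apply: measurable_funM.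
    rewrite [RHS]integral_mkcond; apply: eq_integral => t _; rewrite /patch.
      rewrite (_ : (t \in `[a, (a + T *+ K)%R[%classic) =
        (k * t + b \in `]q, (q + l)%R]%classic)%R); first by case: ifPn => //; rewrite mule0.
      have e : (q + l = k * a + b)%R.
        rewrite /q /l ltr0_norm// -mulr_natr; ring.
      by apply/idP/idP => /set_mem h; apply/mem_set; move: h;
       rewrite /= !in_itv/= e /q ltrD2r lerD2r ltr_nM2l// ler_nM2l// andbC.
  have -> : I = `|k|^-1%:E * (`|k|%:E * I).
    by rewrite muleA -EFinM mulVf ?mul1e// gt_eqF.
  rewrite -H; congr (_ * _).
  rewrite integral_itv_obnd_cbnd; last exact: mGD.
  by rewrite -integral_itv_bndo_bndc; last exact: mGD.
pose n := `|Num.floor (K%:R * `|k|)|%N.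
have f0 : (0 <= Num.floor (K%:R * `|k|))%R by rewrite floor_ge0 mulr_ge0// ltW.
have n1 : (n%:R <= K%:R * `|k|)%R.
  by rewrite -[n%:R]/((Posz n)%:~R) gez0_abs// ge_floor.
have n2 : (K%:R * `|k| <= n.+1%:R)%R.
  by rewrite -natr1 -[n%:R]/((Posz n)%:~R) gez0_abs// ltW//;
  have := lt_succ_floor (K%:R * `|k|); rewrite intrD.
have sub (u v : R) : (u <= v)%R -> \int[mu]_(t in `[q, (q + u)%R[) G t <=
    \int[mu]_(t in `[q, (q + v)%R[) G t.
  move=> uv; apply: ge0_subset_integral => //.
  by apply: subset_itvl; rewrite bnd_simp lerD2l.
have up : \int[mu]_(t in `[q, (q + l)%R[) G t <= n.+1%:R%:E * w.
  rewrite -(integral_periodn q); apply: sub.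
  by rewrite /l -[(T *+ n.+1)%R]mulr_natr ler_pM2l.
have lo : n%:R%:E * w <= \int[mu]_(t in `[q, (q + l)%R[) G t.
  rewrite -(integral_periodn q); apply: sub.
  by rewrite /l -[(T *+ n)%R]mulr_natr ler_pM2l.
split.
  rewrite IE; apply: (@le_trans _ _ (`|k|^-1%:E * (n.+1%:R%:E * w))).
    by rewrite lee_wpmul2l// lee_fin invr_ge0 ltW.
  rewrite muleA -EFinM lee_wpmul2r// lee_fin -natr1 mulrDr mulr1 lerD2r.
  by rewrite mulrC ler_pdivrMr.
rewrite IE; apply: (@le_trans _ _ (`|k|^-1%:E * (n%:R%:E * w) + `|k|^-1%:E * w)).
  rewrite muleA -EFinM -ge0_muleDl ?lee_fin ?mulr_ge0 ?invr_ge0 ?(ltW k0')//.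
  rewrite -EFinD lee_wpmul2r// lee_fin -[X in (_ <= _ + X)%R]mulr1 -mulrDr natr1.
  by rewrite mulrC ler_pdivlMr.
by rewrite leeD2r// lee_wpmul2l// lee_fin invr_ge0 ltW.
Qed.

End Periodic.

Section PolarFull.
Context {R : realType}.
Notation mu := (@lebesgue_measure R).
Implicit Types (F : plane R -> \bar R).
Local Open Scope ereal_scope.

Lemma measurable_pol_t (t : R) : measurable_fun [set: measurableTypeR R]
  (fun r => pol r t : plane R).
Proof. by apply: measurable_fun_pair; apply: measurable_funM. Qed.

Lemma measurable_pol : measurable_fun [set: plane R]
  (fun z : plane R => pol z.2 z.1 : plane R).
Proof.
apply: measurable_fun_pair; apply: measurable_funM => //.
  exact: (measurableT_comp measurable_cosR (@measurable_fst _ _ _ _)).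
exact: (measurableT_comp measurable_sinR (@measurable_fst _ _ _ _)).
Qed.

Definition radial F (t : R) : \bar R :=
  \int[mu]_(r in `]0%R, +oo[) (r%:E * F (pol r t)).

Lemma radialE F t :
  radial F t = \int[mu]_r ((\1_(`]0%R, +oo[) r * r)%:E * F (pol r t)).
Proof.
rewrite /radial integral_mkcond; apply: eq_integral => r _.
rewrite /patch indicE; case: ifPn => _; first by rewrite mul1r.
by rewrite mul0r mul0e.
Qed.

Lemma radial_ge0 F t : (forall z, 0 <= F z) -> 0 <= radial F t.
Proof.
move=> F0; apply: integral_ge0 => r /=; rewrite in_itv/= andbT => r0.
by rewrite mule_ge0// lee_fin ltW.
Qed.

Let ind_ge0 (r : R) : (0 <= \1_(`]0%R, +oo[) r * r)%R.
Proof.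
rewrite indicE; have [/set_mem|_] := boolP (r \in _); last by rewrite mul0r.
by rewrite /= in_itv/= andbT mul1r => /ltW.
Qed.

Lemma measurable_radial F : measurable_fun setT F -> (forall z, 0 <= F z) ->
  measurable_fun [set: measurableTypeR R] (radial F).
Proof.
move=> mF F0.
rewrite (_ : radial F = (fun t => \int[mu]_r ((\1_(`]0%R, +oo[) r * r)%:E * F (pol r t)))); last first.
  by apply/funext => t; exact: radialE.
apply: (@measurable_fun_fubini_tonelli_F _ _ _ _ _ mu
  (fun z : plane R => (\1_(`]0%R, +oo[) z.2 * z.2)%:E * F (pol z.2 z.1))).
- apply: emeasurable_funM; last exact: (measurableT_comp mF measurable_pol).
  apply/measurable_EFinP; apply: measurable_funM => //.
  apply: (@measurableT_comp _ _ _ _ _ _ (\1_(`]0%R, +oo[ : set R) : measurableTypeR R -> R)) => //.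
- move=> z; rewrite mule_ge0// lee_fin; exact: ind_ge0.
Qed.

Lemma pol2pi (r t : R) : pol r (t + 2 * pi) = pol r t.
Proof. by rewrite /pol mulr_natl cosD2pi sinD2pi. Qed.

Lemma polpi (r t : R) : pol r (t + pi) = (- (pol r t).1, - (pol r t).2)%R.
Proof. by rewrite /pol cosDpi sinDpi !mulrN. Qed.

Lemma integral_reflect F : measurable_fun setT F -> (forall z, 0 <= F z) ->
  \int[Leb R]_z F z = \int[Leb R]_z F (- z.1, - z.2)%R.
Proof.
move=> mF F0.
have mopp : measurable_fun [set: plane R] (fun z : plane R => (- z.1, - z.2)%R : plane R).
  by apply: measurable_fun_pair; apply: measurable_funN.
have mFN := measurableT_comp mF mopp.
rewrite /Leb (fubini_tonelli1 F mF F0) (fubini_tonelli1 _ mFN (fun z => F0 _)).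
rewrite /fubini_F/=.
rewrite (@integral_affine R (-1) 0 (fun x => \int[mu]_y F (x, y))); first last.
- by move=> y; exact: integral_ge0.
- exact: (measurable_fun_fubini_tonelli_F (m2 := mu) F).
- by rewrite oppr_eq0 oner_eq0.
apply: eq_integral => x _.
rewrite normrN normr1 mul1e addr0 mulN1r.
rewrite (@integral_affine R (-1) 0 (fun y => F (- x, y)%R)); first last.
- by [].
- by apply: measurableT_comp => //; exact: pair1_measurable.
- by rewrite oppr_eq0 oner_eq0.
by apply: eq_integral => y _; rewrite normrN normr1 mul1e addr0 mulN1r.
Qed.

(** The left half-plane is the image of the right one under z -> -z, which shifts the angle by pi.
    The initial angle is free so that it can be the start of the interval of a given branch of the
    argument. *)
Lemma integral_polar F (a : R) : measurable_fun setT F -> (forall z, 0 <= F z) ->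
  \int[Leb R]_z F z = \int[mu]_(t in `[a, (a + 2 * pi)%R[) radial F t.
Proof.
move=> mF F0.
have mV := measurable_radial mF F0.
have V0 t := radial_ge0 t F0.
have VD (D : set (measurableTypeR R)) : measurable_fun D (radial F).
  exact: measurable_funTS.
pose pos (x : R) : R := \1_(`]0%R, +oo[) x.
have pos0 x : (0 <= (pos x)%:E) by rewrite lee_fin /pos indicE ler0n.
have mpos : measurable_fun [set: measurableTypeR R] (pos : R -> R) by exact: measurable_indic.
have half (G : plane R -> \bar R) : measurable_fun setT G -> (forall z, 0 <= G z) ->
    \int[Leb R]_z ((pos z.1)%:E * G z) =
    \int[mu]_(t in `](- (pi / 2))%R, (pi / 2)%R[) radial G t.
  move=> mG G0; rewrite (polar_half mG G0) [RHS]integral_mkcond.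
  apply: eq_integral => t _; rewrite /patch indicE; case: ifPn => _.
    by rewrite radialE; apply: eq_integral => r _; rewrite mul1r.
  by rewrite integral0_eq// => r _; rewrite mul0r mul0e.
have mposz : measurable_fun [set: plane R] (fun z => (pos z.1)%:E).
  by apply/measurable_EFinP; exact: (measurableT_comp mpos (@measurable_fst _ _ _ _)).
have mposNz : measurable_fun [set: plane R] (fun z => (pos (- z.1)%R)%:E).
  apply/measurable_EFinP; apply: (measurableT_comp mpos).
  by apply: measurable_funN.
have mopp : measurable_fun [set: plane R] (fun z : plane R => (- z.1, - z.2)%R : plane R).
  by apply: measurable_fun_pair; apply: measurable_funN.
have Fsplit : \int[Leb R]_z F z =
    \int[Leb R]_z ((pos z.1)%:E * F z) + \int[Leb R]_z ((pos (- z.1)%R)%:E * F z).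
  rewrite -ge0_integralD//; first last.
  - exact: emeasurable_funM.
  - by move=> z _; rewrite mule_ge0.
  - exact: emeasurable_funM.
  - by move=> z _; rewrite mule_ge0.
  pose F2 (z : plane R) := (pos z.1)%:E * F z + (pos (- z.1)%R)%:E * F z.
  have F20 z : 0 <= F2 z by rewrite adde_ge0// mule_ge0.
  have mF2 : measurable_fun [set: plane R] F2.
    by apply: emeasurable_funD; exact: emeasurable_funM.
  rewrite /Leb (fubini_tonelli1 F mF F0) (fubini_tonelli1 F2 mF2 F20).
  (* The two open half-planes miss the axis x = 0, which is a single point of the outer integral. *)
  have mD : measurable ([set: measurableTypeR R] `\ 0%R) by exact: measurableD.
  rewrite -[LHS](integral_setD1 mD); last first.
    by apply: measurable_funTS; exact: (measurable_fun_fubini_tonelli_F (m2 := mu) F).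
  rewrite -[RHS](integral_setD1 mD); last first.
    by apply: measurable_funTS; exact: (measurable_fun_fubini_tonelli_F (m2 := mu) F2).
  apply: eq_integral => x /set_mem/= [_ /eqP x0].
  apply: eq_integral => y _; rewrite /F2/= -ge0_muleDl// -EFinD.
  rewrite (_ : pos x + pos (- x) = 1)%R ?mul1e//.
  have pE u : pos u = (0 < u)%R%:R%R.
    rewrite /pos indicE; congr ((nat_of_bool _)%:R)%R.
    by apply/idP/idP => [/set_mem|h]; rewrite ?inE /= in_itv/= andbT.
  by rewrite !pE oppr_gt0; case: (ltgtP x 0%R) x0; rewrite ?addr0 ?add0r.
rewrite Fsplit half// [X in _ + X]integral_reflect; first last.
- by move=> z; rewrite mule_ge0.
- exact: emeasurable_funM.
under [X in _ + X]eq_integral do rewrite /= opprK.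
rewrite (half (fun z => F (- z.1, - z.2)%R))//; last exact: measurableT_comp.
have -> : radial (fun z => F (- z.1, - z.2)%R) = fun t => radial F (t + pi)%R.
  by apply/funext => t; rewrite /radial; apply: eq_integral => r _; rewrite polpi.
have VT t : radial F (t + 2 * pi)%R = radial F t.
  by rewrite /radial; apply: eq_integral => r _; rewrite pol2pi.
have pi0 := @pi_gt0 R.
have := @integral_half_periods _ _ mV V0 _ _ VT a (pi / 2)%R.
rewrite (_ : 2 * (pi / 2) = pi)%R; last by rewrite mulrC divfK.
apply; rewrite ?mulr_gt0 ?divr_gt0//.
by lra.
Qed.

End PolarFull.

(** * Lattice tilings *)

Section Cmod.
Context {R : realType}.
Implicit Types z w : R[i].

Lemma cmodD z w : cmod (z + w) <= cmod z + cmod w. Proof. exact: le_normcD. Qed.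

Lemma cmodN z : cmod (- z) = cmod z. Proof. exact: normcN. Qed.

Lemma cmodM z w : cmod (z * w) = cmod z * cmod w. Proof. exact: ComplexField.Normc.normcM. Qed.

Lemma cmodB z w : cmod (z - w) <= cmod z + cmod w.
Proof. by rewrite (le_trans (cmodD _ _))// cmodN. Qed.

Lemma cmod_distC z w : cmod (z - w) = cmod (w - z).
Proof. by rewrite -cmodN opprB. Qed.

Lemma cmod_ge0 z : 0 <= cmod z.
Proof. by case: z => x y; rewrite /cmod /= sqrtr_ge0. Qed.

Lemma cmod0 : cmod (0 : R[i]) = 0. Proof. exact: ComplexField.Normc.normc0. Qed.

Lemma cmod_eq0 z : (cmod z == 0) = (z == 0).
Proof.
by apply/eqP/eqP => [/ComplexField.Normc.eq0_normc//|->]; rewrite cmod0.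
Qed.

Lemma cmod_gt0 z : (0 < cmod z) = (z != 0).
Proof. by rewrite lt_def cmod_ge0 andbT cmod_eq0. Qed.

Lemma cmodr (x : R) : cmod x%:C = `|x|.
Proof. by rewrite /cmod /= expr0n addr0 sqrtr_sqr. Qed.

Lemma cmod_triB z w : cmod z - cmod w <= cmod (z - w).
Proof. by rewrite lerBlDr (le_trans _ (cmodD _ _))// subrK. Qed.

Lemma complex_ofK : cancel (@plane_of R) (@complex_of R).
Proof. by case. Qed.

Lemma plane_ofK : cancel (@complex_of R) (@plane_of R).
Proof. by case. Qed.

End Cmod.

Section Translate.
Context {R : realType}.
Notation mu := (@lebesgue_measure R).
Local Open Scope ereal_scope.

Lemma integral_translate (F : plane R -> \bar R) (a b : R) :
  measurable_fun setT F -> (forall z, 0 <= F z) ->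
  \int[Leb R]_z F z = \int[Leb R]_z F (z.1 + a, z.2 + b)%R.
Proof.
move=> mF F0.
have mtr : measurable_fun [set: plane R] (fun z : plane R => (z.1 + a, z.2 + b)%R : plane R).
  by apply: measurable_fun_pair; apply: measurable_funD.
rewrite /Leb fubini_tonelli1// fubini_tonelli1//; last exact: measurableT_comp.
rewrite /fubini_F/=.
rewrite (@integral_affine R 1 a (fun x => \int[mu]_y F (x, y))) ?oner_eq0//; first last.
- by move=> y; exact: integral_ge0.
- exact: (measurable_fun_fubini_tonelli_F (m2 := mu) F).
apply: eq_integral => x _.
rewrite normr1 mul1e mul1r.
rewrite (@integral_affine R 1 b (fun y => F (x + a, y)%R)) ?oner_eq0//; first last.
- by apply: measurableT_comp => //; exact: pair1_measurable.
by apply: eq_integral => y _; rewrite normr1 mul1e mul1r.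
Qed.

Lemma Leb_box (x y r : R) : (0 <= r)%R ->
  Leb R (`[(x - r)%R, (x + r)%R] `*` `[(y - r)%R, (y + r)%R]) = (4 * r ^+ 2)%:E.
Proof.
move=> r0; transitivity (mu `[(x - r)%R, (x + r)%R] * mu `[(y - r)%R, (y + r)%R]).
  exact: product_measure1E.
rewrite !lebesgue_measure_itv/= !lte_fin.
have [->|r1] := eqVneq r 0%R.
  by rewrite !subr0 !addr0 !ltxx mul0e expr0n/= mulr0.
have rp : (0 < r)%R by rewrite lt_def r1.
have h (u : R) : (u - r < u + r)%R by rewrite ltrD2l (lt_trans _ rp)// oppr_lt0.
by rewrite !h -EFinM; congr EFin; ring.
Qed.

End Translate.

Section Lattice.
Context {R : realType}.
Variables (b : R[i] * R[i]) (L : set R[i]) (hb : is_Zbasis L b).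

Definition ldet : R :=
  complex.Re b.1 * complex.Im b.2 - complex.Im b.1 * complex.Re b.2.
(** Cramer's rule: [lc1] and [lc2] are the coordinates in the basis [b]. *)
Definition lc1 (z : R[i]) : R :=
  (complex.Re z * complex.Im b.2 - complex.Im z * complex.Re b.2) / ldet.
Definition lc2 (z : R[i]) : R :=
  (complex.Re b.1 * complex.Im z - complex.Im b.1 * complex.Re z) / ldet.

Lemma ldet_neq0 : ldet != 0.
Proof.
case: hb => ind _; apply/eqP; rewrite /ldet; move: ind.
case: b => [[u1 u2] [v1 v2]] /= ind D0.
have e1 : v2%:C * (u1 +i* u2) + (- u2)%:C * (v1 +i* v2) = 0.
  by apply/eqP; rewrite eq_complex /=; apply/andP; split; apply/eqP; lra.
have e2 : v1%:C * (u1 +i* u2) + (- u1)%:C * (v1 +i* v2) = 0.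
  by apply/eqP; rewrite eq_complex /=; apply/andP; split; apply/eqP; lra.
have [v20 /eqP] := ind _ _ e1; rewrite oppr_eq0 => /eqP u20.
have [v10 /eqP] := ind _ _ e2; rewrite oppr_eq0 => /eqP u10.
have e3 : 1%:C * (u1 +i* u2) + 1%:C * (v1 +i* v2) = 0.
  by apply/eqP; rewrite eq_complex /= u10 u20 v10 v20; apply/andP; split; apply/eqP; lra.
by have [/eqP] := ind _ _ e3; rewrite oner_eq0.
Qed.

Lemma lcE z : z = (lc1 z)%:C * b.1 + (lc2 z)%:C * b.2.
Proof.
have := ldet_neq0; rewrite /lc1 /lc2 /ldet.
case: b z => [[u1 u2] [v1 v2]] [x y] /= D0.
by apply/eqP; rewrite eq_complex /=; apply/andP; split; apply/eqP; field.
Qed.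

Lemma lc_comb (s t : R) : lc1 (s%:C * b.1 + t%:C * b.2) = s /\
  lc2 (s%:C * b.1 + t%:C * b.2) = t.
Proof.
have := ldet_neq0; rewrite /lc1 /lc2 /ldet.
by case: b => [[u1 u2] [v1 v2]] /= D0; split; field.
Qed.

Lemma lc1B z w : lc1 (z - w) = lc1 z - lc1 w.
Proof. by case: z w => [x y] [x' y']; rewrite /lc1 /= -mulrBl; congr (_ / _); ring. Qed.

Lemma lc2B z w : lc2 (z - w) = lc2 z - lc2 w.
Proof. by case: z w => [x y] [x' y']; rewrite /lc2 /= -mulrBl; congr (_ / _); ring. Qed.

(** Bound for the coordinates in terms of the modulus. Its inverse is a lower bound for the length
    of nonzero lattice vectors, since one of their integer coordinates is nonzero
    ([lattice_min]). *)
Definition lK : R := (`|complex.Re b.1| + `|complex.Im b.1| +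
  `|complex.Re b.2| + `|complex.Im b.2|) / `|ldet|.

Lemma lc_le z : `|lc1 z| <= lK * cmod z /\ `|lc2 z| <= lK * cmod z.
Proof.
have [h1 h2] := cmod_Re_Im z.
have D0 : 0 < `|ldet| by rewrite normr_gt0 ldet_neq0.
rewrite /lc1 /lc2 /lK !normrM normfV mulrAC !ler_pM2r ?invr_gt0//.
have key (a c x y : R) : `|x| <= cmod z -> `|y| <= cmod z ->
    `|x * a - y * c| <= (`|a| + `|c|) * cmod z.
  move=> hx hy; rewrite (le_trans (ler_normB _ _))// !normrM mulrDl.
  by apply: lerD; rewrite mulrC ler_wpM2l.
have c0 := cmod_ge0 z.
split.
  apply: (le_trans (key _ _ _ _ h1 h2)); rewrite ler_wpM2r//.
  have := normr_ge0 (complex.Re b.1); have := normr_ge0 (complex.Im b.1); lra.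
rewrite [complex.Re b.1 * _]mulrC [complex.Im b.1 * _]mulrC.
apply: (le_trans (key _ _ _ _ h2 h1)); rewrite ler_wpM2r//.
have := normr_ge0 (complex.Re b.2); have := normr_ge0 (complex.Im b.2); lra.
Qed.

Lemma lK_gt0 : 0 < lK.
Proof.
rewrite divr_gt0 ?normr_gt0 ?ldet_neq0//.
have D0 := ldet_neq0.
rewrite lt_def !addr_ge0// andbT; apply: contra D0.
rewrite paddr_eq0 ?addr_ge0 ?normr_ge0// paddr_eq0 ?addr_ge0 ?normr_ge0// paddr_eq0 ?normr_ge0// !normr_eq0 => /andP[/andP[/andP[/eqP h1 /eqP h2] _] _].
by rewrite /ldet h1 h2 !mul0r subrr.
Qed.

Definition tile (n : R[i]) : set (plane R) :=
  [set z | 0 <= lc1 (complex_of z - n) < 1 /\ 0 <= lc2 (complex_of z - n) < 1].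

Lemma fundamental_tile : @plane_of R @` fundamental_parallelogram b = tile 0.
Proof.
apply/seteqP; split => [_ [z [s [t [hs ht ->]]] <-]|z].
  by rewrite /tile /= complex_ofK subr0; have [-> ->] := lc_comb s t.
rewrite /tile /= subr0 => -[h1 h2]; exists (complex_of z); last exact: plane_ofK.
by exists (lc1 (complex_of z)), (lc2 (complex_of z)); split=> //; exact: lcE.
Qed.

Definition ldiam : R := cmod b.1 + cmod b.2.

Lemma tile_dist n z : tile n z -> cmod (complex_of z - n) <= ldiam.
Proof.
case=> /andP[h1 h2] /andP[h3 h4]; rewrite [_ - _]lcE (le_trans (cmodD _ _))//.
rewrite !cmodM !cmodr !ger0_norm//.
by apply: lerD; rewrite ler_piMl ?cmod_ge0// ltW.
Qed.

Lemma ldiam_gt0 : 0 < ldiam.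
Proof.
rewrite lt_def addr_ge0 ?cmod_ge0// andbT.
apply: contra ldet_neq0; rewrite paddr_eq0 ?cmod_ge0// !cmod_eq0 => /andP[/eqP h _].
by rewrite /ldet h /= !mul0r subrr.
Qed.

Lemma measurable_lc1 : measurable_fun [set: plane R] (fun z => lc1 (complex_of z)).
Proof.
rewrite /lc1 /complex_of/=; apply: measurable_funM => //.
by apply: measurable_funB; apply: measurable_funM.
Qed.

Lemma measurable_lc2 : measurable_fun [set: plane R] (fun z => lc2 (complex_of z)).
Proof.
rewrite /lc2 /complex_of/=; apply: measurable_funM => //.
by apply: measurable_funB; apply: measurable_funM.
Qed.

Lemma measurable_tile n : measurable (tile n).
Proof.
have E : tile n = (fun z => lc1 (complex_of z)) @^-1` `[lc1 n, (lc1 n + 1)[ `&`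
  (fun z => lc2 (complex_of z)) @^-1` `[lc2 n, (lc2 n + 1)[.
  apply/seteqP; split => z; rewrite /tile /= !lc1B !lc2B !in_itv/= !subr_ge0;
  by rewrite !ltrBlDr ![_ + 1]addrC.
rewrite E; apply: measurableI.
  rewrite -[X in measurable X]setTI; apply: measurable_lc1 => //.
rewrite -[X in measurable X]setTI; apply: measurable_lc2 => //.
Qed.

Lemma lattice_lc p : L p <-> exists i j : int, lc1 p = i%:~R /\ lc2 p = j%:~R.
Proof.
have zC (w : R[i]) (n : int) : w *~ n = (n%:~R)%:C * w.
  by rewrite -mulrzl rmorph_int.
case: hb => _ ->; split => [[i [j ->]]|[i [j [h1 h2]]]].
  by exists i, j; rewrite !zC; exact: lc_comb.
by exists i, j; rewrite !zC -h1 -h2; exact: lcE.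
Qed.

Lemma latticeB p q : L p -> L q -> L (p - q).
Proof.
move=> /lattice_lc[i [j [h1 h2]]] /lattice_lc[i' [j' [h3 h4]]].
by apply/lattice_lc; exists (i - i'), (j - j'); rewrite lc1B lc2B h1 h2 h3 h4 !intrB.
Qed.

Lemma lattice_min p : L p -> p != 0 -> 1 <= lK * cmod p.
Proof.
move=> /lattice_lc[i [j [h1 h2]]] p0.
have [i0|i0] := eqVneq i 0.
  have [j0|j0] := eqVneq j 0.
    by case/eqP : p0; rewrite (lcE p) h1 h2 i0 j0 !mul0r addr0.
  apply: le_trans (proj2 (lc_le p)); rewrite h2 -intr_norm (ler_int R 1).
  by rewrite -gtz0_ge1 normr_gt0.
apply: le_trans (proj1 (lc_le p)); rewrite h1 -intr_norm (ler_int R 1).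
by rewrite -gtz0_ge1 normr_gt0.
Qed.

Lemma tile_exists z0 z : exists2 n, Zgrid z0 L n & tile n z.
Proof.
pose i := Num.floor (lc1 (complex_of z - z0)).
pose j := Num.floor (lc2 (complex_of z - z0)).
pose p : R[i] := (i%:~R)%:C * b.1 + (j%:~R)%:C * b.2.
have [p1 p2] := lc_comb i%:~R j%:~R.
exists (z0 + p).
  by exists p => //; apply/lattice_lc; exists i, j.
rewrite /tile /= opprD addrA !lc1B !lc2B p1 p2 -lc1B -lc2B.
rewrite !subr_ge0 !ge_floor !ltrBlDr ![1 + _]addrC/=.
split.
  by have := lt_succ_floor (lc1 (complex_of z - z0)); rewrite intrD.
by have := lt_succ_floor (lc2 (complex_of z - z0)); rewrite intrD.
Qed.

(** The coordinates of the difference of the base points are integers, and differences of two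
    numbers of [0, 1[, hence 0. *)
Lemma tile_inj z0 z n m : Zgrid z0 L n -> Zgrid z0 L m ->
  tile n z -> tile m z -> n = m.
Proof.
move=> [p Lp <-] [q Lq <-] [a1 a2] [b1 b2].
have /lattice_lc[i [j [h1 h2]]] := latticeB Lp Lq.
have key (x y : R) (k : int) : 0 <= x < 1 -> 0 <= y < 1 -> y - x = k%:~R -> k = 0.
  move=> /andP[x0 x1] /andP[y0 y1] e.
  have k1 : (k%:~R < 1%:~R :> R) by rewrite -e; lra.
  have k2 : ((-1)%:~R < k%:~R :> R) by rewrite -e mulrN1z; lra.
  by move: k1 k2; rewrite !ltr_int; case: k {e} => [[|k]|[|k]].
have e (w v u : R) : w - u - (w - v) = v - u by ring.
have i0 : i = 0.
  apply: (key _ _ i a1 b1); rewrite -lc1B -h1; congr lc1; ring.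
have j0 : j = 0.
  apply: (key _ _ j a2 b2); rewrite -lc2B -h2; congr lc2; ring.
have /eqP : p - q = 0 by rewrite (lcE (p - q)) h1 h2 i0 j0 !mul0r addr0.
by rewrite subr_eq0 => /eqP ->.
Qed.

End Lattice.

(** * Comparison of sums over a grid with plane integrals *)

Section TileSum.
Context {R : realType}.
Variables (b : R[i] * R[i]) (L : set R[i]) (hb : is_Zbasis L b).

(** A square around the disk of radius r, precise enough for upper bounds of areas; the zeros make
    it an instance of [Leb_box]. *)
Definition cbox (r : R) : set (plane R) := `[0 - r, 0 + r] `*` `[0 - r, 0 + r].

Lemma measurable_cbox r : measurable (cbox r).
Proof. exact: measurableX. Qed.

Lemma Leb_cbox r : 0 <= r -> Leb R (cbox r) = (4 * r ^+ 2)%:E.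
Proof. exact: Leb_box. Qed.

Lemma cmod_cbox (z : plane R) r : cmod (complex_of z) <= r -> cbox r z.
Proof.
have [/= h1 h2] := cmod_Re_Im (complex_of z).
move=> zr; split => /=; rewrite in_itv/= sub0r add0r -ler_norml.
  exact: le_trans zr.
exact: le_trans zr.
Qed.

Lemma Leb_tile n : Leb R (tile b n) = Leb R (tile b 0).
Proof.
have m0 k := measurable_tile b k.
have iE k : Leb R (tile b k) = (\int[Leb R]_z (\1_(tile b k) z)%:E)%E.
  by rewrite integral_indic// setIT.
rewrite !iE.
have mI : measurable_fun [set: plane R] (fun z => (\1_(tile b n) z : R)%:E).
  by apply/measurable_EFinP; exact: measurable_indic.
rewrite (@integral_translate R _ (complex.Re n) (complex.Im n) mI)//.
apply: eq_integral => z _; congr EFin; rewrite !indicE; congr ((nat_of_bool _)%:R).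
have e : complex_of (z.1 + complex.Re n, z.2 + complex.Im n) - n = complex_of z - 0.
  by rewrite /complex_of; case: n {mI} => x y /=; apply/eqP;
     rewrite eq_complex /= !subr0 !addrK !eqxx.
by apply/idP/idP => /set_mem h; apply/mem_set; move: h; rewrite /tile /= e.
Qed.

Definition lvol : R := fine (Leb R (tile b 0)).

Lemma Leb_tile0_lty : (Leb R (tile b 0%R) < +oo)%E.
Proof.
apply: (@le_lt_trans _ _ (Leb R (cbox (ldiam b)))); last first.
  by rewrite Leb_cbox ?ltry// ltW// (ldiam_gt0 hb).
rewrite le_measure ?inE//.
- exact: measurable_tile.
- exact: measurable_cbox.
move=> z tz; apply: cmod_cbox.
by rewrite -[X in cmod X]subr0; exact: (tile_dist hb).
Qed.

Lemma Leb_tileE n : Leb R (tile b n) = lvol%:E.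
Proof.
by rewrite Leb_tile /lvol fineK// ge0_fin_numE ?Leb_tile0_lty.
Qed.

Lemma lvol_gt0 : 0 < lvol.
Proof.
rewrite -lte_fin -(Leb_tileE 0).
pose c : R[i] := (2^-1)%:C * b.1 + (2^-1)%:C * b.2.
have K0 := lK_gt0 hb.
(* A point of the square of half-side e around the centre is within 2 e of it, so its coordinates
   differ from 1/2 by at most 1/4. *)
pose e := (8 * lK b)^-1.
have e0 : 0 < e by rewrite invr_gt0 mulr_gt0.
apply: (@lt_le_trans _ _ (Leb R (`[complex.Re c - e, complex.Re c + e] `*`
   `[complex.Im c - e, complex.Im c + e]))).
  by rewrite Leb_box ?ltW// lte_fin mulr_gt0// exprn_gt0.
rewrite le_measure ?inE//.
- exact: measurableX.
- exact: measurable_tile.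
move=> [x y] [/=]; rewrite !in_itv/= => hx hy.
have hd : cmod ((x +i* y) - c) <= 2 * e.
  have -> : (x +i* y) - c = (x - complex.Re c)%:C + (0 +i* (y - complex.Im c)).
    by case: (c) => c1 c2; apply/eqP; rewrite eq_complex /= add0r addr0 !eqxx.
  rewrite (le_trans (cmodD _ _))// mulr_natl; apply: lerD.
    by rewrite cmodr ler_distl.
  by rewrite /cmod /= expr0n/= add0r sqrtr_sqr ler_distl.
have [] := lc_le hb ((x +i* y) - c).
have [c1 c2] := lc_comb hb 2^-1 2^-1.
rewrite lc1B lc2B c1 c2 => h1 h2.
have K2 : lK b * cmod ((x +i* y) - c) <= 4^-1.
  apply: (le_trans (ler_wpM2l (ltW K0) hd)).
  rewrite /e le_eqVlt; apply/orP; left; apply/eqP.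
  by field; rewrite gt_eqF.
move: (le_trans h1 K2) (le_trans h2 K2); rewrite !ler_norml.
rewrite /tile /= subr0 => /andP[a1 a2] /andP[a3 a4].
by split; apply/andP; split; lra.
Qed.

Variable z0 : R[i].
Notation Lam := (Zgrid z0 L).

(** The sum times the area of a tile is the integral of the step function equal to [H n] on the tile
    of [n], because the tiles partition the plane. A pointwise bound [g] on its distance to [F] is
    integrated in both directions, in the extended reals. It serves for counting, for the pairs at
    fixed p, and for the sum over p. *)
Lemma tile_sum (S : seq R[i]) (H : R[i] -> R) (F g : plane R -> R) :
  uniq S -> (forall n, n \in S -> Lam n) -> (forall n, 0 <= H n) ->
  measurable_fun setT F -> (forall z, 0 <= F z) ->
  measurable_fun setT g -> (forall z, 0 <= g z) ->
  (forall n z, Lam n -> tile b n z ->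
     `|(if n \in S then H n else 0) - F z| <= g z) ->
  ((lvol * \sum_(n <- S) H n)%:E <=
     \int[Leb R]_z (F z)%:E + \int[Leb R]_z (g z)%:E)%E /\
  (\int[Leb R]_z (F z)%:E <=
     (lvol * \sum_(n <- S) H n)%:E + \int[Leb R]_z (g z)%:E)%E.
Proof.
move=> uS SL H0 mF F0 mg g0 HF.
pose Hs (z : plane R) := \sum_(n <- S) (H n * \1_(tile b n) z).
have mt n : measurable_fun [set: plane R] (fun z => H n * \1_(tile b n) z).
  by apply: measurable_funM => //; apply: measurable_indic; exact: measurable_tile.
have mHs : measurable_fun [set: plane R] Hs by exact: measurable_sum.
have Hs0 z : 0 <= Hs z by apply: sumr_ge0 => n _; rewrite mulr_ge0.
have HsE n z : Lam n -> tile b n z -> Hs z = if n \in S then H n else 0.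
  move=> Ln tn; rewrite /Hs; case: ifPn => nS.
    rewrite (bigD1_seq n)//= indicE mem_set// mulr1 big1_seq ?addr0// => m /andP[mn mS].
    rewrite indicE memNset ?mulr0// => tm.
    by move/eqP: mn; apply; exact: (tile_inj hb (SL _ mS) Ln tm tn).
  rewrite big1_seq// => m /= mS; rewrite indicE memNset ?mulr0// => tm.
  by move: nS; rewrite (tile_inj hb Ln (SL _ mS) tn tm) mS.
have intHs : (\int[Leb R]_z (Hs z)%:E = (lvol * \sum_(n <- S) H n)%:E)%E.
  under eq_integral do rewrite /Hs -sumEFin.
  rewrite ge0_integral_sum//; first last.
  - by move=> n z _; rewrite lee_fin mulr_ge0.
  - by move=> n; apply/measurable_EFinP; exact: mt.
  rewrite mulr_sumr -sumEFin; apply: eq_bigr => n _.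
  under eq_integral do rewrite EFinM.
  rewrite ge0_integralZl ?lee_fin//; last first.
    by apply/measurable_EFinP; apply: measurable_indic; exact: measurable_tile.
  rewrite integral_indic// ?setIT; last exact: measurable_tile.
  by rewrite Leb_tileE -EFinM mulrC.
have close z : `|Hs z - F z| <= g z.
  have [n Ln tn] := tile_exists hb z0 z.
  by rewrite (HsE n)//; exact: HF.
have mE (h : plane R -> R) : measurable_fun setT h ->
  measurable_fun setT (fun z => (h z)%:E) by move=> mh; exact/measurable_EFinP.
rewrite -intHs -!ge0_integralD//;
  try (by move=> *; rewrite lee_fin); try exact: mE.
split; apply: ge0_le_integral => //; try (by move=> *; rewrite lee_fin ?addr_ge0);
  try exact: mE; try (by apply: emeasurable_funD; exact: mE).
- by move=> z _; rewrite -EFinD lee_fin; have := close z; rewrite ler_norml; lra.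
- by move=> z _; rewrite -EFinD lee_fin; have := close z; rewrite ler_norml; lra.
Qed.

Lemma lattice_count (S : seq R[i]) (T : R) : 0 <= T ->
  uniq S -> (forall n, n \in S -> Lam n) ->
  (forall n, n \in S -> cmod n <= T) ->
  lvol * (size S)%:R <= 4 * (T + ldiam b) ^+ 2.
Proof.
move=> T0 uS SL ST.
have d0 := ldiam_gt0 hb.
have mI : measurable_fun [set: plane R] (\1_(cbox (T + ldiam b)) : plane R -> R).
  by apply: measurable_indic; exact: measurable_cbox.
have [] := @tile_sum S (fun=> 1) (cst 0) (\1_(cbox (T + ldiam b))) uS SL _ _ _ mI _ _ => //.
  move=> n z Ln tn; rewrite subr0; case: ifPn => nS; last by rewrite normr0.
  rewrite normr1 indicE mem_set//; apply: cmod_cbox.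
  rewrite -[complex_of z](subrK n) (le_trans (cmodD _ _))// addrC lerD ?ST//.
  exact: (tile_dist hb).
move=> + _; rewrite integral0 add0e integral_indic ?setIT//; last exact: measurable_cbox.
have Td : 0 <= T + ldiam b by rewrite addr_ge0 // ltW.
rewrite Leb_cbox// lee_fin => h; apply: le_trans h.
by rewrite big_const_seq count_predT iter_addr_0.
Qed.

End TileSum.

(** * Complex powers *)

Section ExpEstimates.
Context {R : realType}.
Implicit Types a b t : R.

(** The exponential of a + i b. A power at level k is [cexp] of a multiple of the logarithm, so
    ratios of powers become exponentials of scaled increments of the logarithm. *)
Definition cexp a b : R[i] := (expR a)%:C * expi b.

Lemma cmodE (x y : R) : cmod (x +i* y) ^+ 2 = x ^+ 2 + y ^+ 2.
Proof. by rewrite /cmod /= sqr_sqrtr// addr_ge0// sqr_ge0. Qed.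

Lemma cmod_le_sum (x y : R) : cmod (x +i* y) <= `|x| + `|y|.
Proof.
rewrite -(@ler_pXn2r _ 2)// ?nnegrE ?cmod_ge0 ?addr_ge0//.
rewrite cmodE sqrrD !real_normK ?num_real// lerD2r lerDl mulrn_wge0//.
Qed.

Lemma expiD a b : expi (a + b) = expi a * expi b.
Proof.
by apply/eqP; rewrite /expi eq_complex /= cosD sinD eqxx/=; apply/eqP; ring.
Qed.

Lemma cmod_expi a : cmod (expi a) = 1.
Proof. by rewrite /cmod /= cos2Dsin2 sqrtr1. Qed.

Lemma cexpD a b a' b' : cexp (a + a') (b + b') = cexp a b * cexp a' b'.
Proof. by rewrite /cexp expiD expRD rmorphM mulrACA. Qed.

(** Two nonnegative terms, one for the modulus and one for the angle: each is controlled by the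
    whole. *)
Lemma sqr_cmod_cexpB1 a b :
  cmod (cexp a b - 1) ^+ 2 = (expR a - 1) ^+ 2 + 4 * expR a * sin (b / 2) ^+ 2.
Proof.
have -> : cexp a b - 1 = (expR a * cos b - 1) +i* (expR a * sin b).
  by apply/eqP; rewrite /cexp eq_complex /= !mul0r subr0 addr0 oppr0 addr0 !eqxx.
rewrite cmodE.
have e : cos b = 1 - 2 * sin (b / 2) ^+ 2.
  rewrite [in LHS](_ : b = b / 2 + b / 2); last by field.
  by rewrite cosD -!expr2 cos2sin2; ring.
have e2 : sin b ^+ 2 = 1 - cos b ^+ 2 by rewrite sin2cos2.
rewrite exprMn e2 e; ring.
Qed.

Lemma sin_mvt t : exists2 x, `|x| <= `|t| & sin t = t * cos x.
Proof.
have dsin (x : R) : is_derive x (1 : R) (@sin R) (cos x) by exact: is_derive_sin.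
have cs (D : set R) : {within D, continuous (@sin R)}.
  by apply: continuous_subspaceT; exact: continuous_sin.
have [t0|t0|<-] := ltgtP 0 t; last by exists 0; rewrite // sin0 mul0r.
  have [x /=] := @MVT R sin cos 0 t t0 (fun x _ => dsin x) (cs _).
  rewrite in_itv/= sin0 !subr0 => /andP[x0 xt] ->.
  by exists x; rewrite 1?mulrC// !gtr0_norm// ltW.
have [x /=] := @MVT R sin cos t 0 t0 (fun x _ => dsin x) (cs _).
rewrite in_itv/= sin0 !sub0r mulrN => /andP[tx x0] /oppr_inj ->.
by exists x; rewrite 1?mulrC// !ltr0_norm// lerN2 ltW.
Qed.

Lemma sin_le_norm t : `|sin t| <= `|t|.
Proof.
have [x _ ->] := sin_mvt t; rewrite normrM ler_piMr//; exact: cos_max.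
Qed.

Lemma cosB1_le t : `|1 - cos t| <= t ^+ 2 / 2.
Proof.
have -> : 1 - cos t = 2 * sin (t / 2) ^+ 2.
  rewrite [in LHS](_ : t = t / 2 + t / 2); last by field.
  by rewrite cosD -!expr2 cos2sin2; ring.
have h : `|sin (t / 2)| ^+ 2 <= `|t / 2| ^+ 2.
  by rewrite ler_pXn2r// ?nnegrE// sin_le_norm.
rewrite !real_normK ?num_real// in h.
rewrite ger0_norm; last by rewrite mulr_ge0// sqr_ge0.
by rewrite (_ : t ^+ 2 / 2 = 2 * (t / 2) ^+ 2) ?ler_pM2l//; field.
Qed.

Lemma sinB_le t : `|t| <= 1 -> `|sin t - t| <= t ^+ 2.
Proof.
move=> t1; have [x xt ->] := sin_mvt t.
rewrite -[X in _ - X]mulr1 -mulrBr normrM distrC.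
have h := cosB1_le x.
have x2 : x ^+ 2 <= `|t|.
  rewrite -(real_normK (num_real x)) expr2 -[X in _ <= X]mulr1.
  by rewrite ler_pM// (le_trans xt).
rewrite -[t ^+ 2](real_normK (num_real t)) expr2 ler_wpM2l//.
by rewrite (le_trans h)// ler_pdivrMr// (le_trans x2)// mulr_natr mulr2n lerDl.
Qed.

Lemma expRB1B_le a : `|a| <= 2^-1 -> `|expR a - 1 - a| <= 2 * a ^+ 2.
Proof.
rewrite ler_norml => /andP[h1 h2].
have l := expR_ge1Dx a; have l' := expR_ge1Dx (- a).
rewrite ger0_norm; last lra.
have p := expR_gt0 a.
have : expR a * (1 - a) <= 1.
  by rewrite (le_trans (ler_wpM2l (ltW p) l'))// expRxMexpNx_1.
nra.
Qed.

Lemma cexp_taylor a b : `|a| + `|b| <= 2^-1 ->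
  cmod (cexp a b - 1 - (a +i* b)) <= 2 * (`|a| + `|b|) ^+ 2.
Proof.
move=> ab.
have a0 := normr_ge0 a; have b0 := normr_ge0 b.
have ea := @expRB1B_le a _; have sb := @sinB_le b _; have cb := cosB1_le b.
have ha : `|a| <= 2^-1 by lra.
have hb : `|b| <= 1 by lra.
move: (ea ha) (sb hb) => {}ea {}sb.
have -> : cexp a b - 1 - (a +i* b) =
    (expR a * cos b - 1 - a) +i* (expR a * sin b - b).
  by apply/eqP; rewrite /cexp eq_complex /= !mul0r subr0 addr0 oppr0 addr0 !eqxx.
apply: (le_trans (cmod_le_sum _ _)).
have sn := sin_le_norm b.
have e0 := expR_gt0 a.
have e2 : expR a <= 2.
  move: ea; rewrite ler_norml => /andP[_]; move: ha; rewrite ler_norml => /andP[].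
  by nra.
have h1 : `|expR a * cos b - 1 - a| <= 2 * a ^+ 2 + b ^+ 2.
  have -> : expR a * cos b - 1 - a = (expR a - 1 - a) - expR a * (1 - cos b) by ring.
  apply: (le_trans (ler_normB _ _)); rewrite lerD// normrM gtr0_norm//.
  apply: (@le_trans _ _ (2 * (b ^+ 2 / 2))); last by rewrite mulrCA divff ?mulr1.
  by rewrite ler_pM// ltW.
have h2 : `|expR a * sin b - b| <= 2 * (`|a| * `|b|) + b ^+ 2.
  have -> : expR a * sin b - b = (expR a - 1) * sin b + (sin b - b) by ring.
  apply: (le_trans (ler_normD _ _)); rewrite lerD// normrM mulrA ler_pM//.
  have -> : expR a - 1 = (expR a - 1 - a) + a by ring.
  apply: (le_trans (ler_normD _ _)).
  have : a ^+ 2 <= 2^-1 * `|a|.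
    by rewrite -(real_normK (num_real a)) expr2 ler_wpM2r.
  lra.
apply: (le_trans (lerD h1 h2)).
rewrite -(real_normK (num_real a)) -(real_normK (num_real b)).
have := mulr_ge0 a0 b0; move: (`|a|) (`|b|) => x y; nra.
Qed.

Lemma cexpB1_le a b : `|a| + `|b| <= 2^-1 ->
  cmod (cexp a b - 1) <= 2 * (`|a| + `|b|).
Proof.
move=> ab; have := cexp_taylor ab => h.
have -> : cexp a b - 1 = (cexp a b - 1 - (a +i* b)) + (a +i* b) by rewrite subrK.
apply: (le_trans (cmodD _ _)); have h' := cmod_le_sum a b.
have a0 := normr_ge0 a; have b0 := normr_ge0 b.
set x := `|a| + `|b| in ab h h' *.
have x0 : 0 <= x by rewrite addr_ge0.
nra.
Qed.

(* [sin t = 2 sin (t/2) cos (t/2)] and both half-angle factors are bounded below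
   by [cos (g/2)], the first one by the mean value theorem. *)
Lemma sin_lower (g t : R) : g < pi -> 0 <= t <= g -> t * cos (g / 2) ^+ 2 <= sin t.
Proof.
move=> gpi /andP[t0 tg].
have h1 : 0 <= t / 2 by rewrite divr_ge0.
have pi0 := @pi_gt0 R.
have cg : 0 < cos (g / 2) by apply: cos_gt0_pihalf; lra.
have cmono x : 0 <= x <= g / 2 -> cos (g / 2) <= cos x.
  move=> /andP[x0 xg]; rewrite leNgt ltr_cos ?in_itv/=; [lra|lra|lra].
have [x xt sx] := sin_mvt (t / 2).
have -> : sin t = 2 * sin (t / 2) * cos (t / 2).
  rewrite [in LHS](_ : t = t / 2 + t / 2); last by field.
  by rewrite sinD; ring.
have cx : cos (g / 2) <= cos x.
  rewrite -(cos_norm x) cmono// normr_ge0/= (le_trans xt)// ger0_norm//; lra.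
have ct : cos (g / 2) <= cos (t / 2) by apply: cmono; lra.
rewrite sx (_ : 2 * (t / 2 * cos x) * cos (t / 2) = t * (cos x * cos (t / 2))); last by field.
by rewrite ler_wpM2l// expr2 ler_pM// ltW.
Qed.

(** Local inversion of the exponential. The angle must stay away from 2 pi, where the exponential
    returns to 1. The two uses take g = pi, for points on one side of the real axis, and g = 2 pi
    alpha, for the power alpha on a whole branch. *)
Lemma cexpB1_lower (g : R) : 0 < g < 2 * pi -> exists2 c, 0 < c &
  forall a b, `|b| <= g -> cmod (cexp a b - 1) <= 2^-1 ->
    `|a| + `|b| <= c * cmod (cexp a b - 1).
Proof.
move=> /andP[g0 g2].
set k := cos (g / 2 / 2) ^+ 2.
have k0 : 0 < k by rewrite exprn_gt0//; apply: cos_gt0_pihalf; lra.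
exists (2 + 2 / k); first by rewrite addr_gt0// divr_gt0.
move=> a b bg E12; set E := cmod _ in E12 *.
have E0 : 0 <= E by exact: cmod_ge0.
have := sqr_cmod_cexpB1 a b; rewrite -/E => EE.
have e0 := expR_gt0 a.
have s0 := sqr_ge0 (sin (b / 2)).
have ea : `|expR a - 1| <= E.
  rewrite -(@ler_pXn2r _ 2)// ?nnegrE// real_normK ?num_real// EE lerDl.
  by rewrite mulr_ge0// mulr_ge0// ltW.
have e12 : 2^-1 <= expR a.
  by move: (le_trans ea E12); rewrite ler_norml; lra.
have ha : `|a| <= 2 * E.
  apply: (@le_trans _ _ (2 * `|expR a - 1|)); last by rewrite ler_wpM2l.
  have l := expR_ge1Dx a; have l' := expR_ge1Dx (- a).
  have [a0|a0] := leP 0 a.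
    rewrite (ger0_norm a0) ger0_norm; lra.
  have ea1 : expR a <= 1 by rewrite expR_le1 ltW.
  rewrite (ltr0_norm a0) ler0_norm; last lra.
  have l2 : expR a * (1 - a) <= 1.
    by rewrite (le_trans (ler_wpM2l (ltW e0) l'))// expRxMexpNx_1.
  nra.
have hs : `|sin (b / 2)| <= E.
  rewrite -(@ler_pXn2r _ 2)// ?nnegrE// real_normK ?num_real// EE.
  have := sqr_ge0 (expR a - 1); nra.
have hb : `|b| <= 2 / k * E.
  have : `|b| / 2 * k <= sin (`|b| / 2).
    have nb := normr_ge0 b; apply: sin_lower; first lra.
    by apply/andP; split; lra.
  have : sin (`|b| / 2) <= `|sin (b / 2)|.
    have [b0|b0] := leP 0 b; first by rewrite (ger0_norm b0) ler_norm.
    by rewrite (ltr0_norm b0) mulNr sinN -normrN ler_norm.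
  move=> h1 h2; rewrite mulrAC ler_pdivlMr//.
  by have := le_trans h2 (le_trans h1 hs); lra.
by rewrite mulrDl lerD.
Qed.

End ExpEstimates.

Section BranchArg.
Context {R : realType}.
Implicit Types (z w : R[i]) (t : R) (k : int).

Lemma two_piS k : 2 * pi * (k + 1)%:~R = 2 * pi * k%:~R + 2 * pi :> R.
Proof. by rewrite intrD mulrDr [1%:~R]mulr1z mulr1. Qed.

Lemma expiz t k : expi (t + 2 * pi * k%:~R) = expi t.
Proof.
have per n (u : R) : expi (u + 2 * pi * n%:R) = expi u.
  elim: n => [|n ih]; first by rewrite mulr0 addr0.
  rewrite -[n.+1%:R]natr1 mulrDr mulr1 addrA /expi [2 * pi as X in _ + X]mulr_natl.
  by rewrite cosD2pi sinD2pi.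
case: k => n; first exact: per.
rewrite NegzE mulrNz mulrN -[in RHS](subrK (2 * pi * n.+1%:R) t).
by rewrite per.
Qed.

Lemma arg0_exists z : z != 0 ->
  exists2 w : R, 0 <= w < 2 * pi & z = (cmod z)%:C * expi w.
Proof.
move=> z0; have m0 : 0 < cmod z by rewrite cmod_gt0.
have pi0 := @pi_gt0 R.
case: z z0 m0 => x y z0; set m := cmod _ => m0.
have mE : m ^+ 2 = x ^+ 2 + y ^+ 2 by rewrite cmodE.
have xm : -1 <= x / m <= 1.
  rewrite -ler_norml normrM normfV (gtr0_norm m0) ler_pdivrMr// mul1r.
  by rewrite -(@ler_pXn2r _ 2)// ?nnegrE ?(ltW m0)// real_normK ?num_real// mE lerDl sqr_ge0.
have s2 : (m * sin (acos (x / m))) ^+ 2 = y ^+ 2.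
  rewrite exprMn sin2cos2 acosK ?in_itv//= (_ : m ^+ 2 * (1 - (x / m) ^+ 2) = m ^+ 2 - x ^+ 2); last by field; rewrite gt_eqF.
  by rewrite mE addrAC subrr add0r.
have c : m * cos (acos (x / m)) = x.
  by rewrite acosK ?in_itv//= mulrC divfK// gt_eqF.
have a0 := acos_ge0 xm; have a1 := acos_lepi xm.
have s0 : 0 <= m * sin (acos (x / m)).
  by rewrite mulr_ge0 ?(ltW m0)// sin_ge0_pi// a0.
have [y0|y0] := leP 0 y.
  exists (acos (x / m)); first by apply/andP; split; lra.
  apply/eqP; rewrite eq_complex /= !mul0r subr0 addr0 c eqxx/=.
  by rewrite -(@eqrXn2 _ 2)// s2.
exists (2 * pi - acos (x / m)).
  apply/andP; split; first lra.
  rewrite ltrBlDr ltrDl lt_def a0 andbT; apply/eqP => e.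
  by move: s2; rewrite e sin0 mulr0 expr0n/= => /esym/eqP; rewrite sqrf_eq0 lt_eqF.
rewrite addrC; apply/eqP; rewrite /expi [2 * pi]mulr_natl cosD2pi sinD2pi.
rewrite cosN sinN eq_complex /= !mul0r subr0 addr0 c eqxx/=.
by rewrite mulrN -eqr_oppLR -(@eqrXn2 _ 2)// ?sqrrN ?s2// oppr_ge0 ltW.
Qed.

Lemma expi_inj t t' : `|t - t'| < 2 * pi -> expi t = expi t' -> t = t'.
Proof.
move=> d [ec es]; apply/eqP; rewrite -subr_eq0.
have c1 : cos (t - t') = 1 by rewrite cosB ec es -!expr2 cos2Dsin2.
have s0 : sin ((t - t') / 2) = 0.
  have : 2 * sin ((t - t') / 2) ^+ 2 = 0.
    have : cos (t - t') = 1 - 2 * sin ((t - t') / 2) ^+ 2.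
      rewrite [in LHS](_ : t - t' = (t - t') / 2 + (t - t') / 2); last by field.
      by rewrite cosD -!expr2 cos2sin2; ring.
    by rewrite c1; lra.
  by move=> /eqP; rewrite mulf_eq0 pnatr_eq0/= sqrf_eq0 => /eqP.
move: (t - t') d s0 => u d s0.
have [u0|u0|//] := ltgtP u 0.
  suff : 0 < sin (- u / 2) by rewrite mulNr sinN s0 oppr0 ltxx.
  rewrite ltr0_norm// in d; apply: sin_gt0_pi; apply/andP; split; lra.
suff : 0 < sin (u / 2) by rewrite s0 ltxx.
rewrite gtr0_norm// in d; apply: sin_gt0_pi; apply/andP; split; lra.
Qed.

Lemma branch_argP k z : z != 0 ->
  [/\ 2 * pi * k%:~R <= branch_arg k z, branch_arg k z < 2 * pi * (k + 1)%:~R &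
      z = (cmod z)%:C * expi (branch_arg k z)].
Proof.
move=> z0; rewrite /branch_arg.
have [w /andP[w0 w1] zE] := arg0_exists z0.
set P := [set _ | _].
have : P (w + 2 * pi * k%:~R).
  split; first by rewrite lerDr.
    by rewrite two_piS addrC ltrD2l.
  by rewrite expiz.
by move=> Pw; apply: (@xgetPex _ 0 P); exists (w + 2 * pi * k%:~R).
Qed.

Lemma branch_arg_polar k (r t : R) : 0 < r ->
  2 * pi * k%:~R <= t < 2 * pi * (k + 1)%:~R ->
  branch_arg k (r%:C * expi t) = t.
Proof.
move=> r0 /andP[t0 t1].
have cm : cmod (r%:C * expi t) = r by rewrite cmodM cmodr cmod_expi mulr1 gtr0_norm.
have z0 : r%:C * expi t != 0 by rewrite -cmod_gt0 cm.
have [b0 b1 /esym] := branch_argP k z0; rewrite cm => e.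
move: t1 b1; rewrite !two_piS => t1 b1.
apply: expi_inj; first by rewrite ltr_norml; apply/andP; split; lra.
by apply: (mulfI _ e); rewrite -cmod_gt0 cmodr normr_gt0 gt_eqF.
Qed.

Lemma cexp_arg k z : z != 0 -> z = cexp (ln (cmod z)) (branch_arg k z).
Proof.
move=> z0; rewrite /cexp lnK ?posrE ?cmod_gt0//.
by have [_ _] := branch_argP k z0.
Qed.

Lemma branch_powE (be : R) k z : z != 0 ->
  branch_pow be k z = cexp (be * ln (cmod z)) (be * branch_arg k z).
Proof. by move=> z0; rewrite /branch_pow /cexp /powR gt_eqF// cmod_gt0. Qed.

Lemma cmod_branch_pow be k z : cmod (branch_pow be k z) = cmod z `^ be.
Proof. by rewrite cmodM cmodr cmod_expi mulr1 ger0_norm// powR_ge0. Qed.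

Definition dln z w : R := ln (cmod w) - ln (cmod z).
Definition darg k z w : R := branch_arg k w - branch_arg k z.

Lemma branch_pow_ratio be k z w : z != 0 -> w != 0 ->
  branch_pow be k w = branch_pow be k z * cexp (be * dln z w) (be * darg k z w).
Proof.
move=> z0 w0; rewrite !branch_powE// -cexpD; congr cexp; rewrite /dln /darg; ring.
Qed.

Lemma ratio k z w : z != 0 -> w != 0 -> w = z * cexp (dln z w) (darg k z w).
Proof.
move=> z0 w0; rewrite {1}(cexp_arg k w0) {1}(cexp_arg k z0) -cexpD.
by congr cexp; rewrite /dln /darg; ring.
Qed.

Lemma darg_lt k z w : z != 0 -> w != 0 -> `|darg k z w| < 2 * pi.
Proof.
move=> z0 w0; have [a1 a2 _] := branch_argP k z0; have [b1 b2 _] := branch_argP k w0.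
move: a2 b2; rewrite !two_piS => a2 b2.
by rewrite /darg ltr_norml; apply/andP; split; lra.
Qed.

Lemma branch_arg_side k z : z != 0 ->
  (0 < complex.Im z -> branch_arg k z - 2 * pi * k%:~R <= pi) /\
  (complex.Im z < 0 -> pi <= branch_arg k z - 2 * pi * k%:~R).
Proof.
move=> z0; have [a1 a2 e] := branch_argP k z0.
move: a2; rewrite !two_piS => a2.
have m0 : 0 < cmod z by rewrite cmod_gt0.
set u := _ - _; have u0 : 0 <= u by rewrite subr_ge0.
have u2 : u < 2 * pi by rewrite ltrBlDr addrC.
have IE : complex.Im z = cmod z * sin u.
  have <- : sin (branch_arg k z) = sin u.
    have := expiz u k; rewrite /u subrK => -[_ ->] //.
  by rewrite {1}e /= mul0r addr0.
rewrite IE; split => h; rewrite leNgt; apply/negP => hu.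
  have : 0 <= sin (u - pi) by apply: sin_ge0_pi; apply/andP; split; lra.
  rewrite -[u in sin u](subrK pi) sinDpi in h.
  move: h; rewrite mulrN oppr_gt0 pmulr_rlt0// => h1 h2.
  by move: (lt_le_trans h1 h2); rewrite ltxx.
have : 0 <= sin u by apply: sin_ge0_pi; rewrite u0 ltW.
by move: h; rewrite pmulr_rlt0// => h1 h2; move: (lt_le_trans h1 h2); rewrite ltxx.
Qed.

(** The cut is the positive real axis, so a half-plane bounded by the real axis is seen by each
    branch as one half of its interval, of length pi. *)
Lemma darg_side k z w : 0 < complex.Im z * complex.Im w -> `|darg k z w| <= pi.
Proof.
move=> zw.
have z0 : z != 0 by apply/eqP => h; move: zw; rewrite h /= mul0r ltxx.
have w0 : w != 0 by apply/eqP => h; move: zw; rewrite h /= mulr0 ltxx.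
have [z1 z2] := branch_arg_side k z0; have [w1 w2] := branch_arg_side k w0.
have [a1 a2 _] := branch_argP k z0; have [b1 b2 _] := branch_argP k w0.
move: a2 b2; rewrite !two_piS => a2 b2.
rewrite /darg ler_norml.
have [zp|zn|z00] := ltgtP 0 (complex.Im z); last by move: zw; rewrite -z00 mul0r ltxx.
  have wp : 0 < complex.Im w by rewrite -(pmulr_rgt0 _ zp).
  have := z1 zp; have := w1 wp; move=> *; apply/andP; split; lra.
have wn : complex.Im w < 0 by rewrite -(nmulr_rgt0 _ zn).
have := z2 zn; have := w2 wn; move=> *; apply/andP; split; lra.
Qed.

End BranchArg.

(** * Local estimates for complex powers, uniform in the level *)

Section PowerEstimates.
Context {R : realType}.
Implicit Types (z w n m p : R[i]) (k : int).

Lemma powRB1 (x be : R) : 0 < x -> x `^ (be - 1) = x `^ be / x.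
Proof. by move=> x0; rewrite powRB; [rewrite powRr1// ltW|rewrite (gt_eqF x0) /= implybT]. Qed.

Lemma powRB2 (x be : R) : 0 < x -> x `^ (be - 2) = x `^ be / x ^+ 2.
Proof.
move=> x0; rewrite powRB; last by rewrite (gt_eqF x0) /= implybT.
by rewrite powR_mulrn// ltW.
Qed.

Lemma branch_powB1 (be : R) k z : z != 0 ->
  branch_pow (be - 1) k z * z = branch_pow be k z.
Proof.
move=> z0; rewrite !branch_powE// [X in _ * X](cexp_arg k z0) -cexpD.
by congr cexp; ring.
Qed.

Lemma ratioB1 k z w : z != 0 -> w != 0 ->
  cmod (cexp (dln z w) (darg k z w) - 1) = cmod (w - z) / cmod z.
Proof.
move=> z0 w0; have -> : w - z = z * (cexp (dln z w) (darg k z w) - 1).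
  by rewrite mulrBr mulr1 -ratio.
by rewrite cmodM mulrAC mulfV ?mul1r// cmod_eq0.
Qed.

(** Only differences of arguments at the same level occur, which makes the constant common to all
    levels. The bound 1 <= c ensures that the radius 1 / (2 c) used next is at most 1/2. *)
Lemma cexp_near : exists2 c : R, 1 <= c & forall k z w,
  0 < complex.Im z * complex.Im w -> cmod (w - z) <= cmod z / 2 ->
  `|dln z w| + `|darg k z w| <= c * (cmod (w - z) / cmod z).
Proof.
have pi0 := @pi_gt0 R.
have [|c c0 hc] := @cexpB1_lower R pi; first by apply/andP; split; lra.
exists (c + 1); first by rewrite lerDr ltW.
move=> k z w zw wz.
have z0 : z != 0 by apply/eqP => h; move: zw; rewrite h /= mul0r ltxx.
have w0 : w != 0 by apply/eqP => h; move: zw; rewrite h /= mulr0 ltxx.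
have m0 : 0 < cmod z by rewrite cmod_gt0.
rewrite -(ratioB1 k)//.
apply: (@le_trans _ _ (c * cmod (cexp (dln z w) (darg k z w) - 1))).
  apply: hc; first exact: darg_side.
  by rewrite ratioB1// ler_pdivrMr// mulrC.
by rewrite ler_wpM2r ?cmod_ge0// lerDl.
Qed.

Variable alpha : R.
Hypothesis halpha : 0 < alpha < 1.
Let a0 : 0 < alpha. Proof. by case/andP: halpha. Qed.
Let a1 : alpha < 1. Proof. by case/andP: halpha. Qed.

(** Write n - p = n exp(zeta). Then (n - p)^alpha = n^alpha exp(alpha zeta), and the linear term
    alpha zeta of this expansion cancels against the one of alpha p / n = alpha (1 - exp(zeta)); two
    second order remainders are left. *)
Lemma branch_pow_taylor : exists C eta : R, [/\ 0 < C, 0 < eta <= 2^-1 &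
  forall k n p, 0 < complex.Im n * complex.Im (n - p) ->
    cmod p <= eta * cmod n ->
    cmod (branch_pow alpha k n - branch_pow alpha k (n - p)
          - alpha%:C * p * branch_pow (alpha - 1) k n)
      <= C * cmod p ^+ 2 * cmod n `^ (alpha - 2)].
Proof.
have [c c1 hc] := cexp_near.
have c0 : 0 < c by exact: lt_le_trans c1.
exists (4 * c ^+ 2), (2 * c)^-1; split.
- by rewrite mulr_gt0// exprn_gt0.
- rewrite invr_gt0 mulr_gt0//= lef_pV2 ?posrE ?mulr_gt0//.
  by rewrite -[X in X <= _]mulr1 ler_pM2l.
move=> k n p np pn.
have n0 : n != 0 by apply/eqP => h; move: np; rewrite h /= mul0r ltxx.
have m0 : n - p != 0 by apply/eqP => h; move: np; rewrite h /= mulr0 ltxx.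
have nn0 : 0 < cmod n by rewrite cmod_gt0.
have e : n - p - n = - p by rewrite addrAC subrr add0r.
have near : cmod (n - p - n) <= cmod n / 2.
  rewrite e cmodN (le_trans pn)// mulrC ler_wpM2l ?(ltW nn0)// lef_pV2 ?posrE ?mulr_gt0//.
  by rewrite -[X in X <= _]mulr1 ler_pM2l.
have := hc k _ _ np near; rewrite e cmodN.
set d := dln n (n - p); set th := darg k n (n - p).
set r := cmod p / cmod n => mr.
have r12 : c * r <= 2^-1.
  rewrite /r mulrA ler_pdivrMr// (le_trans (ler_wpM2l (ltW c0) pn))//.
  by rewrite le_eqVlt; apply/orP; left; apply/eqP; field; rewrite gt_eqF.
have md : `|d| + `|th| <= 2^-1 by exact: le_trans r12.
have mad : `|alpha * d| + `|alpha * th| <= 2^-1.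
  apply: le_trans md; rewrite !normrM -mulrDr ler_piMl ?addr_ge0//.
  by rewrite gtr0_norm// ltW.
have t1 := cexp_taylor md; have t2 := cexp_taylor mad.
rewrite -(branch_powB1 _ _ m0) in t1 t2 *.
rewrite (branch_powB1 _ _ m0) (branch_pow_ratio alpha k n0 m0) -/d -/th.
set Q := branch_pow alpha k n.
set P1 := branch_pow (alpha - 1) k n.
have QE : Q = P1 * n by rewrite /Q -branch_powB1.
have pE : p = n - n * cexp d th.
  by rewrite -(ratio k n0 m0) opprB addrC subrK.
have -> : Q - Q * cexp (alpha * d) (alpha * th) - alpha%:C * p * P1 =
   - (Q * ((cexp (alpha * d) (alpha * th) - 1 - ((alpha * d) +i* (alpha * th)))
     - alpha%:C * (cexp d th - 1 - (d +i* th)))).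
  have sc : (alpha * d) +i* (alpha * th) = alpha%:C * (d +i* th).
    by apply/eqP; rewrite eq_complex /= !mul0r subr0 addr0 !eqxx.
  rewrite sc [in LHS]pE QE; ring.
rewrite cmodN cmodM cmod_branch_pow.
have pw0 := powR_ge0 (cmod n) alpha.
apply: (@le_trans _ _ (cmod n `^ alpha * (4 * (c * r) ^+ 2))).
  rewrite ler_wpM2l// (le_trans (cmodB _ _))// cmodM cmodr (gtr0_norm a0).
  have mr2 : (`|d| + `|th|) ^+ 2 <= (c * r) ^+ 2.
    by rewrite ler_pXn2r// ?nnegrE ?addr_ge0// (le_trans _ mr)// addr_ge0.
  have mr3 : (`|alpha * d| + `|alpha * th|) ^+ 2 <= (c * r) ^+ 2.
    apply: le_trans mr2; rewrite ler_pXn2r// ?nnegrE ?addr_ge0//.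
    rewrite !normrM -mulrDr ler_piMl ?addr_ge0//.
    by rewrite gtr0_norm// ltW.
  have t3 : alpha * cmod (cexp d th - 1 - (d +i* th)) <= 2 * (`|d| + `|th|) ^+ 2.
    by apply: le_trans t1; rewrite ler_piMl ?cmod_ge0// ltW.
  lra.
rewrite powRB2// /r le_eqVlt; apply/orP; left; apply/eqP.
by field; rewrite gt_eqF.
Qed.

Lemma branch_pow_lip : exists C eta : R, [/\ 0 < C, 0 < eta <= 2^-1 &
  forall k n z, 0 < complex.Im n * complex.Im z ->
    cmod (z - n) <= eta * cmod n ->
    cmod (branch_pow (alpha - 1) k n - branch_pow (alpha - 1) k z)
      <= C * cmod (z - n) * cmod n `^ (alpha - 2)].
Proof.
have [c c1 hc] := cexp_near.
have c0 : 0 < c by exact: lt_le_trans c1.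
exists (2 * c), (2 * c)^-1; split.
- by rewrite mulr_gt0.
- rewrite invr_gt0 mulr_gt0//= lef_pV2 ?posrE ?mulr_gt0//.
  by rewrite -[X in X <= _]mulr1 ler_pM2l.
move=> k n z nz zn.
have n0 : n != 0 by apply/eqP => h; move: nz; rewrite h /= mul0r ltxx.
have m0 : z != 0 by apply/eqP => h; move: nz; rewrite h /= mulr0 ltxx.
have nn0 : 0 < cmod n by rewrite cmod_gt0.
have near : cmod (z - n) <= cmod n / 2.
  rewrite (le_trans zn)// mulrC ler_wpM2l ?(ltW nn0)// lef_pV2 ?posrE ?mulr_gt0//.
  by rewrite -[X in X <= _]mulr1 ler_pM2l.
have := hc k _ _ nz near.
set d := dln n z; set th := darg k n z.
set r := cmod (z - n) / cmod n => mr.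
have r12 : c * r <= 2^-1.
  rewrite /r mulrA ler_pdivrMr// (le_trans (ler_wpM2l (ltW c0) zn))//.
  by rewrite le_eqVlt; apply/orP; left; apply/eqP; field; rewrite gt_eqF.
have md : `|(alpha - 1) * d| + `|(alpha - 1) * th| <= `|d| + `|th|.
  rewrite !normrM -mulrDr ler_piMl ?addr_ge0// ler_norml; have := a0; have := a1; move=> *; apply/andP; split; lra.
have mad : `|(alpha - 1) * d| + `|(alpha - 1) * th| <= 2^-1.
  by rewrite (le_trans md)// (le_trans mr).
have t1 := cexpB1_le mad.
rewrite (branch_pow_ratio (alpha - 1) k n0 m0) -/d -/th.
set P1 := branch_pow (alpha - 1) k n.
rewrite -[X in X - _]mulr1 -mulrBr cmodM cmod_branch_pow [cmod (1 - _)]cmod_distC.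
have pw0 := powR_ge0 (cmod n) (alpha - 1).
apply: (@le_trans _ _ (cmod n `^ (alpha - 1) * (2 * (c * r)))).
  rewrite ler_wpM2l// (le_trans t1)// ler_pM2l//.
  exact: le_trans mr.
rewrite powRB2// powRB1// /r le_eqVlt; apply/orP; left; apply/eqP.
by field; rewrite gt_eqF.
Qed.

(** Quantitative injectivity of the power on a whole branch, across the cut included: two arguments
    at one level differ by less than 2 pi, so the powers have angles differing by at most 2 pi
    alpha, which is less than 2 pi. *)
Lemma branch_pow_far : exists C eta : R, [/\ 0 < C, 0 < eta &
  forall k n m, n != 0 -> m != 0 ->
    cmod (branch_pow alpha k n - branch_pow alpha k m) <= eta * cmod n `^ alpha ->
    cmod (n - m) * cmod n `^ (alpha - 1)
      <= C * cmod (branch_pow alpha k n - branch_pow alpha k m)].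
Proof.
have pi0 := @pi_gt0 R.
have [|c c0 hc] := @cexpB1_lower R (2 * pi * alpha).
  by rewrite mulr_gt0 ?mulr_gt0//= -[X in _ < X]mulr1 ltr_pM2l// mulr_gt0.
have ca0 : 0 < c / alpha by rewrite divr_gt0.
pose eta := Num.min 2^-1 (2 * (c / alpha))^-1.
exists (2 * (c / alpha)), eta; split.
- by rewrite mulr_gt0.
- by rewrite lt_min invr_gt0 ltr0n invr_gt0 mulr_gt0.
move=> k n m n0 m0; rewrite (branch_pow_ratio alpha k n0 m0).
set d := dln n m; set th := darg k n m.
rewrite -[X in X - _]mulr1 -mulrBr cmodM cmod_branch_pow [cmod (1 - _)]cmod_distC.
have nn0 : 0 < cmod n by rewrite cmod_gt0.
have pw0 : 0 < cmod n `^ alpha by rewrite powR_gt0.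
rewrite [eta * _]mulrC ler_pM2l// le_min => /andP[E1 E2].
have bth : `|alpha * th| <= 2 * pi * alpha.
  rewrite normrM gtr0_norm// mulrC ler_wpM2r ?(ltW a0)//.
  by rewrite ltW// darg_lt.
have := hc (alpha * d) _ bth E1.
set E := cmod _ in E1 E2 * => h.
have md : `|d| + `|th| <= c / alpha * E.
  rewrite mulrAC ler_pdivlMr//.
  by move: h; rewrite !normrM -mulrDr (gtr0_norm a0) mulrC.
have md2 : `|d| + `|th| <= 2^-1.
  rewrite (le_trans md)// (le_trans (ler_wpM2l (ltW ca0) E2))//.
  by rewrite le_eqVlt; apply/orP; left; apply/eqP; field; rewrite !gt_eqF.
have := cexpB1_le md2.
rewrite ratioB1// cmod_distC => h2.
rewrite powRB1// mulrCA [in leRHS]mulrCA ler_pM2l//.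
by apply: (le_trans h2); rewrite -mulrA ler_pM2l.
Qed.

End PowerEstimates.

(** * Measurability of Lipschitz functions and of branches *)

Section Measurability.
Context {R : realType}.

(** Measurability is for the product sigma-algebra, so a superlevel set is exhibited as a countable
    union of boxes with rational centres. *)
Lemma lipschitz_measurable (u : R[i] -> R) (B : R) :
  (forall z w, `|u z - u w| <= B * cmod (z - w)) ->
  measurable_fun [set: plane R] (fun z => u (complex_of z)).
Proof.
move=> uL mD; apply: (measurability _ (RGenOInfty.measurableE R)) => //.
move=> _ [_ [c ->] <-]; rewrite setTI.
have B0 : 0 <= B.
  by have := uL 1 0; rewrite subr0 cmodr normr1 mulr1; exact: le_trans.
pose e (m : nat) : R := m.+1%:R^-1.
pose I (q : rat) m : set (measurableTypeR R) := `](ratr q - e m), (ratr q + e m)[%classic.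
(* A box is kept only when the value at its centre forces u > c on all of it; its points are within
   2 [e m] of the centre. *)
pose box q1 q2 m : set (plane R) :=
  if c < u (ratr q1 +i* ratr q2) - B * (2 * e m) then I q1 m `*` I q2 m else set0.
have E : (fun z : plane R => u (complex_of z)) @^-1` `]c, +oo[ =
    \bigcup_q1 \bigcup_q2 \bigcup_m box q1 q2 m.
  have near q1 q2 m (z : plane R) : I q1 m z.1 -> I q2 m z.2 ->
      cmod (complex_of z - (ratr q1 +i* ratr q2)) <= 2 * e m.
    rewrite /I /= !in_itv/= -!ltr_distlC => h1 h2.
    apply: (le_trans (cmod_le_sum _ _)); rewrite /= mulr_natl.
    by apply: lerD; rewrite distrC ltW.
  apply/seteqP; split => z /=.
    rewrite in_itv/= andbT => cu.
    have [m hm] : exists m, B * (4 * e m) < u (complex_of z) - c.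
      have d0 : 0 < u (complex_of z) - c by rewrite subr_gt0.
      have [m hm] : exists m, B * 4 / (u (complex_of z) - c) < m.+1%:R.
        exists (Num.truncn (B * 4 / (u (complex_of z) - c))).
        exact: truncnS_gt.
      by exists m; rewrite mulrA /e ltr_pdivrMr// [_ * m.+1%:R]mulrC -ltr_pdivrMr.
    have e0 : 0 < e m by rewrite invr_gt0 ltr0n.
    have h (x : R) : x - e m < x + e m by rewrite ltrD2l (lt_trans _ e0)// oppr_lt0.
    have /rat_in_itvoo[q1 hq1] := h z.1; have /rat_in_itvoo[q2 hq2] := h z.2.
    have J1 : I q1 m z.1 by rewrite /I /= in_itv/= -ltr_distlC -distrC ltr_distlC; move: hq1; rewrite inE.
    have J2 : I q2 m z.2 by rewrite /I /= in_itv/= -ltr_distlC -distrC ltr_distlC; move: hq2; rewrite inE.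
    exists q1 => //; exists q2 => //; exists m => //; rewrite /box ifT//.
    have := uL (complex_of z) (ratr q1 +i* ratr q2).
    have := ler_wpM2l B0 (near _ _ _ _ J1 J2).
    by rewrite ler_norml; lra.
  move=> [q1 _ [q2 _ [m _]]]; rewrite /box; case: ifPn => // cu [J1 J2].
  rewrite in_itv/= andbT.
  have := uL (complex_of z) (ratr q1 +i* ratr q2).
  have := ler_wpM2l B0 (near _ _ _ _ J1 J2).
  by rewrite ler_norml; lra.
rewrite E; apply: bigcupT_measurable_rat => q1; apply: bigcupT_measurable_rat => q2.
apply: bigcupT_measurable => m; rewrite /box; case: ifPn => // _.
by apply: measurableX; exact: measurable_itv.
Qed.

Lemma measurable_cmod : measurable_fun [set: plane R] (fun z => cmod (complex_of z)).
Proof.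
apply: (@lipschitz_measurable _ 1) => z w; rewrite mul1r ler_norml.
by rewrite cmod_triB andbT lerNl opprB cmod_distC cmod_triB.
Qed.

(* Half-angle formula, where the total inverse makes both sides equal on the
   negative real axis. *)
Lemma branch_argE (k : int) (z : R[i]) : z != 0 -> branch_arg k z = 2 * pi * k%:~R +
  (if (complex.Im z == 0) && (0 < complex.Re z) then 0
   else pi - 2 * atan ((cmod z + complex.Re z) * (complex.Im z * (complex.Im z ^+ 2)^-1))).
Proof.
move=> z0; have [a1 a2 zE] := branch_argP k z0; rewrite two_piS in a2.
have pi0 := @pi_gt0 R.
have m0 : 0 < cmod z by rewrite cmod_gt0.
pose th := branch_arg k z - 2 * pi * k%:~R.
have th0 : 0 <= th by rewrite subr_ge0.
have th2 : th < 2 * pi by rewrite ltrBlDr addrC.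
have -> : branch_arg k z = 2 * pi * k%:~R + th by rewrite addrC subrK.
have ee : expi (branch_arg k z) = expi th.
  by rewrite -[in LHS](subrK (2 * pi * k%:~R) (branch_arg k z)) expiz.
rewrite ee in zE.
have RE : complex.Re z = cmod z * cos th by rewrite {1}zE /= mul0r subr0.
have IE : complex.Im z = cmod z * sin th by rewrite {1}zE /= mul0r addr0.
congr (_ + _).
set h := th / 2.
have hE : th = h + h by rewrite /h; field.
have sE : sin th = 2 * sin h * cos h by rewrite hE sinD; ring.
have cE : 1 + cos th = 2 * cos h ^+ 2.
  by rewrite hE cosD -!expr2 sin2cos2; ring.
have [t0|t0] := eqVneq th 0.
  by rewrite IE RE t0 sin0 mulr0 eqxx cos0 mulr1 m0.
have tp : 0 < th by rewrite lt_def t0.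
have sh : 0 < sin h by apply: sin_gt0_pi; apply/andP; split; rewrite /h; lra.
rewrite ifF; last first.
  apply/negP => /andP[]; rewrite IE RE mulf_eq0 (gt_eqF m0)/= => /eqP s0.
  rewrite pmulr_rgt0// => c0.
  move: s0; rewrite sE => /eqP; rewrite !mulf_eq0 pnatr_eq0 (gt_eqF sh)/= => /eqP ch.
  by move: cE c0; rewrite ch expr0n/= mulr0; lra.
have -> : (cmod z + complex.Re z) * (complex.Im z * (complex.Im z ^+ 2)^-1) =
   tan (pi / 2 - h).
  rewrite /tan -[pi / 2 - h]opprB cosN sinN sinBpihalf cosBpihalf opprK.
  rewrite IE RE sE -[X in X + _]mulr1 -mulrDr cE.
  have [->|ch] := eqVneq (cos h) 0; first by rewrite expr0n/= !(mulr0, mul0r).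
  by field; rewrite ch !gt_eqF.
rewrite tanK ?in_itv/=; last by apply/andP; split; rewrite /h; lra.
by rewrite /h; field.
Qed.

(** The formula of [branch_argE] with the inverse written as a real power, so that measurability on
    the whole plane is a matter of composition; it is the argument away from the origin. *)
Definition margb (k : int) (z : plane R) : R := 2 * pi * k%:~R +
  (if (z.2 == 0) && (0 < z.1) then 0
   else pi - 2 * atan ((cmod (complex_of z) + z.1) * (z.2 * (z.2 ^+ 2) `^ (-1)))).

Lemma measurable_margb k : measurable_fun [set: plane R] (margb k).
Proof.
apply: measurable_funD => //; apply: measurable_fun_ifT => //.
  apply: measurable_and; first exact: measurable_fun_eqr.
  exact: measurable_fun_ltr.
apply: measurable_funB => //; apply: measurable_funM => //.
apply: (@measurableT_comp _ _ _ _ _ _ (@atan R)).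
  by apply: continuous_measurable_fun => x; exact: continuous_atan.
apply: measurable_funM; first by apply: measurable_funD => //; exact: measurable_cmod.
apply: measurable_funM => //.
apply: (measurableT_comp (measurable_powR (-1))).
exact: measurable_funX.
Qed.

Lemma branch_arg_margb k (z : plane R) : complex_of z != 0 ->
  branch_arg k (complex_of z) = margb k z.
Proof.
by move=> z0; rewrite branch_argE// /margb powR_inv1 ?sqr_ge0.
Qed.

Lemma measurable_branch_pow (be : R) k (p : R[i]) (u : R[i] -> R) (B : R) :
  (forall z w, `|u z - u w| <= B * cmod (z - w)) ->
  measurable_fun [set: plane R] (fun z => if complex_of z == 0 then 0 else
    u (p * branch_pow be k (complex_of z))).
Proof.
move=> uL.
pose h (z : plane R) : R := cmod (complex_of z) `^ be.
pose M (z : plane R) : plane R :=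
  (complex.Re p * (h z * cos (be * margb k z)) - complex.Im p * (h z * sin (be * margb k z)),
   complex.Re p * (h z * sin (be * margb k z)) + complex.Im p * (h z * cos (be * margb k z))).
rewrite (_ : (fun z => _) = fun z : plane R =>
    if (cmod (complex_of z) == 0) then 0 else u (complex_of (M z))); last first.
  apply/funext => z; rewrite cmod_eq0; case: ifPn => // z0; congr u.
  rewrite /branch_pow branch_arg_margb// /M /complex_of /h /=.
  by case: p {M} => p1 p2; apply/eqP; rewrite eq_complex /= !mul0r !subr0 !addr0 !eqxx.
have mh : measurable_fun [set: plane R] h.
  exact: (measurableT_comp (measurable_powR be) measurable_cmod).
have mb : measurable_fun [set: plane R] (fun z => be * margb k z).
  by apply: measurable_funM => //; exact: measurable_margb.
have mc : measurable_fun [set: plane R] (fun z => h z * cos (be * margb k z)).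
  by apply: measurable_funM => //; exact: (measurableT_comp measurable_cosR mb).
have ms : measurable_fun [set: plane R] (fun z => h z * sin (be * margb k z)).
  by apply: measurable_funM => //; exact: (measurableT_comp measurable_sinR mb).
have mM : measurable_fun [set: plane R] M.
  by apply: measurable_fun_pair; [apply: measurable_funB|apply: measurable_funD];
    apply: measurable_funM.
apply: measurable_fun_ifT => //.
  by apply: measurable_fun_eqr => //; exact: measurable_cmod.
exact: (measurableT_comp (lipschitz_measurable uL) mM).
Qed.

End Measurability.

(** * Sums over pairs *)

Section Pointwise.
Context {R : realType}.

(** One constant [B] bounds both the values and the Lipschitz ratio, since the final error only sees
    the sum of the two norms of f. *)
Definition bump (u : R[i] -> R) (B A : R) : Prop :=
  [/\ forall z, 0 <= u z <= B, forall z w, `|u z - u w| <= B * cmod (z - w) &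
      forall z, A <= cmod z -> u z = 0].

(* The term of the pair [(n, n - p)], for the truncation radius [X]; [lin_val]
   replaces the increment of the power by its differential. *)
Definition pair_val (u : R[i] -> R) (alpha s X : R) (k : int) (p n : R[i]) : R :=
  if [&& n != 0, cmod n <= X, n - p != 0 & cmod (n - p) <= X]
  then u (s%:C * (branch_pow alpha k n - branch_pow alpha k (n - p))) else 0.

Definition lin_val (u : R[i] -> R) (alpha s X : R) (k : int) (p z : R[i]) : R :=
  if (z != 0) && (cmod z <= X)
  then u (s%:C * (alpha%:C * p * branch_pow (alpha - 1) k z)) else 0.

(* Neighbourhood of the real axis, which contains the branch cut, and of the circle
   of radius [X], where one point of the pair may leave the disk. *)
Definition bad (c P X : R) (z : R[i]) : bool :=
  (cmod z <= 2 * X) && ((`|complex.Im z| <= c * P) ||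
                        (X - c * P <= cmod z <= X + c * P)).

(** When a value is nonzero, s P |z|^(alpha-1) is at most a multiple of A, so the second order error
    s P^2 |z|^(alpha-2) becomes A P / |z|. On the bad set only the trivial bound on the test
    function is available. *)
Definition pair_err (C c A P X : R) (z : R[i]) : R :=
  (if cmod z <= 2 * X then C * A * P / cmod z else 0) + (bad c P X z)%:R.

(** Applied with x = Im n, x + y = Im w and x - t = Im (n - p): if w is far enough from the real
    axis, then n and n - p are on its side. *)
Lemma same_side (x y t a c : R) : 0 <= c -> `|y| <= a -> `|t| <= c ->
  a + c < `|x + y| -> 0 < x * (x + y) /\ 0 < x * (x - t).
Proof.
rewrite !ler_norml => c0 /andP[y1 y2] /andP[t1 t2] h.
have [xp|xn] := leP 0 (x + y).
  rewrite (ger0_norm xp) in h.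
  have x0 : 0 < x by lra.
  by split; apply: mulr_gt0; lra.
rewrite (ltr0_norm xn) in h.
have x0 : x < 0 by lra.
by split; rewrite nmulr_rgt0//; lra.
Qed.

(** [W] and [V] are the moduli of a point w of a tile and of its grid point n, at distance at most q
    P. The term e1^-1 of the constant gives the smallness required by the Taylor estimate, q / e2
    that of the Lipschitz estimate, and q + 1 keeps the three points on one side. *)
Lemma pair_margins (q P W V e1 e2 : R) : 0 < q -> 0 < P -> 0 < e1 -> 0 < e2 <= 2^-1 ->
  (q + 1 + e1^-1 + q / e2) * P < W -> W - q * P <= V ->
  [/\ (0 < W) && (0 < V), P <= e1 * V, q * P <= e2 * V, W / 2 <= V &
      q * P + P <= (q + 1 + e1^-1 + q / e2) * P].
Proof.
move=> q0 P0 e10 /andP[e20 e22]; rewrite !mulrDl mul1r => h hV.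
have e1P : 0 < e1^-1 * P by rewrite mulr_gt0// invr_gt0.
have qP : 0 < q * P by exact: mulr_gt0.
have h2 : 2 * (q * P) <= q / e2 * P.
  rewrite mulrA ler_pM2r// mulrC ler_pM2l// -[X in X <= _]invrK lef_pV2 ?posrE ?invr_gt0//.
have e1V : e1^-1 * P <= V by lra.
have e2V : q / e2 * P <= V by lra.
split; [by apply/andP; split; lra| | |by lra|by lra].
  by rewrite -ler_pdivrMl.
by rewrite -ler_pdivrMl// mulrA [e2^-1 * q]mulrC.
Qed.

Lemma seq_min (s : seq R) : exists2 m, 0 < m & forall x, x \in s -> 0 < x -> m <= x.
Proof.
elim: s => [|y s [m m0 hm]]; first by exists 1.
have [y0|y0] := leP y 0.
  exists m => // x; rewrite inE => /predU1P[->|xs] x0; last exact: hm.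
  by move: (lt_le_trans x0 y0); rewrite ltxx.
exists (Num.min m y); first by rewrite lt_min m0.
move=> x; rewrite inE ge_min => /predU1P[->|xs] x0; first by rewrite lexx orbT.
by rewrite hm.
Qed.

(** The grid need not contain 0, so the minimum is taken over the finitely many points of the unit
    disk; this bounds |n|^alpha from below in [pair_range]. *)
Lemma grid_min (L : set R[i]) (z0 : R[i]) : is_Zlattice L ->
  exists2 m, 0 < m & forall n, Zgrid z0 L n -> n != 0 -> m <= cmod n.
Proof.
move=> hL.
have /finite_seqP[s sE] := finite_lattice_ball (1 + cmod z0) hL.
have [m m0 hm] := seq_min [seq cmod (z0 + p) | p <- s].
exists (Num.min m 1); first by rewrite lt_min m0/=.
move=> _ [p Lp <-] n0; rewrite ge_min.
have [h|h] := leP 1 (cmod (z0 + p)); first by rewrite orbT.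
rewrite hm// ?cmod_gt0//; apply: map_f.
suff : [set` s] p by [].
rewrite -sE; split => //.
rewrite -[p](addKr z0) addrC (le_trans (cmodD _ _))// cmodN lerD2r ltW//.
Qed.

Variables (b : R[i] * R[i]) (L : set R[i]) (hb : is_Zbasis L b) (z0 : R[i]).
Notation Lam := (Zgrid z0 L).
Variable alpha : R.
Hypothesis halpha : 0 < alpha < 1.

Let a0 : 0 < alpha. Proof. by case/andP: halpha. Qed.
Let a1 : alpha < 1. Proof. by case/andP: halpha. Qed.

(** A nonzero value means that the powers differ by less than A / s. The hypothesis on s makes this
    at most eta m0^alpha, hence at most eta |n|^alpha, so [branch_pow_far] applies. This is the
    origin of the condition Cs A <= phi(N). *)
Lemma pair_range : exists C Cs : R, [/\ 0 < C, 0 < Cs &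
  forall u B A, 1 <= A -> bump u B A -> forall s X k p n, 0 < s -> Cs * A <= s ->
   Lam n -> pair_val u alpha s X k p n != 0 ->
   s * cmod p * cmod n `^ (alpha - 1) <= C * A].
Proof.
have [C [eta [C0 eta0 far]]] := branch_pow_far halpha.
have [m0 m0p hm] := grid_min z0 (ex_intro _ b hb).
have pm0 : 0 < m0 `^ alpha by rewrite powR_gt0.
exists C, (eta * m0 `^ alpha)^-1; split => //.
  by rewrite invr_gt0 mulr_gt0.
move=> u B A A1 [u0 uL uA] s X k p n s0 sA Ln.
rewrite /pair_val; case: ifPn => [/and4P[n0 nX np npX] un|]; last by rewrite eqxx.
have {un} un : s * cmod (branch_pow alpha k n - branch_pow alpha k (n - p)) < A.
  rewrite ltNge; apply: contra un => h; apply/eqP/uA.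
  by rewrite cmodM cmodr gtr0_norm.
set D := cmod _ in un *.
have D0 : 0 <= D by exact: cmod_ge0.
have := far k n (n - p) n0 np; rewrite -/D => /(_ _).
rewrite opprB addrC subrK => h.
have hD : D <= eta * cmod n `^ alpha.
  have A0 : 0 < A by apply: lt_le_trans A1.
  have : D <= A / s by rewrite ler_pdivlMr// mulrC ltW.
  move=> /le_trans; apply.
  apply: (@le_trans _ _ (eta * m0 `^ alpha)).
    by rewrite ler_pdivrMr// -ler_pdivrMl ?mulr_gt0.
  rewrite ler_pM2l// ge0_ler_powR ?nnegrE ?cmod_ge0 ?(ltW a0) ?(ltW m0p)//.
  exact: hm.
rewrite -mulrA; apply: (@le_trans _ _ (s * (C * D))).
  by rewrite ler_pM2l// h.
by rewrite mulrCA ler_pM2l// ltW.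
Qed.

Lemma lin_range u B A s X k p z : 0 < s -> bump u B A ->
  lin_val u alpha s X k p z != 0 ->
  s * cmod p * cmod z `^ (alpha - 1) <= alpha^-1 * A.
Proof.
move=> s0 [u0 uL uA]; rewrite /lin_val; case: ifPn => [/andP[zn0 zX] un|]; last by rewrite eqxx.
rewrite ler_pdivlMl// ltW// ltNge; apply: contra un => h; apply/eqP/uA.
rewrite cmodM [cmod (_ * branch_pow _ _ _)]cmodM cmod_branch_pow [cmod (_ * p)]cmodM !cmodr !gtr0_norm//; apply: le_trans h _.
by rewrite le_eqVlt; apply/orP; left; apply/eqP; ring.
Qed.

Lemma pow_neg_ge (x X : R) : 0 < x -> x <= X -> X `^ (alpha - 1) <= x `^ (alpha - 1).
Proof.
move=> x0 xX; have X0 : 0 < X by exact: lt_le_trans xX.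
rewrite -opprB !powRN lef_pV2 ?posrE ?powR_gt0//.
by rewrite ge0_ler_powR ?nnegrE ?(ltW x0) ?(ltW X0)// subr_ge0 ltW.
Qed.

Lemma pow_neg_half (x : R) : 0 < x -> (x / 2) `^ (alpha - 1) <= 2 * x `^ (alpha - 1).
Proof.
move=> x0; rewrite powRM ?(ltW x0) ?invr_ge0// mulrC ler_wpM2r ?powR_ge0//.
rewrite -powR_inv1// -powRrM -[X in _ <= X](powRr1 (_ : 0 <= 2))//.
by rewrite ler_powR ?ler1n//; have := a0; lra.
Qed.

(** Two replacements are made: the increment by its differential at n, then n by an arbitrary point
    of its tile. Where they fail, both values still lie in [0, B]. *)
Lemma pair_pointwise : exists C c Cs : R, [/\ 0 < C, 0 < c, 0 < Cs &
  forall u B A, 1 <= A -> 0 <= B -> bump u B A ->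
  forall s X k p n z, 0 < s -> Cs * A <= s -> ldiam b <= X -> L p -> p != 0 ->
    Lam n -> tile b n z ->
    `|pair_val u alpha s X k p n - lin_val u alpha s X k p (complex_of z)|
      <= B * pair_err C c A (cmod p) X (complex_of z)].
Proof.
have [Ct [e1 [Ct0 /andP[e10 e12] taylor]]] := branch_pow_taylor halpha.
have [Cl [e2 [Cl0 /andP[e20 e22] lip]]] := branch_pow_lip halpha.
have [Cr [Cs [Cr0 Cs0 range]]] := pair_range.
have d0 := ldiam_gt0 hb; have K0 := lK_gt0 hb.
pose q := ldiam b * lK b.
have q0 : 0 < q by exact: mulr_gt0.
pose c := q + 1 + e1^-1 + q / e2.
have e1i : 0 < e1^-1 by rewrite invr_gt0.
have qe2 : 0 < q / e2 by rewrite divr_gt0.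
pose Cm := Cr + 2 * alpha^-1.
have Cm0 : 0 < Cm by rewrite addr_gt0// mulr_gt0// invr_gt0.
pose C := 2 * (Ct + Cl * q) * Cm.
have C0 : 0 < C by rewrite !mulr_gt0// addr_gt0// mulr_gt0.
exists C, c, Cs; split => //; first by rewrite /c; lra.
move=> u B A A1 B0 bu s X k p n z s0 sA dX Lp p0 Ln tn.
have [u0 uL uA] := bu.
have A0 : 0 < A by exact: lt_le_trans A1.
set P := cmod p; set w := complex_of z.
set Hv := pair_val _ _ _ _ _ _ _; set Fv := lin_val _ _ _ _ _ _ _.
have P0 : 0 < P by rewrite cmod_gt0.
have X0 : 0 < X by exact: lt_le_trans dX.
have err0 : 0 <= (if cmod w <= 2 * X then C * A * P / cmod w else 0).
  case: ifP => // _; apply: divr_ge0; last exact: cmod_ge0.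
  by apply: mulr_ge0; [apply: mulr_ge0; exact: ltW|exact: ltW].
(* Nonzero lattice vectors are not short, so the diameter of a tile is absorbed into a multiple of
   |p|. *)
have dP : ldiam b <= q * P.
  by rewrite /q -mulrA -[X in X <= _]mulr1 ler_pM2l//; exact: (lattice_min hb Lp p0).
have wn := tile_dist hb tn; rewrite -/w in wn.
have wnP : cmod (w - n) <= q * P by exact: le_trans dP.
have H01 : 0 <= Hv <= B by rewrite /Hv /pair_val; case: ifP => _; rewrite ?u0// lexx.
have F01 : 0 <= Fv <= B by rewrite /Fv /lin_val; case: ifP => _; rewrite ?u0// lexx.
have [HF0|HF0] := boolP ((Hv == 0) && (Fv == 0)).
  case/andP : HF0 => /eqP -> /eqP ->; rewrite subrr normr0 mulr_ge0//.
  by rewrite addr_ge0// ler0n.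
have w2X : cmod w <= 2 * X.
  move: HF0; rewrite negb_and => /orP[h|h].
    have : cmod n <= X by move: h; rewrite /Hv /pair_val; case: ifPn => [/and4P[]|]; rewrite ?eqxx.
    move=> nX; rewrite -[w](subrK n) (le_trans (cmodD _ _))//; lra.
  have : cmod w <= X by move: h; rewrite /Fv /lin_val; case: ifPn => [/andP[]|]; rewrite ?eqxx.
  lra.
have [wb|wb] := boolP (bad c P X w).
  rewrite /pair_err wb; apply: (@le_trans _ _ (B * 1)).
    by rewrite mulr1 ler_norml; lra.
  by rewrite ler_wpM2l// lerDr.
rewrite /pair_err (negbTE wb) addr0 w2X.
move: wb; rewrite /bad w2X andTb negb_or -ltNge => /andP[imw ann].
have {}imw : c * P < `|complex.Im w| := imw.
have [im1 _] := conj (proj2 (cmod_Re_Im (w - n))) I.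
have [im2 _] := conj (proj2 (cmod_Re_Im p)) I.
have {}im2 : `|complex.Im p| <= P := im2.
have {}im1 : `|complex.Im (w - n)| <= cmod (w - n) := im1.
have imw2 : `|complex.Im w| <= cmod w := proj2 (cmod_Re_Im w).
have cw : c * P < cmod w by exact: lt_le_trans imw2.
have nw : cmod w - q * P <= cmod n.
  by rewrite lerBlDr -lerBlDl; exact: le_trans (cmod_triB w n) wnP.
have nw' : cmod n <= cmod w + q * P.
  by rewrite -lerBlDl (le_trans (cmod_triB n w))// cmod_distC.
have [/andP[w00 n0] pn1 qPe w2n cP] :=
  pair_margins q0 P0 e10 (introT andP (conj e20 e22)) cw nw.
have {}cP : q * P + P <= c * P := cP.
have wn2 : cmod (w - n) <= e2 * cmod n by exact: le_trans qPe.
have imE : complex.Im w = complex.Im n + complex.Im (w - n).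
  by case: (w) (n) => [x y] [x' y'] /=; ring.
have imE2 : complex.Im (n - p) = complex.Im n - complex.Im p.
  by case: (p) (n) => [x y] [x' y'].
have [side1 side2] : 0 < complex.Im n * complex.Im w /\
    0 < complex.Im n * complex.Im (n - p).
  rewrite imE2; rewrite {}imE in imw *.
  exact: same_side (ltW P0) (le_trans im1 wnP) im2 (le_lt_trans cP imw).
have nn0 : n != 0 by rewrite -cmod_gt0.
have w0 : w != 0 by rewrite -cmod_gt0.
have np0 : n - p != 0.
  by apply/eqP => h; move: side2; rewrite h /= mulr0 ltxx.
(* Off the annulus w is either well inside or well outside the disk; in the second case n is outside
   too and both values vanish, which has been excluded. *)
have wX : cmod w < X - c * P.
  move: ann; rewrite negb_and -!ltNge => /orP[//|wX].
  exfalso; move/negP : HF0; apply; apply/andP; split.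
    rewrite /Hv /pair_val ifF//; apply/negP => /and4P[_ nX _ _].
    by move: nX wX nw cP P0; clear; lra.
  rewrite /Fv /lin_val ifF//; apply/negP => /andP[_ wX'].
  by move: wX wX' cP P0 (mulr_gt0 q0 P0); clear; lra.
have npX : cmod (n - p) <= X.
  apply: (le_trans (cmodB _ _)); rewrite -/P.
  by move: nw' wX cP; clear; lra.
have HE : Hv = u (s%:C * (branch_pow alpha k n - branch_pow alpha k (n - p))).
  rewrite /Hv /pair_val ifT// nn0 np0 npX andbT !andTb.
  by move: nw' wX cP P0; clear; lra.
have FE : Fv = u (s%:C * (alpha%:C * p * branch_pow (alpha - 1) k w)).
  rewrite /Fv /lin_val ifT// w0 andTb.
  by move: wX cP P0 (mulr_gt0 q0 P0); clear; lra.
(* Either value being nonzero suffices. If it is the linear one, the bound holds at w and passes to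
   n because |n| >= |w| / 2, at the cost of the factor 2 in [Cm]. *)
have key : s * P * cmod n `^ (alpha - 1) <= Cm * A.
  move: HF0; rewrite negb_and => /orP[h|h].
    apply: (le_trans (range _ _ _ A1 bu _ _ _ _ _ s0 sA Ln h)).
    by rewrite ler_pM2r// lerDl mulr_ge0// invr_ge0 ltW.
  have := lin_range s0 bu h; rewrite -/P -/w => h2.
  have w1 : 0 < cmod w by rewrite cmod_gt0.
  have w2 : 0 < cmod w / 2 by exact: divr_gt0.
  have h3 := le_trans (pow_neg_ge w2 w2n) (pow_neg_half w1).
  apply: (@le_trans _ _ (2 * (alpha^-1 * A))).
    apply: (le_trans (ler_wpM2l (ltW (mulr_gt0 s0 P0)) h3)).
    by rewrite mulrCA ler_pM2l.
  by rewrite mulrA ler_pM2r// lerDr ltW.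
rewrite HE FE; apply: (le_trans (uL _ _)); rewrite ler_wpM2l//.
rewrite -mulrBr cmodM cmodr gtr0_norm//.
set D := branch_pow alpha k n - _.
(* Taylor remainder at n, plus the variation of the derivative between n and w; both are of order
   P^2 |n|^(alpha-2). *)
have -> : D - alpha%:C * p * branch_pow (alpha - 1) k w =
   (D - alpha%:C * p * branch_pow (alpha - 1) k n) +
   alpha%:C * p * (branch_pow (alpha - 1) k n - branch_pow (alpha - 1) k w) by ring.
have N0 := powR_gt0 (alpha - 2) n0.
have b1 := taylor k n p side2 pn1.
have b2 := lip k n w side1 wn2.
have b3 : cmod (alpha%:C * p * (branch_pow (alpha - 1) k n - branch_pow (alpha - 1) k w))
    <= Cl * q * P ^+ 2 * cmod n `^ (alpha - 2).
  rewrite !cmodM cmodr (gtr0_norm a0) -/P.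
  apply: (@le_trans _ _ (1 * P * (Cl * (q * P) * cmod n `^ (alpha - 2)))); last first.
    by rewrite le_eqVlt; apply/orP; left; apply/eqP; ring.
  apply: ler_pM; rewrite ?mulr_ge0 ?cmod_ge0 ?(ltW a0) ?(ltW P0)//.
    by rewrite ler_pM2r// ltW// a1.
  apply: (le_trans b2); rewrite ler_pM2r// ler_pM2l//.
apply: (@le_trans _ _ (s * ((Ct + Cl * q) * P ^+ 2 * cmod n `^ (alpha - 2)))).
  rewrite ler_pM2l// (le_trans (cmodD _ _))// !mulrDl lerD//.
have nE : cmod n `^ (alpha - 2) = cmod n `^ (alpha - 1) / cmod n.
  by rewrite powRB2// powRB1//; field; rewrite gt_eqF.
rewrite nE.
have -> : s * ((Ct + Cl * q) * P ^+ 2 * (cmod n `^ (alpha - 1) / cmod n)) =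
   (Ct + Cl * q) * (s * P * cmod n `^ (alpha - 1)) * (P / cmod n) by ring.
have Q0 : 0 < Ct + Cl * q by rewrite addr_gt0// mulr_gt0.
apply: (@le_trans _ _ ((Ct + Cl * q) * (Cm * A) * (2 * P / cmod w))).
  apply: ler_pM.
  - by rewrite !mulr_ge0 ?(ltW Q0) ?(ltW s0) ?(ltW P0)// powR_ge0.
  - by rewrite divr_ge0 ?(ltW P0) ?cmod_ge0.
  - by rewrite ler_pM2l.
  rewrite ler_pdivrMr// mulrAC ler_pdivlMr ?cmod_gt0//.
  rewrite [2 * P]mulrC -mulrA ler_pM2l//.
  by move: w2n; lra.
rewrite /C le_eqVlt; apply/orP; left; apply/eqP; ring.
Qed.

End Pointwise.

#[local] Arguments cmod : simpl never.

(** * Integration of the pointwise error *)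

Section ErrIntegral.
Context {R : realType}.
Notation mu := (@lebesgue_measure R).

Lemma cmod_pol (r t : R) : 0 <= r -> cmod (complex_of (pol r t)) = r.
Proof.
move=> r0; have -> : complex_of (pol r t) = r%:C * expi t.
  by apply/eqP; rewrite eq_complex /= !mul0r subr0 addr0 !eqxx.
by rewrite cmodM cmodr cmod_expi mulr1 ger0_norm.
Qed.

Lemma integral_radial (h : R -> R) :
  measurable_fun [set: measurableTypeR R] h -> (forall r, 0 <= h r) ->
  (\int[Leb R]_z (h (cmod (complex_of z)))%:E =
   (2 * pi)%:E * \int[mu]_(r in `]0%R, +oo[) (r * h r)%:E)%E.
Proof.
move=> mh h0.
have mF : measurable_fun [set: plane R] (fun z => (h (cmod (complex_of z)))%:E).
  by apply/measurable_EFinP; exact: (measurableT_comp mh measurable_cmod).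
rewrite (integral_polar 0 mF); last by move=> z; rewrite lee_fin.
have -> : radial (fun z : plane R => (h (cmod (complex_of z)))%:E) =
    cst (\int[mu]_(r in `]0%R, +oo[) (r * h r)%:E)%E.
  apply/funext => t; rewrite /radial; apply: eq_integral => r.
  rewrite inE /= in_itv/= andbT => r0.
  by rewrite cmod_pol ?(ltW r0)// -EFinM.
rewrite integral_cst//= lebesgue_measure_itv/= add0r lte_fin ifT; last first.
  by rewrite mulr_gt0// pi_gt0.
by rewrite sube0 muleC.
Qed.

Lemma integral_itv_le (h : R -> R) (a b M : R) : a <= b -> 0 <= M ->
  measurable_fun [set: measurableTypeR R] h -> (forall r, 0 <= h r) ->
  (forall r, 0 < r -> ~~ (a <= r <= b) -> h r = 0) ->
  (forall r, 0 < r -> r * h r <= M) ->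
  (\int[mu]_(r in `]0%R, +oo[) (r * h r)%:E <= (M * (b - a))%:E)%E.
Proof.
move=> ab M0 mh h0 hout hM.
have mrh : measurable_fun [set: measurableTypeR R] (fun r => (r * h r)%:E).
  by apply/measurable_EFinP; apply: measurable_funM.
apply: (@le_trans _ _ (\int[mu]_(r in `]0%R, +oo[) (M * \1_(`[a, b]) r)%:E)%E).
  apply: ge0_le_integral => //.
  - by move=> r /=; rewrite in_itv/= andbT => r0; rewrite lee_fin mulr_ge0// ltW.
  - exact: measurable_funTS.
  - apply: measurable_funTS; apply/measurable_EFinP; apply: measurable_funM => //.
  move=> r /=; rewrite in_itv/= andbT => r0; rewrite lee_fin indicE.
  case: (boolP (r \in _)) => [_|/negP rab]; first by rewrite mulr1 hM.
  rewrite mulr0 hout ?mulr0//; apply/negP => rab'; apply: rab.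
  by rewrite inE /= in_itv.
apply: (@le_trans _ _ (\int[mu]_r (M * \1_(`[a, b]) r)%:E)%E).
  apply: ge0_subset_integral => //.
  - by apply/measurable_EFinP; apply: measurable_funM.
  - by move=> r _; rewrite lee_fin mulr_ge0.
under eq_integral do rewrite EFinM.
rewrite ge0_integralZl ?lee_fin//; last by apply/measurable_EFinP.
rewrite integral_indic// setIT; set m := (X in (_ * X)%E).
have -> : m = (b - a)%:E.
  rewrite /m -[LHS]/(lebesgue_measure `[a, b]) lebesgue_measure_itv/= lte_fin.
  by case: ltP => // ba; rewrite (le_anti (introT andP (conj ab ba))) subrr.
by rewrite -EFinM.
Qed.

Lemma measurable_fun_if_le (h : plane R -> R) (a : R) (f : plane R -> R) :
  measurable_fun setT h -> measurable_fun setT f ->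
  measurable_fun setT (fun z => if h z <= a then f z else 0).
Proof.
move=> mh mf; apply: measurable_fun_ifT => //.
exact: measurable_fun_ler.
Qed.

Lemma measurable_pair_err C c A P X :
  measurable_fun [set: plane R] (fun z => pair_err C c A P X (complex_of z) : R).
Proof.
have mc := @measurable_cmod R.
apply: measurable_funD.
  rewrite (_ : (fun z : plane R => _) = fun z : plane R => if cmod (complex_of z) <= 2 * X
     then C * A * P * cmod (complex_of z) `^ (-1) else 0); last first.
    by apply/funext => z; rewrite powR_inv1// cmod_ge0.
  apply: measurable_fun_if_le => //; apply: measurable_funM => //.
  exact: (measurableT_comp (measurable_powR (-1)) mc).
rewrite (_ : (fun z : plane R => _) = fun z : plane R => if bad c P X (complex_of z)
   then 1 else 0); last by apply/funext => z; case: bad.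
apply: measurable_fun_ifT => //.
apply: measurable_and; first exact: measurable_fun_ler.
apply: measurable_or.
  apply: measurable_fun_ler => //; apply: measurableT_comp => //; exact: measurable_snd.
apply: measurable_and; apply: measurable_fun_ler => //.
Qed.

(** All pieces are of order P X: the integral of 1 / |z| over a disk is proportional to its radius,
    while the strip and the annulus have length of order X and width of order P. *)
Lemma pair_err_integral (C c A P X : R) : 0 < C -> 0 < c -> 1 <= A -> 0 < P -> 0 < X ->
  (\int[Leb R]_z (pair_err C c A P X (complex_of z))%:E <=
   ((4 * pi * C + 8 * c + 8 * pi * c) * A * P * X)%:E)%E.
Proof.
move=> C0 c0 A1 P0 X0; have pi0 := @pi_gt0 R.
have A0 : 0 < A by exact: lt_le_trans A1.
pose h1 (r : R) : R := if r <= 2 * X then C * A * P * r `^ (-1) else 0.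
pose strip : set (plane R) := `[- (2 * X), 2 * X] `*` `[- (c * P), c * P].
pose h2 (r : R) : R := if (r <= 2 * X) && (X - c * P <= r <= X + c * P) then 1 else 0.
have mh1 : measurable_fun [set: measurableTypeR R] h1.
  apply: measurable_fun_ifT => //; first exact: measurable_fun_ler.
  by apply: measurable_funM => //; exact: measurable_powR.
have mh2 : measurable_fun [set: measurableTypeR R] h2.
  apply: measurable_fun_ifT => //; apply: measurable_and; first exact: measurable_fun_ler.
  by apply: measurable_and; exact: measurable_fun_ler.
have h10 r : 0 <= h1 r.
  by rewrite /h1; case: ifP => // _; rewrite mulr_ge0 ?powR_ge0// ltW// !mulr_gt0.
have h20 r : 0 <= h2 r by rewrite /h2; case: ifP.
have ms : measurable strip by apply: measurableX; exact: measurable_itv.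
have mz (h : R -> R) : measurable_fun [set: measurableTypeR R] h ->
    measurable_fun [set: plane R] (fun z => (h (cmod (complex_of z)))%:E).
  by move=> mh; apply/measurable_EFinP; exact: (measurableT_comp mh (@measurable_cmod R)).
have mI : measurable_fun [set: plane R] (fun z => (\1_strip z : R)%:E).
  by apply/measurable_EFinP; exact: measurable_indic.
apply: (@le_trans _ _ (\int[Leb R]_z ((h1 (cmod (complex_of z)))%:E +
     ((\1_strip z : R)%:E + (h2 (cmod (complex_of z)))%:E)))%E).
  apply: ge0_le_integral => //.
  - move=> z _; rewrite lee_fin addr_ge0// ?ler0n//; case: ifP => // _.
    by rewrite divr_ge0 ?cmod_ge0// ltW// !mulr_gt0.
  - by apply/measurable_EFinP; exact: measurable_pair_err.
  - by apply: emeasurable_funD; [exact: mz|apply: emeasurable_funD => //; exact: mz].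
  move=> z _; rewrite -!EFinD lee_fin /pair_err /h1 powR_inv1 ?cmod_ge0//.
  rewrite lerD2l /bad /h2; set w := complex_of z.
  have [w2|w2] := boolP (cmod w <= 2 * X); last by rewrite addr_ge0.
  rewrite andTb; case: (boolP (`|_| <= _)) => [im|im]; last first.
    by rewrite orFb andTb; case: ifP => _; rewrite ?lerDr// addr_ge0.
  rewrite orTb; apply: (@le_trans _ _ (\1_strip z)); last first.
    by rewrite lerDl; case: ifP.
  rewrite indicE mem_set// /strip; split => /=; rewrite in_itv/= -ler_norml//.
  exact: le_trans (proj1 (cmod_Re_Im w)) w2.
rewrite ge0_integralD//; first last.
- by apply: emeasurable_funD => //; exact: mz.
- by move=> z _; rewrite adde_ge0// lee_fin.
- exact: mz.
- by move=> z _; rewrite lee_fin.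
rewrite ge0_integralD//; first last.
- exact: mz.
- by move=> z _; rewrite lee_fin.
rewrite !integral_radial// integral_indic// setIT.
have -> : Leb R strip = (8 * c * P * X)%:E.
  transitivity (mu `[(- (2 * X))%R, (2 * X)%R] * mu `[(- (c * P))%R, (c * P)%R])%E.
    exact: product_measure1E.
  have lt (x : R) : 0 < x -> - x < x by move=> x0; lra.
  rewrite !lebesgue_measure_itv/= !lte_fin !lt ?mulr_gt0// -EFinM.
  by congr EFin; ring.
have i1 : (\int[mu]_(r in `]0%R, +oo[) (r * h1 r)%:E <= (C * A * P * (2 * X - 0))%:E)%E.
  apply: integral_itv_le => //.
  - by rewrite mulr_ge0// ltW.
  - by rewrite ltW// !mulr_gt0.
  - by move=> r r0; rewrite /h1 (ltW r0)/= => /negbTE ->.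
  move=> r r0; rewrite /h1; case: ifP => _; last by rewrite mulr0 ltW// !mulr_gt0.
  by rewrite powR_inv1 ?(ltW r0)// mulrCA mulfV ?mulr1// gt_eqF.
have i2 : (\int[mu]_(r in `]0%R, +oo[) (r * h2 r)%:E <=
     (2 * X * ((X + c * P) - (X - c * P)))%:E)%E.
  apply: integral_itv_le => //.
  - by have := mulr_gt0 c0 P0; lra.
  - by rewrite mulr_ge0// ltW.
  - by move=> r r0; rewrite /h2 => /negbTE ->; rewrite andbF.
  move=> r r0; rewrite /h2; case: ifP => [/andP[r2 _]|_]; first by rewrite mulr1.
  by rewrite mulr0 mulr_ge0// ltW.
apply: (@le_trans _ _ ((2 * pi)%:E * (C * A * P * (2 * X - 0))%:E + ((8 * c * P * X)%:E +
   (2 * pi)%:E * (2 * X * ((X + c * P) - (X - c * P)))%:E))%E).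
  by apply: leeD; [|apply: leeD2l]; rewrite lee_wpmul2l// lee_fin mulr_ge0// ltW.
rewrite -!EFinM -!EFinD lee_fin.
have cpx : 0 < c * P * X by rewrite !mulr_gt0.
have pcpx : 0 < pi * (c * P * X) by rewrite !mulr_gt0.
have q1 := ler_wpM2r (ltW cpx) A1; have q2 := ler_wpM2r (ltW pcpx) A1.
lra.
Qed.

End ErrIntegral.

Section PairSum.
Context {R : realType}.
Variables (b : R[i] * R[i]) (L : set R[i]) (hb : is_Zbasis L b) (z0 : R[i]).
Notation Lam := (Zgrid z0 L).
Variable alpha : R.
Hypothesis halpha : 0 < alpha < 1.

Definition lin_int (u : R[i] -> R) (s X : R) (k : int) (p : R[i]) : \bar R :=
  (\int[Leb R]_z (lin_val u alpha s X k p (complex_of z))%:E)%E.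

Lemma measurable_lin_val (u : R[i] -> R) (B A s X : R) k p : bump u B A ->
  measurable_fun [set: plane R] (fun z => lin_val u alpha s X k p (complex_of z)).
Proof.
case=> _ uL _.
rewrite (_ : (fun z => _) = fun z : plane R => if cmod (complex_of z) <= X then
  (if complex_of z == 0 then 0 else
   u ((s%:C * (alpha%:C * p)) * branch_pow (alpha - 1) k (complex_of z))) else 0); last first.
  apply/funext => z; rewrite /lin_val; case: (_ == 0) => //=; first by case: ifP.
  by rewrite !mulrA.
apply: measurable_fun_if_le; first exact: measurable_cmod.
exact: (measurable_branch_pow _ _ _ uL).
Qed.

Lemma lin_int_lty (u : R[i] -> R) (B A s X : R) k p : bump u B A -> 0 <= X ->
  (lin_int u s X k p < +oo)%E.
Proof.
move=> bu X0; have [u0 _ _] := bu.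
have B0 : 0 <= B by have /andP[] := u0 0; exact: le_trans.
apply: (@le_lt_trans _ _ (\int[Leb R]_z (B%:E * (\1_(cbox X) z)%:E))%E).
  apply: ge0_le_integral => //.
  - by move=> z _; rewrite lee_fin /lin_val; case: ifP => // _; have /andP[] := u0 (s%:C * (alpha%:C * p * branch_pow (alpha - 1) k (complex_of z))).
  - by apply/measurable_EFinP; exact: (measurable_lin_val _ _ _ _ bu).
  - apply: emeasurable_funM => //; apply/measurable_EFinP.
    by apply: measurable_indic; exact: measurable_cbox.
  move=> z _; rewrite -EFinM lee_fin /lin_val.
  case: ifPn => [/andP[_ zX]|_]; last by rewrite mulr_ge0.
  rewrite indicE mem_set ?mulr1; last exact: cmod_cbox.
  by have /andP[] := u0 (s%:C * (alpha%:C * p * branch_pow (alpha - 1) k (complex_of z))).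
rewrite ge0_integralZl ?lee_fin//; last first.
  by apply/measurable_EFinP; apply: measurable_indic; exact: measurable_cbox.
rewrite integral_indic ?setIT//; last exact: measurable_cbox.
by rewrite Leb_cbox// -EFinM ltry.
Qed.

Lemma lin_int_ge0 (u : R[i] -> R) (B A s X : R) k p : bump u B A ->
  (0 <= lin_int u s X k p)%E.
Proof.
move=> [u0 _ _]; apply: integral_ge0 => z _; rewrite lee_fin /lin_val.
by case: ifP => // _; have /andP[] := u0 (s%:C * (alpha%:C * p * branch_pow (alpha - 1) k (complex_of z))).
Qed.

Lemma pair_sum_estimate : exists C Cs : R, [/\ 0 < C, 0 < Cs &
  forall u B A, 1 <= A -> bump u B A ->
  forall s X k p (S : seq R[i]), 0 < s -> Cs * A <= s -> ldiam b <= X -> L p -> p != 0 ->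
    uniq S -> (forall n, n \in S <-> [/\ Lam n, n != 0 & cmod n <= X]) ->
  `|lvol b * (\sum_(n <- S) pair_val u alpha s X k p n) - fine (lin_int u s X k p)|
     <= C * B * A * cmod p * X].
Proof.
have [C [c [Cs [C0 c0 Cs0 pw]]]] := pair_pointwise hb z0 halpha.
have pi0 := @pi_gt0 R.
pose CE := 4 * pi * C + 8 * c + 8 * pi * c.
have CE0 : 0 < CE by rewrite !addr_gt0// !mulr_gt0.
exists CE, Cs; split => // u B A A1 bu s X k p S s0 sA dX Lp p0 uS hS.
have [u0 uL uA] := bu.
have B0 : 0 <= B by have /andP[] := u0 0; exact: le_trans.
have d0 := ldiam_gt0 hb.
have X0 : 0 < X by exact: lt_le_trans dX.
have P0 : 0 < cmod p by rewrite cmod_gt0.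
have A0 : 0 < A by exact: lt_le_trans A1.
have mF := measurable_lin_val s X k p bu.
have merr := @measurable_pair_err R C c A (cmod p) X.
have err0 z : 0 <= pair_err C c A (cmod p) X z.
  rewrite addr_ge0 ?ler0n//; case: ifP => // _.
  by rewrite divr_ge0 ?cmod_ge0// ltW// !mulr_gt0.
have [] := @tile_sum R b L hb z0 S (pair_val u alpha s X k p)
  (fun z => lin_val u alpha s X k p (complex_of z))
  (fun z => B * pair_err C c A (cmod p) X (complex_of z)) uS.
- by move=> n /hS[].
- by move=> n; rewrite /pair_val; case: ifP => // _; have /andP[] := u0 (s%:C * (branch_pow alpha k n - branch_pow alpha k (n - p))).
- exact: mF.
- by move=> z; rewrite /lin_val; case: ifP => // _; have /andP[] := u0 (s%:C * (alpha%:C * p * branch_pow (alpha - 1) k (complex_of z))).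
- exact: measurable_funM.
- by move=> z; rewrite mulr_ge0.
- move=> n z Ln tn; rewrite (_ : (if n \in S then _ else 0) = pair_val u alpha s X k p n).
    exact: pw.
  case: ifPn => // nS; rewrite /pair_val ifF//; apply/negP => /and4P[n0 nX _ _].
  by move/negP : nS; apply; apply/hS.
have -> : (\int[Leb R]_z (B * pair_err C c A (cmod p) X (complex_of z))%:E =
   B%:E * \int[Leb R]_z (pair_err C c A (cmod p) X (complex_of z))%:E)%E.
  under eq_integral do rewrite EFinM.
  rewrite ge0_integralZl ?lee_fin//; first by apply/measurable_EFinP.
  by move=> z _; rewrite lee_fin.
have bnd : (B%:E * \int[Leb R]_z (pair_err C c A (cmod p) X (complex_of z))%:E <=
    (CE * B * A * cmod p * X)%:E)%E.
  apply: (@le_trans _ _ (B%:E * (CE * A * cmod p * X)%:E)%E).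
    by rewrite lee_wpmul2l ?lee_fin// pair_err_integral.
  by rewrite -EFinM lee_fin le_eqVlt; apply/orP; left; apply/eqP; ring.
rewrite -/(lin_int u s X k p).
have fE : lin_int u s X k p = (fine (lin_int u s X k p))%:E.
  by rewrite fineK// ge0_fin_numE ?(lin_int_ge0 _ _ _ _ bu)// (lin_int_lty _ _ _ bu)// ltW.
rewrite fE => h1 h2.
have := le_trans h1 (leeD2l _ bnd); have := le_trans h2 (leeD2l _ bnd).
rewrite -!EFinD !lee_fin ler_norml => h3 h4; apply/andP; split; lra.
Qed.

End PairSum.

Lemma fine_close {R : realType} (x y : \bar R) (e : R) :
  x \is a fin_num -> y \is a fin_num ->
  (x <= y + e%:E)%E -> (y <= x + e%:E)%E -> `|fine x - fine y| <= e.
Proof.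
move: x y => [x| |] [y| |]//= _ _; rewrite -!EFinD !lee_fin => h1 h2.
by rewrite ler_norml; apply/andP; split; lra.
Qed.

(** * Averaging over the levels *)

Section Averaging.
Context {R : realType}.
Notation mu := (@lebesgue_measure R).
Variable alpha : R.
Hypothesis halpha : 0 < alpha < 1.
Let a0 : 0 < alpha. Proof. by case/andP: halpha. Qed.
Let a1 : alpha < 1. Proof. by case/andP: halpha. Qed.
Variables (u : R[i] -> R) (B A : R).
Hypothesis (bu : bump u B A).

Let u0 z : 0 <= u z. Proof. by have [/(_ z)/andP[]] := bu. Qed.
Let uB z : u z <= B. Proof. by have [/(_ z)/andP[]] := bu. Qed.
Let B0 : 0 <= B. Proof. exact: le_trans (u0 0) (uB 0). Qed.
Let uL z w : `|u z - u w| <= B * cmod (z - w).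
Proof. by have [_ h _] := bu; exact: h. Qed.
Let uA z : A <= cmod z -> u z = 0. Proof. by have [_ _] := bu; apply. Qed.

(* In polar coordinates [lin_val] depends on the level and on the argument of the
   point only through the argument [t] of its value. *)
Definition ray (c X t r : R) : R :=
  if r <= X then u ((c * r `^ (alpha - 1))%:C * expi t) else 0.

Definition wint (c X t : R) : \bar R :=
  (\int[mu]_(r in `]0%R, +oo[) (r * ray c X t r)%:E)%E.

(** The integral I(c) of the overview, in polar coordinates. *)
Definition Icirc (c : R) : \bar R :=
  (\int[mu]_(t in `[0%R, (2 * pi)%R[) wint c 1 t)%E.

Lemma ray_ge0 c X t r : 0 <= ray c X t r.
Proof. by rewrite /ray; case: ifP. Qed.

(** The map c |z|^(alpha-2) z keeps the argument and has no branch, so [wint] becomes the radial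
    integral of a measurable function of the plane; measurability in t follows. *)
Let planar (c X : R) (z : plane R) : R :=
  if cmod (complex_of z) <= X then
    u ((c * cmod (complex_of z) `^ (alpha - 2))%:C * complex_of z) else 0.

Let mplanar c X : measurable_fun [set: plane R] (planar c X).
Proof.
apply: measurable_fun_if_le; first exact: measurable_cmod.
have mu1 := lipschitz_measurable uL.
pose M (z : plane R) : plane R :=
  (c * cmod (complex_of z) `^ (alpha - 2) * z.1, c * cmod (complex_of z) `^ (alpha - 2) * z.2).
rewrite (_ : (fun z : plane R => _) = (fun z => u (complex_of (M z)))); last first.
  apply/funext => z; congr u; apply/eqP.
  by rewrite eq_complex /= !mul0r subr0 addr0 !eqxx.
have mc : measurable_fun [set: plane R]
    (fun z => c * cmod (complex_of z) `^ (alpha - 2)).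
  apply: measurable_funM => //.
  exact: (measurableT_comp (measurable_powR (alpha - 2)) (@measurable_cmod R)).
apply: (measurableT_comp mu1); apply: measurable_fun_pair; exact: measurable_funM.
Qed.

Lemma pol_complex (r t : R) : complex_of (pol r t) = r%:C * expi t.
Proof.
by apply/eqP; rewrite eq_complex /= !mul0r subr0 addr0 !eqxx.
Qed.

Lemma powR_split2 (r : R) : 0 < r -> r `^ (alpha - 2) * r = r `^ (alpha - 1).
Proof. by move=> r0; rewrite powRB2// powRB1//; field; rewrite gt_eqF. Qed.

Lemma wintE c X t : wint c X t = radial (fun z => (planar c X z)%:E) t.
Proof.
rewrite /wint /radial; apply: eq_integral => r; rewrite inE /= in_itv/= andbT => r0.
rewrite -EFinM /planar /ray cmod_pol ?(ltW r0)// pol_complex.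
congr (r * _)%:E; case: ifP => // _; congr u.
by rewrite mulrA -rmorphM -mulrA powR_split2.
Qed.

Lemma measurable_wint c X : measurable_fun [set: measurableTypeR R] (wint c X).
Proof.
rewrite (_ : wint c X = radial (fun z => (planar c X z)%:E)); last first.
  by apply/funext => t; exact: wintE.
apply: measurable_radial; first by apply/measurable_EFinP; exact: mplanar.
by move=> z; rewrite lee_fin /planar; case: ifP.
Qed.

Lemma wint_ge0 c X t : (0 <= wint c X t)%E.
Proof.
apply: integral_ge0 => r /=; rewrite in_itv/= andbT => r0.
by rewrite lee_fin mulr_ge0 ?ray_ge0// ltW.
Qed.

Lemma wint2pi c X t : wint c X (t + 2 * pi) = wint c X t.
Proof.
by rewrite /wint /ray; have := expiz t 1; rewrite mulr1 => ->.
Qed.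

Lemma measurable_ray c X t : measurable_fun [set: measurableTypeR R] (ray c X t).
Proof.
apply: measurable_fun_ifT => //; first exact: measurable_fun_ler.
have mu1 := lipschitz_measurable uL.
pose M (r : R) : plane R := pol (c * r `^ (alpha - 1)) t.
rewrite (_ : (fun r : R => _) = (fun r => u (complex_of (M r)))); last first.
  by apply/funext => r; rewrite /M pol_complex.
apply: (measurableT_comp mu1); apply: (measurableT_comp (measurable_pol_t t)).
by apply: measurable_funM => //; exact: measurable_powR.
Qed.

Lemma wint_scale c X t : 0 < X ->
  wint c X t = ((X ^+ 2)%:E * wint (c * X `^ (alpha - 1)) 1 t)%E.
Proof.
move=> X0.
have wE (c' X' : R) : wint c' X' t =
    (\int[mu]_r (\1_(`]0%R, +oo[) r * (r * ray c' X' t r))%:E)%E.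
  rewrite /wint integral_mkcond; apply: eq_integral => r _.
  by rewrite /patch indicE; case: ifP; rewrite ?mul1r ?mul0r.
have mr (c' X' : R) : measurable_fun [set: measurableTypeR R]
    (fun r => (\1_(`]0%R, +oo[) r * (r * ray c' X' t r))%:E).
  apply/measurable_EFinP; apply: measurable_funM => //.
  by apply: measurable_funM => //; exact: measurable_ray.
have r0 (c' X' r : R) : (0 <= (\1_(`]0%R, +oo[) r * (r * ray c' X' t r))%:E)%E.
  rewrite lee_fin indicE; case: (boolP (r \in _)) => [|_]; last by rewrite mul0r.
  by rewrite inE /= in_itv/= andbT mul1r => r0; rewrite mulr_ge0 ?ray_ge0 ?(ltW r0).
rewrite !wE (@integral_affine R X 0 _ (lt0r_neq0 X0) (mr c X) (r0 c X)).
have X2 : (0 <= (X ^+ 2)%:E)%E by rewrite lee_fin sqr_ge0.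
rewrite -(ge0_integralZl mu measurableT (mr _ 1) (fun r _ => r0 _ _ r) X2).
apply: eq_integral => r _.
rewrite addr0 -!EFinM (gtr0_norm X0); congr EFin.
rewrite !indicE.
have -> : (X * r \in `]0%R, +oo[%classic) = (r \in `]0%R, +oo[%classic).
  by apply/idP/idP; rewrite !inE /= !in_itv/= !andbT pmulr_rgt0.
case: (boolP (r \in _)) => [|_]; last by rewrite !mul0r !mulr0.
rewrite inE /= in_itv/= andbT => rp; rewrite !mul1r.
have -> : ray c X t (X * r) = ray (c * X `^ (alpha - 1)) 1 t r.
  rewrite /ray -[X in _ <= X]mulr1 ler_pM2l//; case: ifP => // _.
  by rewrite powRM ?(ltW X0) ?(ltW rp)// mulrA.
ring.
Qed.

Lemma wint_le c t : (wint c 1 t <= B%:E)%E.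
Proof.
rewrite -[B]mulr1 -[X in B * X]subr0; apply: integral_itv_le => //.
- exact: measurable_ray.
- by move=> r; exact: ray_ge0.
- by move=> r r0; rewrite (ltW r0)/= /ray => /negbTE ->.
move=> r r0; rewrite /ray; case: ifP => r1; last by rewrite mulr0.
by rewrite -[X in _ <= X]mul1r ler_pM ?(ltW r0).
Qed.

Lemma powR_ge1_neg (r : R) : 0 < r -> r <= 1 -> 1 <= r `^ (alpha - 1).
Proof.
by move=> r0 r1; have := pow_neg_ge halpha r0 r1; rewrite powR1.
Qed.

Lemma wint_eq0 c t : 0 <= c -> A <= c -> wint c 1 t = 0%E.
Proof.
move=> c0 Ac; rewrite /wint integral0_eq// => r /=; rewrite in_itv/= andbT => r0.
rewrite /ray; case: ifP => r1; last by rewrite mulr0.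
rewrite uA ?mulr0// cmodM cmodr cmod_expi mulr1.
rewrite ger0_norm ?mulr_ge0 ?powR_ge0//.
apply: (le_trans Ac); rewrite -[X in X <= _]mulr1 ler_wpM2l//.
exact: powR_ge1_neg.
Qed.

Lemma Icirc_ge0 c : (0 <= Icirc c)%E.
Proof. by apply: integral_ge0 => t _; exact: wint_ge0. Qed.

Lemma Icirc_le c : (Icirc c <= (2 * pi * B)%:E)%E.
Proof.
have p0 := @pi_gt0 R.
apply: (@le_trans _ _ (\int[mu]_(t in `[0%R, (2 * pi)%R[) B%:E)%E).
  apply: ge0_le_integral => //; last by move=> t _; exact: wint_le.
  - by move=> t _; exact: wint_ge0.
  - by apply: measurable_funTS; exact: measurable_wint.
rewrite integral_cst//= lebesgue_measure_itv/= lte_fin ifT ?mulr_gt0//.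
by rewrite sube0 -EFinM mulrC.
Qed.

Lemma Icirc_fin c : Icirc c \is a fin_num.
Proof.
by rewrite ge0_fin_numE ?Icirc_ge0// (le_lt_trans (Icirc_le c))// ltry.
Qed.

Lemma Icirc_eq0 c : 0 <= c -> A <= c -> Icirc c = 0%E.
Proof.
by move=> c0 Ac; rewrite /Icirc integral0_eq// => t _; rewrite wint_eq0.
Qed.

(** The factor r of the polar measure absorbs the singularity at 0: r times r^(alpha-1) is r^alpha,
    at most 1 on the unit interval. *)
Lemma wint_lip c c' t : 0 <= c -> 0 <= c' ->
  (wint c 1 t <= wint c' 1 t + (B * `|c - c'|)%:E)%E.
Proof.
move=> c0 c0'.
pose h (r : R) : R := if r <= 1 then B * `|c - c'| * r `^ (alpha - 1) else 0.
have mh : measurable_fun [set: measurableTypeR R] h.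
  apply: measurable_fun_ifT => //; first exact: measurable_fun_ler.
  by apply: measurable_funM => //; exact: measurable_powR.
have h0 r : 0 <= h r by rewrite /h; case: ifP => // _; rewrite !mulr_ge0 ?powR_ge0.
apply: (@le_trans _ _ (wint c' 1 t + \int[mu]_(r in `]0%R, +oo[) (r * h r)%:E)%E).
  rewrite /wint -ge0_integralD//; first last.
  - by apply: measurable_funTS; apply/measurable_EFinP; apply: measurable_funM.
  - by move=> r /=; rewrite in_itv/= andbT => r0; rewrite lee_fin mulr_ge0 ?(ltW r0).
  - apply: measurable_funTS; apply/measurable_EFinP; apply: measurable_funM => //.
    exact: measurable_ray.
  - by move=> r /=; rewrite in_itv/= andbT => r0; rewrite lee_fin mulr_ge0 ?ray_ge0 ?(ltW r0).
  apply: ge0_le_integral => //.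
  - by move=> r /=; rewrite in_itv/= andbT => r0; rewrite lee_fin mulr_ge0 ?ray_ge0 ?(ltW r0).
  - apply: measurable_funTS; apply/measurable_EFinP; apply: measurable_funM => //.
    exact: measurable_ray.
  - apply: measurable_funTS; apply: emeasurable_funD; apply/measurable_EFinP; apply: measurable_funM => //.
    exact: measurable_ray.
  move=> r /=; rewrite in_itv/= andbT => r0; rewrite -EFinD lee_fin -mulrDr ler_pM2l//.
  rewrite /ray /h; case: ifP => r1; last by rewrite addr0.
  have := uL ((c * r `^ (alpha - 1))%:C * expi t) ((c' * r `^ (alpha - 1))%:C * expi t).
  rewrite -mulrBl cmodM cmod_expi mulr1 -rmorphB cmodr -mulrBl normrM.
  rewrite (ger0_norm (powR_ge0 _ _)) mulrA ler_norml; lra.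
rewrite leeD2l// -[X in (_ <= X%:E)%E]mulr1 -[X in _ * X]subr0.
apply: integral_itv_le => //.
- by rewrite mulr_ge0.
- by move=> r r0; rewrite (ltW r0)/= /h => /negbTE ->.
move=> r r0; rewrite /h; case: ifP => r1; last by rewrite mulr0 mulr_ge0.
rewrite mulrCA -[X in _ <= X]mulr1 ler_wpM2l ?mulr_ge0//.
rewrite powRB1// mulrCA mulfV ?mulr1 ?gt_eqF//.
have : r `^ alpha <= 1 `^ alpha by rewrite ge0_ler_powR ?nnegrE ?(ltW a0) ?(ltW r0).
by rewrite powR1.
Qed.

Lemma Icirc_lip c c' : 0 <= c -> 0 <= c' ->
  `|fine (Icirc c) - fine (Icirc c')| <= 2 * pi * B * `|c - c'|.
Proof.
have p0 := @pi_gt0 R.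
have half x y : 0 <= x -> 0 <= y ->
    (Icirc x <= Icirc y + (2 * pi * B * `|x - y|)%:E)%E.
  move=> x0 y0.
  apply: (@le_trans _ _ (Icirc y + \int[mu]_(t in `[0%R, (2 * pi)%R[) (B * `|x - y|)%:E)%E).
    rewrite /Icirc -ge0_integralD//; first last.
    - by move=> t _; rewrite lee_fin mulr_ge0.
    - by apply: measurable_funTS; exact: measurable_wint.
    - by move=> t _; exact: wint_ge0.
    apply: ge0_le_integral => //.
    - by move=> t _; exact: wint_ge0.
    - by apply: measurable_funTS; exact: measurable_wint.
    - by apply: measurable_funTS; apply: emeasurable_funD => //; exact: measurable_wint.
    by move=> t _; exact: wint_lip.
  rewrite leeD2l// integral_cst//= lebesgue_measure_itv/= lte_fin ifT ?mulr_gt0//.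
  by rewrite sube0 -EFinM lee_fin mulrC mulrA.
move=> c0 c0'; apply: fine_close; [exact: Icirc_fin|exact: Icirc_fin|exact: half|].
by rewrite distrC; exact: half.
Qed.

(** With the polar angle starting at 2 pi k, it is the argument at level k itself. The level then
    survives only in the interval of integration, and p only through its modulus and a rotation. *)
Lemma lin_int_wint (s X : R) k (p : R[i]) (om : R) : 0 < s -> 0 < X ->
  p = (cmod p)%:C * expi om ->
  lin_int alpha u s X k p =
  ((X ^+ 2)%:E * \int[mu]_(t in `[(2 * pi * k%:~R)%R, (2 * pi * (k + 1)%:~R)%R[)
     wint (s * alpha * cmod p * X `^ (alpha - 1)) 1 ((alpha - 1) * t + om)%R)%E.
Proof.
move=> s0 X0 pE.
have mF := measurable_lin_val alpha s X k p bu.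
rewrite /lin_int (integral_polar (2 * pi * k%:~R)); first last.
- by move=> z; rewrite lee_fin /lin_val; case: ifP.
- by apply/measurable_EFinP; exact: mF.
rewrite two_piS -ge0_integralZl ?lee_fin ?sqr_ge0//; first last.
- by move=> t _; exact: wint_ge0.
- apply: measurable_funTS; apply: (measurableT_comp (measurable_wint _ _)).
  by apply: measurable_funD => //; apply: measurable_funM.
apply: eq_integral => t; rewrite inE /= in_itv/= => ht.
rewrite -wint_scale//; apply: eq_integral => r; rewrite inE /= in_itv/= andbT => r0.
rewrite -EFinM; congr (r * _)%:E.
rewrite /lin_val /ray cmod_pol ?(ltW r0)// pol_complex.
have z0 : r%:C * expi t != 0 by rewrite -cmod_gt0 cmodM cmodr cmod_expi mulr1 normr_gt0 gt_eqF.
rewrite z0 andTb; case: ifP => // _; congr u.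
rewrite /branch_pow branch_arg_polar ?two_piS// cmodM cmodr cmod_expi mulr1 gtr0_norm//.
rewrite [in LHS]pE expiD !rmorphM /=; ring.
Qed.

Lemma levels_cat (N' N'' : nat) (G : R -> \bar R) :
  measurable_fun [set: measurableTypeR R] G -> (forall t, 0 <= G t)%E ->
  (\sum_(k <- levels N' N'') \int[mu]_(t in `[(2 * pi * k%:~R)%R, (2 * pi * (k + 1)%:~R)%R[) G t =
   \int[mu]_(t in `[(- (2 * pi * N'%:R))%R, ((- (2 * pi * N'%:R)) + (2 * pi) *+ (N' + N''))%R[) G t)%E.
Proof.
move=> mG G0; rewrite /levels big_map.
have p0 := @pi_gt0 R.
elim: (N' + N'')%N => [|n ih].
  by rewrite big_nil mulr0n addr0 set_itvco0 integral_set0.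
rewrite -addn1 iotaD big_cat ih big_seq1 add0n addn1.
set a := (- (2 * pi * N'%:R))%R.
have e1 : (2 * pi * (n%:Z - N'%:Z)%:~R)%R = a + (2 * pi) *+ n.
  by rewrite intrB mulrBr addrC /a -[(2 * pi) *+ n]mulr_natr.
have e2 : (2 * pi * (n%:Z - N'%:Z + 1)%:~R)%R = a + (2 * pi) *+ n.+1.
  by rewrite two_piS e1 [(2 * pi) *+ n.+1]mulrSr addrA.
have l1 : a <= a + (2 * pi) *+ n by rewrite lerDl mulrn_wge0// mulr_ge0// ltW.
have l2 : a + (2 * pi) *+ n <= a + (2 * pi) *+ n.+1.
  by rewrite lerD2l [(2 * pi) *+ n.+1]mulrSr lerDl mulr_ge0// ltW.
by rewrite e1 e2 [RHS](integral_itv_cat mG G0 l1 l2).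
Qed.

(** The intervals of consecutive levels join into N' + N'' periods, to which [average_period]
    applies with slope alpha - 1. The error is one turn of the rotated argument divided by the speed
    1 - alpha, whatever the number of levels. *)
Lemma lin_int_average (s X : R) (p : R[i]) (N' N'' : nat) : 0 < s -> 0 < X ->
  p != 0 ->
  `|\sum_(k <- levels N' N'') fine (lin_int alpha u s X k p) -
     (N' + N'')%:R * (X ^+ 2 * fine (Icirc (s * alpha * cmod p * X `^ (alpha - 1))))| <=
  (1 - alpha)^-1 * (X ^+ 2 * fine (Icirc (s * alpha * cmod p * X `^ (alpha - 1)))).
Proof.
move=> s0 X0 pn0; have p0 := @pi_gt0 R.
have [om _ pE] := arg0_exists pn0.
set c := s * alpha * cmod p * X `^ (alpha - 1).
pose G (t : R) := wint c 1 ((alpha - 1) * t + om).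
have mG : measurable_fun [set: measurableTypeR R] G.
  apply: (measurableT_comp (measurable_wint _ _)).
  by apply: measurable_funD => //; apply: measurable_funM.
have G0 t : (0 <= G t)%E by exact: wint_ge0.
have X2 : 0 < X ^+ 2 by rewrite exprn_gt0.
have [] := @average_period R (wint c 1) (measurable_wint c 1) (wint_ge0 c 1)
  (2 * pi) (mulr_gt0 (ltr0n _ 2) p0) (wint2pi c 1) (alpha - 1) om (- (2 * pi * N'%:R)) (N' + N'').
  by rewrite subr_lt0.
rewrite -/(Icirc c) -/G -levels_cat//.
set Sg := (\sum_(k <- _) _)%E.
have an : `|alpha - 1| = 1 - alpha by rewrite ltr0_norm ?opprB// subr_lt0.
rewrite an.
have Sfin : Sg \is a fin_num -> \sum_(k <- levels N' N'') fine (lin_int alpha u s X k p) = X ^+ 2 * fine Sg.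
  move=> fS; apply: EFin_inj; rewrite -sumEFin EFinM fineK// /Sg ge0_sume_distrr; last first.
    by move=> k _; apply: integral_ge0 => t _; exact: G0.
  apply: eq_bigr => k _; rewrite fineK; first exact: lin_int_wint.
  by rewrite ge0_fin_numE ?(lin_int_ge0 _ _ _ _ _ bu)// (lin_int_lty _ _ _ _ bu)// ltW.
have Sg0 : (0 <= Sg)%E.
  by apply: sume_ge0 => k _; apply: integral_ge0 => t _; exact: G0.
rewrite -[Icirc c]fineK ?Icirc_fin//.
set w := fine (Icirc c) => h1 h2.
have fS : Sg \is a fin_num.
  by rewrite ge0_fin_numE// (le_lt_trans h1)// -EFinM ltry.
rewrite (Sfin fS); move: h1 h2; rewrite -(fineK fS) -!EFinM -EFinD !lee_fin /=.
set q := fine Sg; set K := _%:R; set d := (1 - alpha)^-1 => h1 h2.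
have -> : X ^+ 2 * q - K * (X ^+ 2 * w) = X ^+ 2 * (q - K * w) by ring.
rewrite normrM (gtr0_norm X2) [d * _]mulrCA ler_pM2l// ler_norml.
by apply/andP; split; lra.
Qed.

End Averaging.

Lemma sum_seq_restrict (R : zmodType) (I : eqType) (G G' : seq I) (g : I -> R) :
  uniq G -> uniq G' -> (forall i, i \in G -> i \notin G' -> g i = 0) ->
  \sum_(i <- G') (if i \in G then g i else 0) = \sum_(i <- G) g i.
Proof.
move=> uG uG' g0; rewrite -big_mkcond -big_filter.
rewrite [RHS](bigID (fun i => i \in G'))/= [X in _ = _ + X]big1_seq ?addr0; last first.
  by move=> i /andP[iG' iG]; exact: g0.
rewrite -[RHS]big_filter; apply: perm_big; apply: uniq_perm; rewrite ?filter_uniq//.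
by move=> i; rewrite !mem_filter andbC.
Qed.

(** * Reduction to a sum over the lattice *)

Section MainEstimate.
Context {R : realType}.
Variables (b : R[i] * R[i]) (L : set R[i]) (hb : is_Zbasis L b) (z0 : R[i]).
Notation Lam := (Zgrid z0 L).
Variable alpha : R.
Hypothesis halpha : 0 < alpha < 1.
Let a0 : 0 < alpha. Proof. by case/andP: halpha. Qed.
Let a1 : alpha < 1. Proof. by case/andP: halpha. Qed.

Let hL : is_Zlattice L. Proof. by exists b. Qed.

Lemma grid_ball_seq (w : R[i]) (X : R) : exists S : seq R[i], uniq S /\
  forall n, n \in S <-> [/\ Zgrid w L n, n != 0 & cmod n <= X].
Proof.
have /finite_seqP[s sE] := finite_lattice_ball (X + cmod w) hL.
pose S := [seq n <- undup [seq w + p | p <- s] | (n != 0) && (cmod n <= X)].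
exists S; split; first by rewrite filter_uniq// undup_uniq.
move=> n; rewrite mem_filter mem_undup; split.
  move=> /andP[/andP[n0 nX] /mapP[p ps nE]]; split => //; rewrite nE.
  by exists p => //; suff [] : [set p | L p /\ cmod p <= X + cmod w] p by []; rewrite sE.
move=> [[p Lp <-] n0 nX]; rewrite n0 nX/=; apply: map_f.
suff : [set` s] p by [].
rewrite -sE; split => //.
by rewrite -[p](addKr w) addrC (le_trans (cmodD _ _))// cmodN lerD2r.
Qed.

(** Finite support for sums over nonzero lattice vectors of functions vanishing for |p| >= r. Extra
    vectors are allowed, so one list can serve several radii; [covers_sum] shows that the choice is
    immaterial. *)
Definition covers (SP : seq R[i]) (r : R) : Prop :=
  [/\ uniq SP, forall p, p \in SP -> L p /\ p != 0 &
      forall p, L p -> p != 0 -> cmod p < r -> p \in SP].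

Lemma Zgrid0 : Zgrid 0 L = L.
Proof.
apply/seteqP; split => [_ [p Lp <-]|p Lp]; first by rewrite add0r.
by exists p => //; rewrite add0r.
Qed.

Lemma lattice_ball_seq (X : R) : exists S : seq R[i], uniq S /\
  forall p, p \in S <-> [/\ L p, p != 0 & cmod p <= X].
Proof.
by have [S [uS hS]] := grid_ball_seq 0 X; rewrite Zgrid0 in hS; exists S.
Qed.

Lemma covers_sum (F : R[i] -> R) SP SP' r r' : covers SP r -> covers SP' r' ->
  (forall p, L p -> p != 0 -> r <= cmod p -> F p = 0) ->
  (forall p, L p -> p != 0 -> r' <= cmod p -> F p = 0) ->
  \sum_(p <- SP) F p = \sum_(p <- SP') F p.
Proof.
move=> [u1 h1 c1] [u2 h2 c2] F1 F2.
rewrite -(sum_seq_restrict u1 u2); last first.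
  move=> p pS pS'; have [Lp p0] := h1 _ pS; apply: F2 => //.
  by rewrite leNgt; apply: contra pS' => h; exact: c2.
rewrite [LHS]big_seq [RHS]big_seq; apply: eq_bigr => p pS'.
case: ifPn => // pS; have [Lp p0] := h2 _ pS'; rewrite F1//.
by rewrite leNgt; apply: contra pS => h; exact: c1.
Qed.

(** Excluding 0 removes the additive constant: a nonempty list forces T >= 1 / [lK], so T plus the
    diameter of a tile is at most a multiple of T. *)
Lemma lattice_card : exists2 C : R, 0 < C & forall (T : R) (S : seq R[i]),
  uniq S -> (forall p, p \in S -> [/\ L p, p != 0 & cmod p <= T]) ->
  (size S)%:R <= C * T ^+ 2.
Proof.
have v0 := lvol_gt0 hb; have d0 := ldiam_gt0 hb; have K0 := lK_gt0 hb.
pose q := 1 + ldiam b * lK b.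
have q0 : 0 < q by rewrite addr_gt0// mulr_gt0.
exists (4 * q ^+ 2 / lvol b); first by rewrite divr_gt0// mulr_gt0// exprn_gt0.
move=> T [|p S] uS hS; first by rewrite /= mulr_ge0 ?sqr_ge0// divr_ge0 ?mulr_ge0 ?sqr_ge0// ltW.
have [Lp p0 pT] := hS p (mem_head _ _).
have T0 : 0 <= T by exact: le_trans (cmod_ge0 p) pT.
have := @lattice_count R b L hb 0 (p :: S) T T0 uS; rewrite Zgrid0.
have H1 : forall n, n \in p :: S -> L n by move=> n /hS[].
have H2 : forall n, n \in p :: S -> cmod n <= T by move=> n /hS[].
move=> /(_ H1 H2) h.
rewrite mulrAC ler_pdivlMr// mulrC (le_trans h)// -mulrA ler_pM2l//.
have n1 : 0 <= T + ldiam b by apply: addr_ge0 => //; exact: ltW.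
have n2 : 0 <= q * T by apply: mulr_ge0 => //; exact: ltW.
rewrite -exprMn ler_pXn2r ?nnegrE//.
rewrite /q mulrDl mul1r lerD2l -mulrA -[X in X <= _]mulr1 ler_pM2l//.
by apply: (le_trans (lattice_min hb Lp p0)); rewrite ler_pM2l.
Qed.

(** The bijection sends (n, m) to (n - m, n). Neither index set contains the other, but the terms
    outside the common part vanish. *)
Lemma pair_sum_reindex (u : R[i] -> R) (s : R) (N : nat) (k : int)
    (SP S : seq R[i]) :
  uniq SP -> uniq S -> (forall p, p \in SP -> L p /\ p != 0) ->
  (forall n, n \in S <-> [/\ Lam n, n != 0 & cmod n <= N%:R]) ->
  (forall p n, L p -> p != 0 -> Lam n -> pair_val u alpha s N%:R k p n != 0 -> p \in SP) ->
  \sum_(nm <- fset_set (grid_pairs Lam N))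
     u (s%:C * (branch_pow alpha k nm.1 - branch_pow alpha k nm.2)) =
  \sum_(p <- SP) \sum_(n <- S) pair_val u alpha s N%:R k p n.
Proof.
move=> uSP uS hSP hS hcov.
set G := fset_set _; pose g (nm : R[i] * R[i]) : R :=
  u (s%:C * (branch_pow alpha k nm.1 - branch_pow alpha k nm.2)).
have GE (nm : R[i] * R[i]) : nm \in G <-> grid_pairs Lam N nm.
  rewrite /G in_fset_set; last exact: finite_grid_pairs.
  by split => [/set_mem|/mem_set].
pose G' := [seq (n, n - p) | p <- SP, n <- S].
have uG' : uniq G'.
  apply: allpairs_uniq => // -[p n] [p' n'] _ _ [] -> h.
  by congr pair; move: h => /(congr1 (fun w => n' - w)); rewrite !subKr.
rewrite -/(\sum_(nm <- G) g nm) -(@sum_seq_restrict _ _ G G' g)//; last first.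
  move=> [n m] /GE[/= Ln Lm nm /andP[n0 nN] /andP[m0 mN]] nG'.
  apply/eqP; apply: contraNT nG' => gn.
  have Lp : L (n - m).
    case: Ln Lm => p Lp <- [q Lq <-]; rewrite opprD addrACA subrr add0r.
    exact: (latticeB hb).
  have p0 : n - m != 0 by rewrite subr_eq0.
  apply/allpairsP; exists (n - m, n); split => //=; last by rewrite subKr.
    apply: (hcov _ n) => //; rewrite /pair_val subKr ifT//.
    by rewrite -!cmod_gt0 n0 nN m0 mN.
  by apply/hS; split => //; rewrite -cmod_gt0.
rewrite /G' big_allpairs_dep [LHS]big_seq [RHS]big_seq; apply: eq_bigr => p /hSP[Lp p0].
rewrite [LHS]big_seq [RHS]big_seq; apply: eq_bigr => n /hS[Ln n0 nN].
rewrite /pair_val n0 nN andTb andTb.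
have Lnp : Lam (n - p).
  case: Ln => q Lq <-; exists (q - p); rewrite ?addrA//.
  exact: (latticeB hb).
case: ifPn => [/GE[/= _ _ _ _ /andP[m0 mN]]|nG].
  by rewrite -cmod_gt0 m0 mN.
case: ifPn => // /andP[np0 npN]; case/negP: nG; apply/GE; split => //=.
- by apply: contra p0 => /eqP e; rewrite -(subKr n p) -e subrr.
- by rewrite cmod_gt0 n0.
- by rewrite cmod_gt0 np0.
Qed.

(** [pair_sum_estimate] is applied at each level and each p, [lin_int_average] once for each p, and
    the errors are multiplied by the number of vectors given by [lattice_card]. *)
Lemma main_estimate : exists C Cs : R, [/\ 0 < C, 0 < Cs &
  forall u B A, 1 <= A -> bump u B A ->
  forall (s : R) (N N' N'' : nat) (SP : seq R[i]) (r : R),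
    0 < s -> (0 < N)%N -> Cs * A <= s -> ldiam b <= N%:R -> (0 < N' + N'')%N ->
    let x := s / N%:R `^ (1 - alpha) in
    A <= alpha * x * r -> covers SP r ->
  `| ((N' + N'')%:R * (N%:R / x) ^+ 2)^-1 *
     (\sum_(k <- levels N' N'') \sum_(nm <- fset_set (grid_pairs Lam N))
        u (s%:C * (branch_pow alpha k nm.1 - branch_pow alpha k nm.2)))
     - x ^+ 2 / lvol b * \sum_(p <- SP) fine (Icirc alpha u (alpha * x * cmod p)) |
  <= C * B * (A ^+ 4 / (x * N%:R) + A ^+ 2 / (N' + N'')%:R)].
Proof.
have [Cr [Cs1 [Cr0 Cs10 range]]] := pair_range hb z0 halpha.
have [Ce [Cs2 [Ce0 Cs20 est]]] := pair_sum_estimate hb z0 halpha.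
have [Cl Cl0 card] := lattice_card.
have v0 := lvol_gt0 hb; have d0 := ldiam_gt0 hb.
have pi0 := @pi_gt0 R.
(* The radius Ct A / x must contain both the vectors that contribute to the pairs, hence [Cr], and
   those where I(alpha x |p|) is nonzero, hence 1 / alpha. *)
pose Ct := Cr + alpha^-1.
have ai0 : 0 < alpha^-1 by rewrite invr_gt0.
have Ct0 : 0 < Ct by rewrite addr_gt0.
have da : 0 < (1 - alpha)^-1 by rewrite invr_gt0 subr_gt0.
pose C1 := Ce * Cl * Ct ^+ 3 / lvol b.
pose C2 := (1 - alpha)^-1 * (2 * pi) * Cl * Ct ^+ 2 / lvol b.
have C10 : 0 < C1 by rewrite divr_gt0// !mulr_gt0// exprn_gt0.
have C20 : 0 < C2 by rewrite divr_gt0// !mulr_gt0// exprn_gt0.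
exists (C1 + C2), (Cs1 + Cs2); split; [exact: addr_gt0|exact: addr_gt0|].
move=> u B A A1 bu s N N' N'' SP0 r s0 N0 sA dN K1 x xr cov0.
have [u0 uL uA] := bu.
have B0 : 0 <= B by have /andP[] := u0 0; exact: le_trans.
have A0 : 0 < A by exact: lt_le_trans A1.
have X0 : 0 < N%:R :> R by rewrite ltr0n.
have x0 : 0 < x by rewrite divr_gt0// powR_gt0.
have sA1 : Cs1 * A <= s by rewrite (le_trans _ sA)// mulrDl lerDl mulr_ge0// ltW.
have sA2 : Cs2 * A <= s by rewrite (le_trans _ sA)// mulrDl lerDr mulr_ge0// ltW.
have xE : s * N%:R `^ (alpha - 1) = x by rewrite /x -opprB powRN.
pose T := Ct * A / x.
have T0 : 0 < T by rewrite divr_gt0// mulr_gt0.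
have [SP [uSP hSP]] := lattice_ball_seq T.
have [S [uS hS]] := grid_ball_seq z0 N%:R.
have covT : covers SP T.
  split => // p; first by move=> /hSP[].
  by move=> Lp p0 pT; apply/hSP; split => //; exact: ltW.
have IcE p : T <= cmod p -> fine (Icirc alpha u (alpha * x * cmod p)) = 0.
  move=> Tp; rewrite (Icirc_eq0 halpha bu)//.
    by rewrite !mulr_ge0 ?cmod_ge0// ltW.
  apply: (@le_trans _ _ (alpha * x * T)); last by rewrite ler_pM2l// mulr_gt0.
  rewrite /T /Ct (_ : _ * _ = alpha * Cr * A + A); last by field; rewrite !gt_eqF.
  by rewrite lerDr !mulr_ge0// ltW.
have IcE0 p : r <= cmod p -> fine (Icirc alpha u (alpha * x * cmod p)) = 0.
  move=> Tp; rewrite (Icirc_eq0 halpha bu)//.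
    by rewrite !mulr_ge0 ?cmod_ge0// ltW.
  by apply: (le_trans xr); rewrite ler_pM2l// mulr_gt0.
rewrite (covers_sum (F := fun p => fine (Icirc alpha u (alpha * x * cmod p))) cov0 covT); first last.
- by move=> p _ _; exact: IcE.
- by move=> p _ _; exact: IcE0.
have hcov k p n : L p -> p != 0 -> Lam n -> pair_val u alpha s N%:R k p n != 0 -> p \in SP.
  move=> Lp p0 Ln pv; apply/hSP; split => //.
  have := range u B A A1 bu s N%:R k p n s0 sA1 Ln pv.
  move: pv; rewrite /pair_val; case: ifPn => [/and4P[n0 nN _ _] _|]; last by rewrite eqxx.
  move=> h; have h2 := pow_neg_ge halpha (_ : 0 < cmod n) nN.
  have {}h2 := h2 (etrans (cmod_gt0 n) n0).
  rewrite /T ler_pdivlMr// -xE mulrA [cmod p * s]mulrC.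
  apply: (le_trans (ler_wpM2l _ h2)); first by rewrite mulr_ge0 ?cmod_ge0// ltW.
  by apply: (le_trans h); rewrite ler_pM2r// lerDl ltW.
have reE k : \sum_(nm <- fset_set (grid_pairs Lam N))
     u (s%:C * (branch_pow alpha k nm.1 - branch_pow alpha k nm.2)) =
     \sum_(p <- SP) \sum_(n <- S) pair_val u alpha s N%:R k p n.
  by apply: pair_sum_reindex => //; [move=> p /hSP[]|exact: hcov].
under eq_bigr do rewrite reE.
rewrite exchange_big/=.
set K : R := (N' + N'')%:R.
have K0 : 0 < K by rewrite ltr0n.
pose I p := fine (Icirc alpha u (alpha * x * cmod p)).
pose Q p := \sum_(k <- levels N' N'') \sum_(n <- S) pair_val u alpha s N%:R k p n.
have sizeL : size (levels N' N'') = (N' + N'')%N by rewrite size_map size_iota.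
have perp p : p \in SP -> `|lvol b * Q p - K * (N%:R ^+ 2 * I p)| <=
    K * (Ce * B * A * T * N%:R) + (1 - alpha)^-1 * (N%:R ^+ 2 * (2 * pi * B)).
  move=> /hSP[Lp p0 pT].
  have cE : s * alpha * cmod p * N%:R `^ (alpha - 1) = alpha * x * cmod p.
    by rewrite -xE; ring.
  have av := lin_int_average halpha bu N' N'' s0 X0 p0.
  rewrite cE -/(I p) -/K in av.
  have I2 : I p <= 2 * pi * B.
    rewrite -lee_fin /I fineK; last exact: (Icirc_fin _ bu).
    exact: (Icirc_le _ bu).
  have av2 : `|\sum_(k <- levels N' N'') fine (lin_int alpha u s N%:R k p) -
      K * (N%:R ^+ 2 * I p)| <= (1 - alpha)^-1 * (N%:R ^+ 2 * (2 * pi * B)).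
    by apply: (le_trans av); rewrite ler_pM2l// ler_pM2l// exprn_gt0.
  have e1 : `|lvol b * Q p - \sum_(k <- levels N' N'') fine (lin_int alpha u s N%:R k p)|
      <= K * (Ce * B * A * T * N%:R).
    rewrite /Q mulr_sumr -sumrB (le_trans (ler_norm_sum _ _ _))//.
    apply: (@le_trans _ _ (\sum_(k <- levels N' N'') (Ce * B * A * T * N%:R))).
      apply: ler_sum => k _; apply: (le_trans (est u B A A1 bu s N%:R k p S s0 sA2 dN Lp p0 uS hS)).
      by rewrite ler_pM2r// ler_wpM2l// !mulr_ge0// ltW.
    by rewrite big_const_seq count_predT sizeL iter_addr_0 mulr_natl.
  rewrite -(subrKA (\sum_(k <- levels N' N'') fine (lin_int alpha u s N%:R k p))).
  by apply: (le_trans (ler_normD _ _)); apply: lerD.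
have x2 : 0 < x ^+ 2 by rewrite exprn_gt0.
pose W := x ^+ 2 / (lvol b * K * N%:R ^+ 2).
have W0 : 0 < W by rewrite divr_gt0// !mulr_gt0// exprn_gt0.
have -> : (K * (N%:R / x) ^+ 2)^-1 * (\sum_(p <- SP) Q p) - x ^+ 2 / lvol b * (\sum_(p <- SP) I p)
   = W * \sum_(p <- SP) (lvol b * Q p - K * (N%:R ^+ 2 * I p)).
  rewrite sumrB -!mulr_sumr /W; field.
  by rewrite -natrD -/K !gt_eqF.
rewrite normrM (gtr0_norm W0).
have szT := card T SP uSP (fun p => proj1 (hSP p)).
apply: (@le_trans _ _ (W * ((Cl * T ^+ 2) * (K * (Ce * B * A * T * N%:R) +
   (1 - alpha)^-1 * (N%:R ^+ 2 * (2 * pi * B)))))).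
  rewrite ler_pM2l// (le_trans (ler_norm_sum _ _ _))//.
  set M := K * _ + _ in perp *.
  have M0 : 0 <= M.
    by rewrite /M; apply: addr_ge0; rewrite ?mulr_ge0 ?sqr_ge0 ?invr_ge0 ?subr_ge0 ?(ltW a1) ?(ltW x0) ?(ltW Ct0) ?(ltW K0) ?(ltW Ce0) ?(ltW A0) ?(ltW X0) ?(ltW da) ?(ltW pi0)//.
  apply: (@le_trans _ _ (\sum_(p <- SP) M)).
    by rewrite [X in X <= _]big_seq [X in _ <= X]big_seq; apply: ler_sum => p pS; exact: perp.
  by rewrite big_const_seq count_predT iter_addr_0 -mulr_natl ler_wpM2r.
have -> : W * ((Cl * T ^+ 2) * (K * (Ce * B * A * T * N%:R) +
   (1 - alpha)^-1 * (N%:R ^+ 2 * (2 * pi * B)))) =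
   C1 * B * (A ^+ 4 / (x * N%:R)) + C2 * B * (A ^+ 2 / K).
  rewrite /W /T /C1 /C2; field.
  by rewrite -?natrD -?/K !gt_eqF ?subr_gt0.
have p1 : 0 <= A ^+ 4 / (x * N%:R).
  by rewrite ltW// divr_gt0 ?exprn_gt0// mulr_gt0.
have p2 : 0 <= A ^+ 2 / K by rewrite ltW// divr_gt0 ?exprn_gt0.
rewrite mulrDr; apply: lerD.
  by rewrite (ler_wpM2r p1)// (ler_wpM2r B0)// lerDl ltW.
by rewrite (ler_wpM2r p2)// (ler_wpM2r B0)// lerDr ltW.
Qed.

End MainEstimate.

(** * The limiting density *)

Section PowSubst.
Context {R : realType}.
Notation mu := (@lebesgue_measure R).

Lemma continuous_powR (a x : R) : 0 < x -> {for x, continuous (fun y : R => y `^ a)}.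
Proof.
move=> x0; apply: differentiable_continuous; apply/derivable1_diffP.
by apply: ex_derive; exact: is_derive1_powR.
Qed.

Lemma continuous_lip (g : R -> R) (M : R) :
  (forall x y, `|g x - g y| <= M * `|x - y|) -> continuous g.
Proof.
move=> gL x; apply/cvgrPdist_lt => e e0.
have M0 : 0 <= M by have := gL 1 0; rewrite subr0 normr1 mulr1; exact: le_trans.
near=> y; apply: (le_lt_trans (gL x y)).
apply: (@le_lt_trans _ _ ((M + 1) * `|x - y|)).
  by rewrite ler_wpM2r// lerDl.
rewrite mulrC -ltr_pdivlMr; last by rewrite ltr_pwDr.
near: y; apply: cvgr_dist_lt => //.
by rewrite divr_gt0// ltr_pwDr.
Unshelve. all: by end_near. Qed.

Variable alpha : R.
Hypothesis halpha : 0 < alpha < 1.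
Let a0 : 0 < alpha. Proof. by case/andP: halpha. Qed.
Let a1 : alpha < 1. Proof. by case/andP: halpha. Qed.

(* Density with respect to [s ds] of the image of [r dr] on the unit interval
   under [r |-> c r ^ (alpha - 1)]. *)
Definition density (c s : R) : R :=
  if c <= s then (1 - alpha)^-1 * c `^ (2 / (1 - alpha))
                 * s `^ (- ((4 - 2 * alpha) / (1 - alpha))) else 0.

Lemma density_ge0 c s : 0 <= density c s.
Proof.
rewrite /density; case: ifP => // _.
by rewrite !mulr_ge0 ?powR_ge0// invr_ge0 subr_ge0 ltW.
Qed.

(** The cutoff [r0] avoids the end r = 0, where c r^(alpha-1) is unbounded; compact support of the
    test function makes it harmless later. *)
Lemma powR_substitution (c r0 : R) (g : R -> R) : 0 < c -> 0 < r0 < 1 ->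
  continuous g ->
  (\int[mu]_(s in `[c, (c * r0 `^ (alpha - 1))%R]) (s * (g s * density c s))%:E =
   \int[mu]_(r in `[r0, 1%R]) (r * g (c * r `^ (alpha - 1)))%:E)%E.
Proof.
move=> c0 /andP[r00 r01] cg.
pose F (r : R) : R := c * r `^ (alpha - 1).
pose F' (r : R) : R := c * ((alpha - 1) * r `^ (alpha - 1 - 1)).
pose G (s : R) : R := s * (g s * ((1 - alpha)^-1 * c `^ (2 / (1 - alpha))
                 * s `^ (- ((4 - 2 * alpha) / (1 - alpha))))).
have dF (x : R) : 0 < x -> is_derive x 1 F (F' x).
  by move=> x0; apply: is_deriveZ; exact: is_derive1_powR.
have F'E (x : R) : 0 < x -> F^`()%classic x = F' x.
  by move=> x0; rewrite derive1E; apply: derive_val; exact: dF.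
have cF' (x : R) : 0 < x -> {for x, continuous F'}.
  move=> x0; apply: cvgM; first exact: cvg_cst.
  by apply: cvgM; [exact: cvg_cst|exact: continuous_powR].
have cF (x : R) : 0 < x -> {for x, continuous F}.
  by move=> x0; apply: cvgM; [exact: cvg_cst|exact: continuous_powR].
have F1 : F 1 = c by rewrite /F powR1 mulr1.
have Fdec : {in `[r0, 1] &, {homo F : x y /~ (x < y)%R}}.
  move=> x y; rewrite !in_itv/= => /andP[rx x1] /andP[ry y1] xy.
  rewrite /F ltr_pM2l// -opprB !powRN ltf_pV2 ?posrE ?powR_gt0 ?(lt_le_trans r00)//.
  by rewrite gt0_ltr_powR ?subr_gt0// ?nnegrE (le_trans (ltW r00)).
have FF : forall x : R, 0 < x -> \forall y \near x, F^`()%classic y = F' y.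
  move=> x x0; near=> y; apply: F'E; near: y; exact: lt_nbhsr.
have := @integration_by_substitution_decreasing R F G r0 1 (ltW r01) Fdec.
rewrite F1 => /(_ _ _ _ _ _) H.
transitivity (\int[mu]_(s in `[c, F r0]) (G s)%:E)%E.
  apply: eq_integral => s; rewrite inE /= in_itv/= => /andP[cs _].
  by rewrite /density cs.
rewrite H.
- apply: eq_integral => r; rewrite inE /= in_itv/= => /andP[rr r1].
  have rp : 0 < r by exact: lt_le_trans rr.
  congr EFin; rewrite fctE /= fctE /= F'E// /G /F'.
  have Fp : 0 < F r by rewrite mulr_gt0// powR_gt0.
  set q := g _; rewrite -/(F r).
  have na : 1 - alpha != 0 by rewrite gt_eqF// subr_gt0.
  transitivity (q * (c `^ (2 / (1 - alpha)) * (F r `^ (1 - (4 - 2 * alpha) / (1 - alpha)) * (c * r `^ (alpha - 2))))).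
    rewrite [F r `^ (1 - _)]powRD; last by rewrite (gt_eqF Fp) implybT.
    rewrite powRr1 ?(ltW Fp)// (_ : alpha - 1 - 1 = alpha - 2); last by ring.
    by field.
  rewrite /F powRM ?powR_ge0 ?(ltW c0)// -powRrM.
  (* The powers are gathered: the exponents of c add up to 0 and those of r to 1, which is what
     fixes the exponents of [density]. *)
  transitivity (q * ((c `^ (2 / (1 - alpha)) * c `^ (1 - (4 - 2 * alpha) / (1 - alpha)) * c `^ 1)
     * (r `^ ((alpha - 1) * (1 - (4 - 2 * alpha) / (1 - alpha))) * r `^ (alpha - 2)))).
    rewrite powRr1 ?(ltW c0)//; ring.
  have cn x : x ==> (c != 0) by rewrite (gt_eqF c0) implybT.
  have rn x : x ==> (r != 0) by rewrite (gt_eqF rp) implybT.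
  rewrite -!powRD//.
  rewrite (_ : _ + _ + 1 = 0); last by field.
  rewrite (_ : _ + (alpha - 2) = 1); last by field.
  by rewrite powRr0 powRr1 ?(ltW rp)// mul1r mulrC.
- move=> x; rewrite in_itv/= => /andP[rx x1].
  have x0 : 0 < x by exact: lt_trans rx.
  rewrite /continuous_at F'E//; apply: cvg_trans (cF' x x0).
  by apply: near_eq_cvg; near=> y; apply/esym; near: y; exact: FF.
- apply/cvg_ex; exists (F' r0).
  apply: cvg_trans (cvg_at_right_filter (cF' r0 r00)).
  apply: near_eq_cvg; near=> y; apply/esym/F'E; apply: (lt_trans r00); near: y.
  exact: nbhs_right_gt.
- apply/cvg_ex; exists (F' 1).
  apply: cvg_trans (cvg_at_left_filter (cF' 1 ltr01)).
  apply: near_eq_cvg; near=> y; apply/esym/F'E; near: y.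
  exact: nbhs_left_gt.
- split.
  + move=> x; rewrite in_itv/= => /andP[rx x1].
    by have [] := dF x (lt_trans r00 rx).
  + exact: cvg_at_right_filter (cF r0 r00).
  + exact: cvg_at_left_filter (cF 1 ltr01).
apply: continuous_in_subspaceT => x /set_mem/=; rewrite in_itv/= => /andP[cx _].
have x0 : 0 < x by exact: lt_le_trans cx.
apply: cvgM; first exact: cvg_id.
apply: cvgM; first exact: cg.
by apply: cvgM; [exact: cvg_cst|exact: continuous_powR].
Unshelve. all: by end_near.
Qed.

End PowSubst.

Lemma mem_itv_pos {R : realType} (r : R) : (r \in `]0, +oo[%classic) = (0 < r).
Proof. by apply/idP/idP; rewrite inE /= in_itv/= andbT. Qed.

Lemma mem_itv_cc {R : realType} (a b r : R) : (r \in `[a, b]%classic) = (a <= r <= b).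
Proof. by apply/idP/idP; rewrite inE /= in_itv/=. Qed.

Section Density.
Context {R : realType}.
Notation mu := (@lebesgue_measure R).
Variable alpha : R.
Hypothesis halpha : 0 < alpha < 1.
Let a0 : 0 < alpha. Proof. by case/andP: halpha. Qed.
Let a1 : alpha < 1. Proof. by case/andP: halpha. Qed.
Variables (u : R[i] -> R) (B A : R).
Hypothesis (bu : bump u B A).

Let u0 z : 0 <= u z. Proof. by have [/(_ z)/andP[]] := bu. Qed.
Let uB z : u z <= B. Proof. by have [/(_ z)/andP[]] := bu. Qed.
Let B0 : 0 <= B. Proof. exact: le_trans (u0 0) (uB 0). Qed.
Let uL z w : `|u z - u w| <= B * cmod (z - w).
Proof. by have [_ h _] := bu; exact: h. Qed.
Let uA z : A <= cmod z -> u z = 0. Proof. by have [_ _] := bu; apply. Qed.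

Lemma measurable_density (c : R) : measurable_fun [set: measurableTypeR R] (density alpha c).
Proof.
apply: measurable_fun_ifT => //; first exact: measurable_fun_ler.
by apply: measurable_funM => //; exact: measurable_powR.
Qed.

Lemma wint_density (c t : R) : 0 < c ->
  wint alpha u c 1 t =
  (\int[mu]_(s in `]0%R, +oo[) (s * (u (s%:C * expi t) * density alpha c s))%:E)%E.
Proof.
move=> c0; pose g s := u (s%:C * expi t).
have cg : continuous g.
  apply: (@continuous_lip _ _ B) => x y; apply: (le_trans (uL _ _)).
  by rewrite -mulrBl -rmorphB cmodM cmodr cmod_expi mulr1.
(* A radius beyond the support and beyond c, so that the solution r0 of c r0^(alpha-1) = A' lies in
   ]0, 1[; on r < r0, as on s > A', the test function vanishes. *)
pose A' := `|A| + 2 * c.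
have A'0 : 0 < A' by rewrite ltr_wpDl// mulr_gt0.
have AA' : A <= A' by rewrite (le_trans (ler_norm _))// lerDl mulr_ge0// ltW.
have cA' : c < A' by rewrite (@lt_le_trans _ _ (2 * c))// ?lerDr// mulr_natl mulr2n ltrDl.
pose r0 := (c / A') `^ (1 - alpha)^-1.
have r00 : 0 < r0 by rewrite powR_gt0// divr_gt0.
have d0 : 0 < (1 - alpha)^-1 by rewrite invr_gt0 subr_gt0.
have r01 : r0 < 1.
  have : r0 < 1 `^ (1 - alpha)^-1.
    by rewrite gt0_ltr_powR ?nnegrE ?divr_ge0 ?(ltW c0) ?(ltW A'0)// ltr_pdivrMr// mul1r.
  by rewrite powR1.
have r0E : c * r0 `^ (alpha - 1) = A'.
  rewrite /r0 -powRrM (_ : (1 - alpha)^-1 * (alpha - 1) = -1); last by field; rewrite gt_eqF// subr_gt0.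
  rewrite powR_inv1 ?divr_ge0 ?(ltW c0) ?(ltW A'0)//.
  by field; rewrite !gt_eqF.
have := powR_substitution halpha c0 (introT andP (conj r00 r01)) cg.
rewrite r0E => sub.
transitivity (\int[mu]_(r in `[r0, 1%R]) (r * g (c * r `^ (alpha - 1)))%:E)%E.
  rewrite /wint integral_mkcond [RHS]integral_mkcond; apply: eq_integral => r _.
  rewrite /patch mem_itv_pos mem_itv_cc; have [rp|rn] := ltP 0 r; last first.
    by rewrite ifF//; apply/negP => /andP[r0r _]; move: (lt_le_trans r00 r0r); rewrite ltNge rn.
  case: ifP => [/andP[_ r1]|nr]; first by rewrite /ray r1.
  rewrite /ray; case: ifP => r1; last by rewrite mulr0.
  rewrite uA ?mulr0// cmodM cmod_expi mulr1 cmodr ger0_norm; last first.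
    by rewrite mulr_ge0 ?powR_ge0// ltW.
  apply: (le_trans AA'); rewrite -r0E ler_pM2l//.
  apply: pow_neg_ge => //; rewrite leNgt; apply/negP => r0r.
  by move/negP : nr; apply; rewrite r1 ltW.
rewrite -sub integral_mkcond [RHS]integral_mkcond; apply: eq_integral => s _.
rewrite /patch mem_itv_pos mem_itv_cc; case: ifP => [/andP[cs sA]|ns].
  by rewrite (lt_le_trans c0 cs).
case: ifP => // s0.
rewrite /density; case: ifP => cs; last by rewrite !mulr0.
rewrite uA ?mul0r ?mulr0// cmodM cmod_expi mulr1 cmodr gtr0_norm//.
apply: (le_trans AA'); rewrite leNgt; apply/negP => sA.
by move/negP : ns; apply; rewrite cs ltW.
Qed.

Lemma Icirc_density (c : R) : 0 < c ->
  Icirc alpha u c =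
  (\int[Leb R]_z (u (complex_of z) * density alpha c (cmod (complex_of z)))%:E)%E.
Proof.
move=> c0; rewrite (integral_polar 0); first last.
- by move=> z; rewrite lee_fin mulr_ge0// density_ge0.
- apply/measurable_EFinP; apply: measurable_funM; first exact: (lipschitz_measurable uL).
  exact: (measurableT_comp (measurable_density c) (@measurable_cmod R)).
rewrite /Icirc add0r; apply: eq_integral => t _; rewrite (wint_density t c0).
rewrite /radial; apply: eq_integral => r; rewrite inE /= in_itv/= andbT => r0.
by rewrite -EFinM cmod_pol ?(ltW r0)// pol_complex.
Qed.

Variables (b : R[i] * R[i]) (L : set R[i]) (hb : is_Zbasis L b).
Hypothesis covE : covol L = lvol b.

(** The exponents match because (4 - 2 alpha) / (1 - alpha) = 2 + 2 / (1 - alpha): the factor l^2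
    and the power of l in the densities combine into the power of |z| / l. Where u is nonzero, |z| <
    A, so the sum in [rho] only involves vectors of modulus less than r. *)
Lemma rho_sum (l : R) (SP : seq R[i]) (r : R) (z : R[i]) : 0 < l ->
  covers L SP r -> A <= alpha * l * r ->
  u z * rho alpha L l z =
  l ^+ 2 / lvol b * \sum_(p <- SP) (u z * density alpha (alpha * l * cmod p) (cmod z)).
Proof.
move=> l0 [uSP hSP cov] Ar.
have al0 : 0 < alpha * l by exact: mulr_gt0.
have v0 := lvol_gt0 hb.
have da : 0 < 1 - alpha by rewrite subr_gt0.
have [uz|uz] := eqVneq (u z) 0.
  by rewrite uz mul0r big1 ?mulr0// => p _; rewrite mul0r.
have zA : cmod z < A.
  by rewrite ltNge; apply: contra uz => /uA ->.
rewrite /rho (gt_eqF l0); have [->|z0] := eqVneq z 0.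
  rewrite mulr0 big_seq big1 ?mulr0// => p /hSP[_ p0].
  rewrite /density ifF ?mulr0//; apply/negbTE; rewrite -ltNge cmod0.
  by rewrite mulr_gt0// cmod_gt0.
have zp : 0 < cmod z by rewrite cmod_gt0.
pose P := [set p | L p /\ cmod p <= cmod z / (alpha * l)].
have fP : finite_set P by apply: finite_lattice_ball; exists b.
rewrite (fsbig_finite _ _ fP) -mulr_sumr /=.
have sE : \sum_(i <- fset_set P) cmod i `^ (2 / (1 - alpha)) =
  \sum_(p <- SP) (if alpha * l * cmod p <= cmod z then cmod p `^ (2 / (1 - alpha)) else 0).
  rewrite -(@sum_seq_restrict _ _ (fset_set P) SP _ (fset_uniq _) uSP); last first.
    move=> p; rewrite in_fset_set// => /set_mem[Lp pz] pS.
    (* The zero vector occurs in the sum of [rho] but not in [SP]; its term is a positive power of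
       0. *)
    have [->|p0] := eqVneq p 0.
      by rewrite cmod0 powR0// mulf_neq0// invr_eq0 gt_eqF.
    case/negP : pS; apply: cov => //.
    rewrite -(ltr_pM2l al0) (lt_le_trans _ Ar)//.
    by rewrite (le_lt_trans _ zA)// mulrC -ler_pdivlMr.
  rewrite [LHS]big_seq [RHS]big_seq; apply: eq_bigr => p pS.
  have [Lp p0] := hSP _ pS.
  rewrite [_ * cmod p]mulrC -ler_pdivlMr// in_fset_set//.
  congr (if _ then _ else _).
  by apply/idP/idP => [/set_mem[]//|h]; apply/mem_set.
rewrite sE [RHS]mulrCA; congr (u z * _); rewrite !mulr_sumr; apply: eq_big_seq => p /hSP[Lp p0].
have pp : 0 < cmod p by rewrite cmod_gt0.
rewrite /density; case: ifP => _; last by rewrite !mulr0.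
rewrite covE.
set e := 2 / (1 - alpha); set sg := (4 - 2 * alpha) / (1 - alpha).
have sgE : sg = 2 + e by rewrite /sg /e; field; rewrite gt_eqF.
rewrite [(alpha * l * cmod p) `^ e]powRM ?(ltW al0) ?(ltW pp)//.
rewrite [(alpha * l) `^ e]powRM ?(ltW a0) ?(ltW l0)//.
rewrite [(cmod z / l) `^ _]powRM ?invr_ge0 ?(ltW zp) ?(ltW l0)//.
rewrite -(powR_inv1 (ltW l0)) -powRrM mulN1r opprK sgE powRD; last by rewrite (gt_eqF l0) implybT.
rewrite (powR_mulrn 2 (ltW l0)).
by field; rewrite !gt_eqF.
Qed.

Lemma integral_rho (l : R) (SP : seq R[i]) (r : R) : 0 < l ->
  covers L SP r -> A <= alpha * l * r ->
  (\int[Leb R]_z (u (complex_of z) * rho alpha L l (complex_of z))%:E =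
   (l ^+ 2 / lvol b * \sum_(p <- SP) fine (Icirc alpha u (alpha * l * cmod p)))%:E)%E.
Proof.
move=> l0 cov Ar; have [uSP hSP _] := cov.
have v0 := lvol_gt0 hb.
have mD p : measurable_fun [set: plane R] (fun z : plane R =>
    (u (complex_of z) * density alpha (alpha * l * cmod p) (cmod (complex_of z)))%:E).
  apply/measurable_EFinP; apply: measurable_funM; first exact: (lipschitz_measurable uL).
  exact: (measurableT_comp (measurable_density _) (@measurable_cmod R)).
have D0 p (z : plane R) : (0 <= (u (complex_of z) * density alpha (alpha * l * cmod p) (cmod (complex_of z)))%:E)%E.
  by rewrite lee_fin mulr_ge0// density_ge0.
have k0 : 0 <= l ^+ 2 / lvol b by rewrite divr_ge0 ?sqr_ge0// ltW.
under eq_integral => z _ do rewrite (rho_sum _ l0 cov Ar) EFinM -sumEFin.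
have kE : (0 <= (l ^+ 2 / lvol b)%:E)%E by rewrite lee_fin.
have mS : measurable_fun [set: plane R] (fun z : plane R => \sum_(p <- SP)
    (u (complex_of z) * density alpha (alpha * l * cmod p) (cmod (complex_of z)))%:E)%E.
  exact: emeasurable_sum.
have S0 (z : plane R) : [set: plane R] z -> (0 <= \sum_(p <- SP)
    (u (complex_of z) * density alpha (alpha * l * cmod p) (cmod (complex_of z)))%:E)%E.
  by move=> _; apply: sume_ge0 => p _.
rewrite (ge0_integralZl (Leb R) measurableT mS S0 kE) [RHS]EFinM; congr (_ * _)%E.
rewrite (ge0_integral_sum (Leb R) measurableT mD (fun p z _ => D0 p z)).
rewrite -sumEFin; apply: eq_big_seq => p /hSP[Lp p0].
rewrite fineK; last exact: (Icirc_fin _ bu).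
by rewrite Icirc_density// !mulr_gt0// cmod_gt0.
Qed.

End Density.

(** * Dependence of the lattice sum on the scale *)

Section PhiLip.
Context {R : realType}.
Variable alpha : R.
Hypothesis halpha : 0 < alpha < 1.
Let a0 : 0 < alpha. Proof. by case/andP: halpha. Qed.
Variables (b : R[i] * R[i]) (L : set R[i]) (hb : is_Zbasis L b).

(** The number of vectors is of order (A / l)^2 and is compensated by the prefactor l^2, so no power
    of l remains. The third power of A comes from the variation of the argument alpha x |p|, with
    |p| of order A / l. *)
Lemma lattice_sum_lip : exists2 C : R, 0 < C & forall (I : R -> R) M A,
  1 <= A -> 0 <= M -> (forall c, 0 <= c -> 0 <= I c <= M) ->
  (forall c c', 0 <= c -> 0 <= c' -> `|I c - I c'| <= M * `|c - c'|) ->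
  (forall c, 0 <= c -> A <= c -> I c = 0) ->
  forall (l x : R) (SP : seq R[i]) (r : R), 0 < l -> l / 2 <= x <= 2 * l ->
    covers L SP r -> A <= alpha * x * r -> A <= alpha * l * r ->
  `| x ^+ 2 / lvol b * \sum_(p <- SP) I (alpha * x * cmod p)
     - l ^+ 2 / lvol b * \sum_(p <- SP) I (alpha * l * cmod p) |
  <= C * M * A ^+ 3 * `|x / l - 1|.
Proof.
have v0 := lvol_gt0 hb.
have [Cl Cl0 card] := lattice_card hb.
(* 4 bounds x^2 / l^2 and 2 comes from the radius 2 A / (alpha l), in the variation of I; 3 bounds
   (x + l) / l, in the variation of x^2. *)
pose C := (lvol b)^-1 * (Cl * (2 / alpha) ^+ 2) * (4 * 2 + 3).
have C0 : 0 < C.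
  have k2 : 0 < 2 / alpha by rewrite divr_gt0.
  have k3 : 0 < 4 * 2 + 3 :> R by rewrite addr_gt0 ?mulr_gt0.
  by rewrite /C !mulr_gt0 ?invr_gt0// exprn_gt0.
exists C => // I B A A1 B0 IB IL IA l x SP0 r l0 /andP[lx xl] cov0 Ax Al.
have A0 : 0 < A by exact: lt_le_trans A1.
have x0 : 0 < x by apply: lt_le_trans lx; rewrite divr_gt0.
pose T := 2 * A / (alpha * l).
have T0 : 0 < T by rewrite divr_gt0 ?mulr_gt0.
have [SP [uSP hSP]] := lattice_ball_seq hb T.
have covT : covers L SP T.
  split => // p; first by move=> /hSP[].
  by move=> Lp p0 pT; apply/hSP; split => //; exact: ltW.
have I0 (y : R) (q : R) (w : R[i]) : 0 < y -> A <= alpha * y * q -> q <= cmod w ->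
    I (alpha * y * cmod w) = 0.
  move=> y0 Ay qw; rewrite IA//.
    by rewrite !mulr_ge0 ?cmod_ge0// ltW.
  by apply: (le_trans Ay); rewrite ler_pM2l// mulr_gt0.
have AT (y : R) : l / 2 <= y -> A <= alpha * y * T.
  move=> ly; apply: (@le_trans _ _ (alpha * (l / 2) * T)).
    by rewrite /T le_eqVlt; apply/orP; left; apply/eqP; field; rewrite !gt_eqF.
  by rewrite ler_pM2r// ler_pM2l.
have tr y : 0 < y -> l / 2 <= y -> A <= alpha * y * r ->
    \sum_(p <- SP0) I (alpha * y * cmod p) = \sum_(p <- SP) I (alpha * y * cmod p).
  move=> y0 ly Ay.
  apply: (covers_sum (F := fun p => I (alpha * y * cmod p)) cov0 covT) => p _ _.
    exact: I0.
  by apply: I0 => //; exact: AT.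
rewrite (tr x)// (tr l)//; last lra.
have -> : x ^+ 2 / lvol b * (\sum_(p <- SP) I (alpha * x * cmod p))
    - l ^+ 2 / lvol b * (\sum_(p <- SP) I (alpha * l * cmod p)) =
    (lvol b)^-1 * \sum_(p <- SP) (x ^+ 2 * (I (alpha * x * cmod p) - I (alpha * l * cmod p))
      + (x ^+ 2 - l ^+ 2) * I (alpha * l * cmod p)).
  rewrite big_split/= -!mulr_sumr sumrB; ring.
rewrite normrM gtr0_norm ?invr_gt0//.
set D := `|x / l - 1|.
have D0 : 0 <= D by exact: normr_ge0.
have xlD : `|x - l| = l * D.
  by rewrite /D -[X in _ = X * _](gtr0_norm l0) -normrM mulrBr mulr1 mulrCA mulfV ?mulr1// gt_eqF.
have each p : p \in SP -> `|x ^+ 2 * (I (alpha * x * cmod p) - I (alpha * l * cmod p))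
      + (x ^+ 2 - l ^+ 2) * I (alpha * l * cmod p)| <=
      l ^+ 2 * (B * A * (4 * 2 + 3)) * D.
  move=> /hSP[Lp p0 pT].
  have Il : `|I (alpha * l * cmod p)| <= B.
    have n2 : 0 <= alpha * l * cmod p by rewrite !mulr_ge0 ?cmod_ge0// ltW.
    by have /andP[h1 h2] := IB _ n2; rewrite ger0_norm.
  have Id : `|I (alpha * x * cmod p) - I (alpha * l * cmod p)| <= B * (2 * A * D).
    have n1 : 0 <= alpha * x * cmod p by rewrite !mulr_ge0 ?cmod_ge0// ltW.
    have n2 : 0 <= alpha * l * cmod p by rewrite !mulr_ge0 ?cmod_ge0// ltW.
    apply: (le_trans (IL _ _ n1 n2)); apply: (ler_wpM2l B0).
    rewrite -mulrBl -mulrBr !normrM (gtr0_norm a0) xlD (ger0_norm (cmod_ge0 p)).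
    apply: (@le_trans _ _ (alpha * (l * D) * T)).
      by rewrite ler_wpM2l// !mulr_ge0// ltW.
    by rewrite /T le_eqVlt; apply/orP; left; apply/eqP; field; rewrite !gt_eqF.
  apply: (le_trans (ler_normD _ _)); rewrite [X in X + _ <= _]normrM [X in _ + X <= _]normrM.
  have xx : `|x ^+ 2| <= 4 * l ^+ 2.
    rewrite ger0_norm ?sqr_ge0//; nra.
  have xxl : `|x ^+ 2 - l ^+ 2| <= 3 * l ^+ 2 * D.
    rewrite subr_sqr normrM xlD (_ : 3 * l ^+ 2 * D = (l * D) * (3 * l)); last by ring.
    rewrite ler_wpM2l ?mulr_ge0// ?(ltW l0)// gtr0_norm ?addr_gt0//; lra.
  apply: (@le_trans _ _ (4 * l ^+ 2 * (B * (2 * A * D)) + 3 * l ^+ 2 * D * (B))).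
    by apply: lerD; apply: ler_pM.
  have w0 : 0 <= l ^+ 2 * (B) * D.
    by rewrite !mulr_ge0 ?sqr_ge0// ltW.
  have := ler_wpM2l w0 A1; set W := l ^+ 2 * _ * D in w0 *; move=> hW.
  apply: (@le_trans _ _ (8 * (W * A) + 3 * W)).
    by rewrite /W le_eqVlt; apply/orP; left; apply/eqP; ring.
  apply: (@le_trans _ _ (11 * (W * A))); first lra.
  by rewrite /W le_eqVlt; apply/orP; left; apply/eqP; ring.
have szT := card T SP uSP (fun p => proj1 (hSP p)).
set M := l ^+ 2 * _ * D in each.
have M0 : 0 <= M.
  by rewrite /M !mulr_ge0 ?sqr_ge0 ?addr_ge0// ltW.
apply: (@le_trans _ _ ((lvol b)^-1 * (Cl * T ^+ 2 * M))).
  rewrite ler_pM2l ?invr_gt0// (le_trans (ler_norm_sum _ _ _))//.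
  apply: (@le_trans _ _ (\sum_(p <- SP) M)).
    by rewrite [X in X <= _]big_seq [X in _ <= X]big_seq; apply: ler_sum => p pS; exact: each.
  by rewrite big_const_seq count_predT iter_addr_0 -mulr_natl ler_wpM2r.
rewrite /M /T /C le_eqVlt; apply/orP; left; apply/eqP; field.
by rewrite !gt_eqF.
Qed.

Lemma Phi_lip : exists2 C : R, 0 < C & forall u B A, 1 <= A -> bump u B A ->
  forall (l x : R) (SP : seq R[i]) (r : R), 0 < l -> l / 2 <= x <= 2 * l ->
    covers L SP r -> A <= alpha * x * r -> A <= alpha * l * r ->
  `| x ^+ 2 / lvol b * \sum_(p <- SP) fine (Icirc alpha u (alpha * x * cmod p))
     - l ^+ 2 / lvol b * \sum_(p <- SP) fine (Icirc alpha u (alpha * l * cmod p)) |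
  <= C * B * A ^+ 3 * `|x / l - 1|.
Proof.
have [C C0 h] := lattice_sum_lip; have pi0 := @pi_gt0 R.
exists (C * (2 * pi)); first by rewrite mulr_gt0// mulr_gt0.
move=> u B A A1 bu l x SP r l0 lx cov Ax Al.
have [u0 uL uA] := bu.
have B0 : 0 <= B by have /andP[] := u0 0; exact: le_trans.
have M0 : 0 <= 2 * pi * B by rewrite !mulr_ge0// ltW.
have IB c : 0 <= c -> 0 <= fine (Icirc alpha u c) <= 2 * pi * B.
  move=> c0; rewrite fine_ge0 ?(Icirc_ge0 _ bu)// andTb -lee_fin.
  by rewrite (fineK (Icirc_fin _ bu c)); exact: (Icirc_le _ bu).
have IA c : 0 <= c -> A <= c -> fine (Icirc alpha u c) = 0.
  by move=> c0 Ac; rewrite (Icirc_eq0 halpha bu c0 Ac).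
have := h (fun c => fine (Icirc alpha u c)) _ _ A1 M0 IB
  (@Icirc_lip R alpha halpha u B A bu) IA l x SP r l0 lx cov Ax Al.
by move=> /le_trans; apply; rewrite !mulrA.
Qed.

End PhiLip.

(** * The limit of small scale *)

Section SmallScale.
Context {R : realType}.
Notation mu := (@lebesgue_measure R).

Lemma integral_powR (a m : R) : 0 < a -> 0 < m ->
  (\int[mu]_(s in `[0%R, m]) (s `^ a)%:E = (m `^ (a + 1) / (a + 1))%:E)%E.
Proof.
move=> a0 m0; have a10 : 0 < a + 1 by rewrite addr_gt0.
pose F (s : R) : R := (a + 1)^-1 * s `^ (a + 1).
have dF (x : R) : 0 < x -> is_derive x 1 F (x `^ a).
  move=> x0; rewrite (_ : x `^ a = (a + 1)^-1 * ((a + 1) * x `^ (a + 1 - 1))); last first.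
    by rewrite mulrA mulVf ?mul1r ?addrK// gt_eqF.
  by apply: is_deriveZ; exact: is_derive1_powR.
rewrite (@continuous_FTC2 _ _ F)//.
- rewrite -EFinB /F powR0 ?gt_eqF//; congr EFin; rewrite mulr0 subr0; exact: mulrC.
- apply/continuous_within_itvP => //; split.
  + by move=> x; rewrite in_itv/= => /andP[x0 _]; exact: continuous_powR.
  + by rewrite powR0 ?gt_eqF//; exact: powR_cvg0.
  + by apply: cvg_at_left_filter; exact: continuous_powR.
- split.
  + by move=> x; rewrite in_itv/= => /andP[x0 _]; have [] := dF x x0.
  + rewrite /F powR0 ?gt_eqF//.
    by apply: cvgM; [exact: cvg_cst|exact: powR_cvg0].
  + apply: cvg_at_left_filter; apply: cvgM; first exact: cvg_cst.
    exact: continuous_powR.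
move=> x; rewrite in_itv/= => /andP[x0 _].
by rewrite derive1E; apply: derive_val; exact: dF.
Qed.

Variable alpha : R.
Hypothesis halpha : 0 < alpha < 1.
Let a0 : 0 < alpha. Proof. by case/andP: halpha. Qed.
Let a1 : alpha < 1. Proof. by case/andP: halpha. Qed.

(** The integration is over the first argument of [density]. As [density] is homogeneous of degree
    -2, the result does not depend on m > 0; this is why the limit for lambda = 0 is a constant
    density. *)
Lemma integral_density (m : R) : 0 <= m ->
  (\int[mu]_(s in `]0%R, +oo[) (s * density alpha s m)%:E =
   (if m == 0 then 0 else (4 - 2 * alpha)^-1)%:E)%E.
Proof.
move=> m0; have da : 0 < 1 - alpha by rewrite subr_gt0.
have [->|mn0] := eqVneq m 0.
  rewrite integral0_eq// => s /=; rewrite in_itv/= andbT => s0.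
  by rewrite /density leNgt s0/= mulr0.
have mp : 0 < m by rewrite lt_def mn0.
set e := 2 / (1 - alpha); set sg := (4 - 2 * alpha) / (1 - alpha).
have sgE : sg = (1 + e) + 1 by rewrite /sg /e; field; rewrite gt_eqF.
have e0 : 0 < e by rewrite divr_gt0.
have e10 : 0 < 1 + e by rewrite addr_gt0.
transitivity (\int[mu]_(s in `[0%R, m])
   (((1 - alpha)^-1 * m `^ (- sg))%:E * (s `^ (1 + e))%:E))%E.
  rewrite integral_mkcond [RHS]integral_mkcond; apply: eq_integral => s _.
  rewrite /patch mem_itv_pos mem_itv_cc; have [s0|s0] := ltP 0 s; last first.
    case: ifP => // /andP[s0' _]; rewrite (le_anti (introT andP (conj s0 s0'))).
    by rewrite powR0 ?gt_eqF// mule0.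
  rewrite (ltW s0) andTb /density; case: ifP => sm; last by rewrite mulr0.
  rewrite -EFinM powRD; last by rewrite (gt_eqF s0) implybT.
  by rewrite powRr1 ?(ltW s0)// -/e -/sg; congr EFin; ring.
rewrite ge0_integralZl ?lee_fin ?mulr_ge0 ?powR_ge0 ?invr_ge0 ?(ltW da)//; last 2 first.
- by apply: measurable_funTS; apply/measurable_EFinP; exact: measurable_powR.
- by move=> s _; rewrite lee_fin powR_ge0.
rewrite integral_powR// -EFinM -sgE powRN; congr EFin.
have pm : 0 < m `^ sg by rewrite powR_gt0.
have a2 : 0 < 4 - 2 * alpha by have := a1; lra.
move: (m `^ sg) pm => M pm; rewrite /sg; field.
by rewrite !gt_eqF//=.
Qed.

Lemma Leb_sigma_finite : sigma_finite [set: plane R] (Leb R).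
Proof.
exists (fun n => cbox n%:R); last first.
  by move=> n; split; [exact: measurable_cbox|rewrite Leb_cbox ?ler0n// ltry].
apply/seteqP; split => // z _.
exists (Num.truncn (cmod (complex_of z))).+1 => //; apply: cmod_cbox.
exact: ltW (truncnS_gt _).
Qed.

(** The plane measure equipped with sigma-finiteness, for Tonelli on the product of the line and the
    plane. *)
Definition Leb_sigma : {sigma_finite_measure set (plane R) -> \bar R} :=
  HB.pack (product_measure1 mu mu)
    (isSFinite.Build _ _ _ _ (sfinite_measure_sigma_finite Leb_sigma_finite))
    (isSigmaFinite.Build _ _ _ _ Leb_sigma_finite).

Variables (u : R[i] -> R) (B A : R).
Hypothesis (bu : bump u B A).

Let u0 z : 0 <= u z. Proof. by have [/(_ z)/andP[]] := bu. Qed.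
Let uL z w : `|u z - u w| <= B * cmod (z - w).
Proof. by have [_ h _] := bu; exact: h. Qed.

(** Represent I(s) by its density and exchange the integrals; the inner one over s is then the
    constant of [integral_density]. *)
Lemma integral_Icirc :
  (\int[mu]_(s in `]0%R, +oo[) (s%:E * Icirc alpha u s) =
   (4 - 2 * alpha)^-1%:E * \int[Leb R]_z (u (complex_of z))%:E)%E.
Proof.
have a2 : 0 < 4 - 2 * alpha by have := a1; lra.
have mu1 := lipschitz_measurable uL.
have mc := @measurable_cmod R.
pose K (q : measurableTypeR R * plane R) : R := \1_(`]0, +oo[) q.1 *
  (q.1 * (u (complex_of q.2) * density alpha q.1 (cmod (complex_of q.2)))).
have mK : measurable_fun [set: measurableTypeR R * plane R] (fun q => (K q)%:E).
  apply/measurable_EFinP.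
  have m1 : measurable_fun [set: measurableTypeR R * plane R] (fun q => q.1 : R) by exact: measurable_fst.
  have m2 : measurable_fun [set: measurableTypeR R * plane R] (fun q => cmod (complex_of q.2)).
    exact: (measurableT_comp mc (@measurable_snd _ _ _ _)).
  have m3 : measurable_fun [set: measurableTypeR R * plane R] (fun q => u (complex_of q.2)).
    exact: (measurableT_comp mu1 (@measurable_snd _ _ _ _)).
  have mI : measurable_fun [set: measurableTypeR R] (\1_(`]0, +oo[) : R -> R) by exact: measurable_indic.
  apply: measurable_funM; first exact: (measurableT_comp mI m1).
  apply: measurable_funM => //; apply: measurable_funM => //.
  apply: measurable_fun_ifT => //; first exact: measurable_fun_ler.
  apply: measurable_funM; first (apply: measurable_funM => //; exact: (measurableT_comp (measurable_powR _) m1)).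
  exact: (measurableT_comp (measurable_powR _) m2).
have K0 q : (0 <= (K q)%:E)%E.
  rewrite lee_fin /K indicE mem_itv_pos; have [s0|] := ltP 0 q.1; last by rewrite mul0r.
  by rewrite mul1r mulr_ge0 ?(ltW s0)// mulr_ge0// density_ge0.
transitivity (\int[mu]_s \int[Leb R]_z (K (s, z))%:E)%E.
  rewrite integral_mkcond; apply: eq_integral => s _; rewrite /patch mem_itv_pos.
  have [s0|s0] := ltP 0 s; last first.
    by rewrite integral0_eq// => z _; rewrite /K /= indicE mem_itv_pos ltNge s0 mul0r.
  rewrite (Icirc_density halpha bu s0) -ge0_integralZl ?lee_fin ?(ltW s0)//; last 2 first.
  - apply/measurable_EFinP; apply: measurable_funM => //.
    exact: (measurableT_comp (measurable_density _ s) mc).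
  - by move=> z _; rewrite lee_fin mulr_ge0// density_ge0.
  apply: eq_integral => z _; rewrite /K /= indicE mem_itv_pos s0 mul1r.
  by rewrite -EFinM.
transitivity (\int[Leb R]_z \int[mu]_s (K (s, z))%:E)%E.
  exact: (@fubini_tonelli _ _ _ _ _ mu Leb_sigma (fun q => (K q)%:E)).
rewrite -ge0_integralZl ?lee_fin ?invr_ge0 ?(ltW a2)//; last 2 first.
- exact/measurable_EFinP.
- by move=> z _; rewrite lee_fin.
have mz : measurable [set (0, 0) : plane R].
  have -> : [set (0, 0) : plane R] = [set 0] `*` [set 0].
    by apply/seteqP; split => [[x y]/= [-> ->]//|[x y] /= [-> ->]].
  exact: measurableX.
(* At the origin the inner integral is 0 instead of the constant, so the two integrands agree only
   almost everywhere. *)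
have z0 : (Leb R).-negligible [set (0, 0) : plane R].
  exists [set (0, 0)]; split => //.
  have -> : [set (0, 0) : plane R] = [set 0] `*` [set 0].
    by apply/seteqP; split => [[x y]/= [-> ->]//|[x y] /= [-> ->]].
  transitivity (mu [set 0%R] * mu [set 0%R])%E; first exact: product_measure1E.
  by rewrite lebesgue_measure_set1 mul0e.
apply: ge0_ae_eq_integral => //.
- exact: (measurable_fun_fubini_tonelli_G (m1 := mu) (fun q => (K q)%:E)).
- by apply: emeasurable_funM => //; exact/measurable_EFinP.
- by move=> z _; exact: integral_ge0.
- by move=> z _; rewrite mule_ge0// lee_fin// invr_ge0 ltW.
apply: (negligibleS _ z0) => z /=; apply: contra_notP => zn0 _.
have zn : complex_of z != 0.
  by apply/eqP => -[z1 z2]; apply: zn0; case: z z1 z2 => x y /= -> ->.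
transitivity ((u (complex_of z))%:E * \int[mu]_(s in `]0%R, +oo[)
   (s * density alpha s (cmod (complex_of z)))%:E)%E; last first.
  by rewrite integral_density ?cmod_ge0// cmod_eq0 (negbTE zn) muleC.
rewrite -ge0_integralZl ?lee_fin//; last 2 first.
- apply: measurable_funTS; apply/measurable_EFinP; apply: measurable_funM => //.
  apply: measurable_fun_ifT => //; first exact: measurable_fun_ler.
  by apply: measurable_funM => //; apply: measurable_funM => //; exact: measurable_powR.
- by move=> s /=; rewrite in_itv/= andbT => s0; rewrite lee_fin mulr_ge0 ?density_ge0 ?(ltW s0).
rewrite [RHS]integral_mkcond; apply: eq_integral => s _.
rewrite /patch mem_itv_pos /K /= indicE mem_itv_pos.
by case: ltP => _; rewrite ?mul0r// mul1r -EFinM mulrCA.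
Qed.

End SmallScale.

Section SmallScaleSum.
Context {R : realType}.
Notation mu := (@lebesgue_measure R).

Lemma integral_scale (k J : R) (I : R -> R) : 0 < k ->
  measurable_fun [set: measurableTypeR R] I -> (forall c, 0 <= I c) ->
  (\int[mu]_(s in `]0%R, +oo[) (s * I s)%:E = J%:E)%E ->
  (\int[mu]_(r in `]0%R, +oo[) (r * I (k * r))%:E = (J / k ^+ 2)%:E)%E.
Proof.
move=> k0 mI I0 IJ.
have mIk : measurable_fun [set: measurableTypeR R] (fun r : R => I (k * r)).
  by apply: (measurableT_comp mI); apply: measurable_funM.
pose G (s : measurableTypeR R) : \bar R := (\1_(`]0%R, +oo[) s * (s * I s))%:E.
have GE (g : R -> R) : (\int[mu]_(s in `]0%R, +oo[) (s * g s)%:E =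
    \int[mu]_s (\1_(`]0%R, +oo[) s * (s * g s))%:E)%E.
  rewrite integral_mkcond; apply: eq_integral => s _.
  by rewrite /patch indicE; case: ifP => _; rewrite ?mul1r ?mul0r.
have mG : measurable_fun [set: measurableTypeR R] G.
  by apply/measurable_EFinP; apply: measurable_funM; [exact: measurable_indic|apply: measurable_funM].
have pos0 (g : R -> R) s : (forall c, 0 <= g c) -> (0 <= (\1_(`]0%R, +oo[) s * (s * g s))%:E)%E.
  move=> g0; rewrite lee_fin indicE mem_itv_pos.
  by case: ltP => [/ltW ?|]; rewrite ?mul0r// mul1r mulr_ge0.
have kk : 0 < k ^+ 2 by rewrite exprn_gt0.
have := integral_affine 0 (lt0r_neq0 k0) mG (fun s => pos0 _ s I0).
rewrite -GE IJ => H.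
have {}H : J%:E = ((k ^+ 2)%:E * \int[mu]_(r in `]0%R, +oo[) (r * I (k * r))%:E)%E.
  rewrite H (GE (fun r => I (k * r))) -ge0_integralZl ?lee_fin ?(ltW kk)//; last 2 first.
  - by apply/measurable_EFinP; apply: measurable_funM; [exact: measurable_indic|apply: measurable_funM].
  - by move=> s _; exact: (pos0 (fun r => I (k * r)) s (fun r => I0 _)).
  apply: eq_integral => s _; rewrite /G addr0 -!EFinM gtr0_norm// !indicE !mem_itv_pos pmulr_rgt0//.
  by congr EFin; ring.
rewrite mulrC EFinM H muleA -EFinM mulVf ?mul1e// gt_eqF//.
Qed.

Lemma integral_cbox (K s : R) : 0 <= K -> 0 <= s ->
  (\int[Leb R]_z (K * \1_(cbox s) z)%:E = (K * (4 * s ^+ 2))%:E)%E.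
Proof.
move=> K0 s0; have mc := @measurable_cbox R s.
have mi : measurable_fun [set: plane R] (fun z => (\1_(cbox s) z : R)%:E).
  by apply/measurable_EFinP; exact: measurable_indic.
have i0 z : [set: plane R] z -> (0 <= (\1_(cbox s) z : R)%:E)%E.
  by rewrite lee_fin indicE ler0n.
have := ge0_integralZl (Leb R) measurableT mi i0 (k := K%:E).
rewrite lee_fin => /(_ K0); rewrite integral_indic// setIT Leb_cbox// -EFinM => <-//.
Qed.

Lemma bump_ge0E (u : R[i] -> R) (B A : R) : bump u B A -> forall z, (0 <= (u z)%:E)%E.
Proof. by case=> u0 _ _ z; rewrite lee_fin; have /andP[] := u0 z. Qed.

Lemma bump_integral_fin (u : R[i] -> R) (B A : R) : 0 <= A -> bump u B A ->
  (\int[Leb R]_z (u (complex_of z))%:E)%E \is a fin_num.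
Proof.
move=> A0 bu; have [u0 uL uA] := bu.
have B0 : 0 <= B by have /andP[] := u0 0; exact: le_trans.
rewrite ge0_fin_numE; last by apply: integral_ge0 => z _; rewrite lee_fin; have /andP[] := u0 (complex_of z).
apply: (@le_lt_trans _ _ (\int[Leb R]_z (B * \1_(cbox A) z)%:E)%E).
  apply: ge0_le_integral => //.
  - by move=> z _; rewrite lee_fin; have /andP[] := u0 (complex_of z).
  - by apply/measurable_EFinP; exact: (lipschitz_measurable uL).
  - apply/measurable_EFinP; apply: measurable_funM => //; apply: measurable_indic; exact: measurable_cbox.
  - move=> z _; rewrite lee_fin indicE; have [zA|zA] := leP (cmod (complex_of z)) A.
      by rewrite mem_set ?mulr1; [have /andP[] := u0 (complex_of z)|exact: cmod_cbox].
    by rewrite uA ?mulr_ge0 ?ler0n// ltW.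
by rewrite integral_cbox// ltry.
Qed.

Variables (b : R[i] * R[i]) (L : set R[i]).
Hypothesis (hb : is_Zbasis L b).
Variable alpha : R.
Hypothesis halpha : 0 < alpha < 1.
Let a0 : 0 < alpha. Proof. by case/andP: halpha. Qed.
Let a1 : alpha < 1. Proof. by case/andP: halpha. Qed.

(** [tile_sum] for the radial function I(k |z|) with k = alpha x: on a tile it varies by at most M k
    d, over an area of order (A / k + d)^2. Multiplied by x^2 this is of order M A^2 x, as x <=
    1. *)
Lemma lattice_sum_integral : exists2 C : R, 0 < C & forall (I : R -> R) M A J,
  1 <= A -> 0 <= M -> (forall c, 0 <= I c <= M) ->
  (forall c c', `|I c - I c'| <= M * `|c - c'|) ->
  (forall c, A <= c -> I c = 0) ->
  (\int[mu]_(s in `]0%R, +oo[) (s * I s)%:E = J%:E)%E ->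
  forall (x : R) (SP : seq R[i]) (r : R), 0 < x <= 1 ->
    covers L SP r -> A <= alpha * x * r ->
  `| x ^+ 2 / lvol b * \sum_(p <- SP) I (alpha * x * cmod p)
     - 2 * pi / (alpha ^+ 2 * lvol b ^+ 2) * J | <= C * M * A ^+ 2 * x.
Proof.
have v0 := lvol_gt0 hb; have pi0 := @pi_gt0 R.
have [d d0 dE] : exists2 d, 0 < d & ldiam b = d by exists (ldiam b); [exact: (ldiam_gt0 hb)|].
pose C := (lvol b ^+ 2)^-1 * (alpha * d * 4 * (alpha^-1 + d) ^+ 2 + 4 * d ^+ 2).
have v20 : 0 < lvol b ^+ 2 by rewrite exprn_gt0.
exists C.
  rewrite mulr_gt0 ?invr_gt0// addr_gt0// ?mulr_gt0 ?exprn_gt0 ?addr_gt0 ?invr_gt0//.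
move=> I M A J A1 M0 IM IL IA IJ x SP r /andP[x0 x1] [uSP hSP cov] Ar.
have A0 : 0 < A by exact: lt_le_trans A1.
have I0 c : 0 <= I c by have /andP[] := IM c.
pose k := alpha * x; have k0 : 0 < k by exact: mulr_gt0.
have mI : measurable_fun [set: measurableTypeR R] I.
  by apply: continuous_measurable_fun; exact: (continuous_lip IL).
pose T := A / k; have T0 : 0 < T by rewrite divr_gt0.
pose F (z : plane R) := I (k * cmod (complex_of z)).
have mh : measurable_fun [set: measurableTypeR R] (fun s : R => I (k * s)).
  by apply: (measurableT_comp mI); apply: measurable_funM.
have mF : measurable_fun [set: plane R] F := measurableT_comp mh (@measurable_cmod R).
have FJ : (\int[Leb R]_z (F z)%:E = (2 * pi * (J / k ^+ 2))%:E)%E.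
  rewrite (integral_radial mh)// (integral_scale k0 mI I0 IJ).
  by rewrite -EFinM.
pose M1 := M * (k * d).
have M10 : 0 <= M1 by rewrite !mulr_ge0// ltW.
(* The second term pays for the tile at the origin: 0 is not in [SP], whereas I(k |z|) may be as
   large as M there. *)
pose g (z : plane R) : R := M1 * \1_(cbox (T + d)) z + M * \1_(cbox d) z.
have ind0 s (z : plane R) : 0 <= \1_(cbox s) z :> R by rewrite indicE ler0n.
have g0 z : 0 <= g z by rewrite addr_ge0// mulr_ge0.
have mi s : measurable_fun [set: plane R] (\1_(cbox s) : plane R -> R).
  by apply: measurable_indic; exact: measurable_cbox.
have mg : measurable_fun [set: plane R] g.
  by apply: measurable_funD; apply: measurable_funM.
have gE : (\int[Leb R]_z (g z)%:E = (M1 * (4 * (T + d) ^+ 2) + M * (4 * d ^+ 2))%:E)%E.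
  have one K s : 0 <= K -> 0 <= s ->
    (\int[Leb R]_z (K * \1_(cbox s) z)%:E = (K * (4 * s ^+ 2))%:E)%E.
    by move=> K0 s0; exact: integral_cbox.
  under eq_integral do rewrite EFinD.
  rewrite ge0_integralD//; last 4 first.
  - by move=> z _; rewrite lee_fin mulr_ge0.
  - by apply/measurable_EFinP; apply: measurable_funM.
  - by move=> z _; rewrite lee_fin mulr_ge0.
  - by apply/measurable_EFinP; apply: measurable_funM.
  by rewrite !one ?addr_ge0// ltW.
have SPL n : n \in SP -> Zgrid 0 L n by rewrite Zgrid0 => /hSP[].
have key n z : Zgrid 0 L n -> tile b n z ->
   `|(if n \in SP then I (k * cmod n) else 0) - F z| <= g z.
  rewrite Zgrid0 => Ln tn; have := tile_dist hb tn; rewrite dE => dn.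
  have [n0|n0] := eqVneq n 0.
    rewrite ifF; last by apply/negP => /hSP[_]; rewrite n0 eqxx.
    rewrite sub0r normrN (ger0_norm (I0 _)) /F /g [X in M * X]indicE mem_set; last first.
      by apply: cmod_cbox; rewrite -[complex_of z]subr0 -n0.
    rewrite mulr1; apply: (@le_trans _ _ M); first by have /andP[] := IM (k * cmod (complex_of z)).
    by rewrite lerDr mulr_ge0.
  have -> : (if n \in SP then I (k * cmod n) else 0) = I (k * cmod n).
    case: ifPn => // nS; rewrite IA// (le_trans Ar)// ler_pM2l//.
    by rewrite leNgt; apply: contra nS; exact: cov.
  apply: (@le_trans _ _ (M1 * \1_(cbox (T + d)) z)); last by rewrite lerDl mulr_ge0.
  have nz : `|cmod n - cmod (complex_of z)| <= d.
    rewrite ler_norml; apply/andP; split.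
      have := cmod_triB (complex_of z) n; lra.
    have := cmod_triB n (complex_of z); rewrite cmod_distC; lra.
  rewrite indicE; have [zT|zT] := leP (cmod (complex_of z)) (T + d).
    rewrite mem_set; last exact: cmod_cbox.
    rewrite mulr1 (le_trans (IL _ _))// ler_wpM2l// -mulrBr normrM gtr0_norm//.
    by rewrite ler_pM2l.
  have far s : T <= s -> I (k * s) = 0.
    by move=> Ts; rewrite IA// -ler_pdivrMl// mulrC.
  have Tz : T <= cmod (complex_of z) by move: d0 zT; lra.
  have Tn : T <= cmod n by move: nz; rewrite ler_norml => /andP[]; move: zT; lra.
  by rewrite /F (far _ Tn) (far _ Tz) subrr normr0 mulr_ge0 ?ler0n.
have [le1 le2] := @tile_sum _ b L hb 0 SP (fun n => I (k * cmod n)) F g uSP SPL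
  (fun n => I0 _) mF (fun z => I0 _) mg g0 key.
move: le1 le2; rewrite FJ gE -!EFinD !lee_fin.
move: (\sum_(n <- SP) _) => S le1 le2.
set E := M1 * _ + _ in le1 le2.
(* One factor 1 / covolume comes from the averaged pairs and one from the present sum over p; the
   scale x cancels. *)
have kE : x ^+ 2 / lvol b ^+ 2 * (2 * pi * (J / k ^+ 2)) = 2 * pi / (alpha ^+ 2 * lvol b ^+ 2) * J.
  by rewrite /k; field; rewrite !gt_eqF.
rewrite -kE (_ : x ^+ 2 / lvol b * S = x ^+ 2 / lvol b ^+ 2 * (lvol b * S)); last first.
  by field; rewrite gt_eqF.
rewrite -mulrBr normrM (ger0_norm (divr_ge0 (sqr_ge0 _) (ltW v20))).
apply: (@le_trans _ _ (x ^+ 2 / lvol b ^+ 2 * E)).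
  apply: ler_wpM2l; first exact: divr_ge0 (sqr_ge0 _) (ltW v20).
  by rewrite ler_norml; apply/andP; split; lra.
have xT : x * (T + d) <= A * (alpha^-1 + d).
  rewrite mulrDr /T /k (_ : x * (A / (alpha * x)) = A * alpha^-1); last first.
    by field; rewrite !gt_eqF.
  rewrite mulrDr lerD2l; apply: ler_wpM2r; [exact: ltW|exact: le_trans A1].
have xT2 : (x * (T + d)) ^+ 2 <= (A * (alpha^-1 + d)) ^+ 2.
  by rewrite ler_sqr ?nnegrE// ?mulr_ge0 ?addr_ge0 ?invr_ge0// ltW.
have -> : x ^+ 2 / lvol b ^+ 2 * E =
   (lvol b ^+ 2)^-1 * M * x * (alpha * d * 4 * (x * (T + d)) ^+ 2 + 4 * d ^+ 2 * x).
  by rewrite /E /M1 /k; ring.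
have -> : C * M * A ^+ 2 * x = (lvol b ^+ 2)^-1 * M * x *
   (alpha * d * 4 * (A * (alpha^-1 + d)) ^+ 2 + 4 * d ^+ 2 * A ^+ 2).
  by rewrite /C; ring.
apply: ler_wpM2l; first by rewrite !mulr_ge0 ?invr_ge0// ltW.
apply: lerD; first by apply: ler_wpM2l => //; rewrite !mulr_ge0// ltW.
apply: ler_wpM2l; first by rewrite mulr_ge0 ?sqr_ge0.
by rewrite (le_trans x1)// exprn_ege1.
Qed.

Lemma Phi_small : exists2 C : R, 0 < C & forall u B A, 1 <= A -> bump u B A ->
  forall (x : R) (SP : seq R[i]) (r : R), 0 < x <= 1 ->
    covers L SP r -> A <= alpha * x * r ->
  `| x ^+ 2 / lvol b * \sum_(p <- SP) fine (Icirc alpha u (alpha * x * cmod p))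
     - pi / (alpha ^+ 2 * (2 - alpha) * lvol b ^+ 2) * fine (\int[Leb R]_z (u (complex_of z))%:E) |
  <= C * B * A ^+ 2 * x.
Proof.
have [C C0 h] := lattice_sum_integral; have pi0 := @pi_gt0 R; have v0 := lvol_gt0 hb.
exists (C * (2 * pi)); first by rewrite mulr_gt0// mulr_gt0.
move=> u B A A1 bu x SP r x1 cov Ar.
have [u0 uL uA] := bu.
have B0 : 0 <= B by have /andP[] := u0 0; exact: le_trans.
have a2 : 0 < 4 - 2 * alpha by have := a1; lra.
have a3 : 0 < 2 - alpha by have := a1; lra.
have x0 : 0 < x by case/andP: x1.
(* Even extension: the bounds on [Icirc] hold for c >= 0, while the Riemann sum lemma asks for a
   function bounded and Lipschitz on the whole line. *)
pose I (c : R) : R := fine (Icirc alpha u `|c|).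
have fu := bump_integral_fin (le_trans ler01 A1) bu.
have IJ : (\int[mu]_(s in `]0%R, +oo[) (s * I s)%:E =
   ((4 - 2 * alpha)^-1 * fine (\int[Leb R]_z (u (complex_of z))%:E))%:E)%E.
  rewrite EFinM (fineK fu) -(integral_Icirc halpha bu); apply: eq_integral => s.
  rewrite inE /= in_itv/= andbT => s0.
  by rewrite EFinM /I (gtr0_norm s0) (fineK (Icirc_fin _ bu _)).
have IP c : 0 <= c -> I c = fine (Icirc alpha u c) by move=> c0; rewrite /I ger0_norm.
have M0 : 0 <= 2 * pi * B by rewrite !mulr_ge0// ltW.
have IM c : 0 <= I c <= 2 * pi * B.
  apply/andP; split; first exact: fine_ge0 (Icirc_ge0 _ bu _).
  rewrite -lee_fin (fineK (Icirc_fin _ bu _)); exact: (Icirc_le _ bu).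
have IL c c' : `|I c - I c'| <= 2 * pi * B * `|c - c'|.
  apply: (le_trans (Icirc_lip halpha bu (normr_ge0 c) (normr_ge0 c'))).
  by apply: ler_wpM2l => //; exact: ler_dist_dist.
have IA c : A <= c -> I c = 0.
  move=> Ac; have c0 : 0 <= c by rewrite (le_trans _ Ac)// (le_trans _ A1).
  by rewrite IP// (Icirc_eq0 halpha bu c0 Ac).
have SE : \sum_(p <- SP) I (alpha * x * cmod p) =
    \sum_(p <- SP) fine (Icirc alpha u (alpha * x * cmod p)).
  by apply: eq_bigr => p _; apply: IP; exact: (mulr_ge0 (mulr_ge0 (ltW a0) (ltW x0)) (cmod_ge0 p)).
have final (S S' J : R) : S = S' ->
    `|x ^+ 2 / lvol b * S - 2 * pi / (alpha ^+ 2 * lvol b ^+ 2) * ((4 - 2 * alpha)^-1 * J)|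
      <= C * (2 * pi * B) * A ^+ 2 * x ->
    `|x ^+ 2 / lvol b * S' - pi / (alpha ^+ 2 * (2 - alpha) * lvol b ^+ 2) * J|
      <= C * (2 * pi) * B * A ^+ 2 * x.
  move=> ->; rewrite [C * (2 * pi * B)]mulrA.
  have -> // : 2 * pi / (alpha ^+ 2 * lvol b ^+ 2) * ((4 - 2 * alpha)^-1 * J) =
     pi / (alpha ^+ 2 * (2 - alpha) * lvol b ^+ 2) * J.
  by field; rewrite !gt_eqF.
exact: (final _ _ _ SE (h I _ A _ A1 M0 IM IL IA IJ x SP r x1 cov Ar)).
Qed.

End SmallScaleSum.

(** * Test functions *)

Section TestFunctions.
Context {R : realType}.
Local Notation T := (R * R)%type.

Lemma is_derive_line (F : T -> R) (q v : T) (s : R) :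
  differentiable F (s *: v + q) ->
  is_derive s 1 (fun t : R => F (t *: v + q)) ('d F (s *: v + q) v).
Proof.
move=> dF; have E : (fun h : R => h^-1 *: (((fun t : R => F (t *: v + q)) \o shift s) (h *: 1) - F (s *: v + q)))
   = (fun h : R => h^-1 *: ((F \o shift (s *: v + q)) (h *: v) - F (s *: v + q))).
  by apply/funext => h /=; rewrite scalerDl -!addrA [h *: 1]mulr1.
by apply: DeriveDef; rewrite /derivable/derive E; [exact: diff_derivable|exact: deriveE].
Qed.

Lemma plane_norm_fst (h : T) : `|h.1| <= plane_norm h.
Proof. by have [] := cmod_Re_Im (complex_of h). Qed.

Lemma plane_norm_snd (h : T) : `|h.2| <= plane_norm h.
Proof. by have [] := cmod_Re_Im (complex_of h). Qed.

Lemma plane_norm_le (h : T) : plane_norm h <= `|h.1| + `|h.2|.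
Proof. exact: cmod_le_sum. Qed.

Lemma plane_normZ (k : R) (h : T) : plane_norm (k *: h) = `|k| * plane_norm h.
Proof.
rewrite /plane_norm (_ : complex_of (k *: h) = k%:C * complex_of h) ?cmodM ?cmodr//.
by case: h => x y; apply/eqP; rewrite eq_complex /= !mul0r subr0 addr0 !eqxx.
Qed.

Variable f : R[i] -> R[i].
Hypothesis hf : C1c f.
Let g := plane_map f.
Let dg p : differentiable g p. Proof. by have [] := hf. Qed.

Lemma diff_off_supp p h : ~ supp f p -> 'd g p h = 0.
Proof.
move=> pS; rewrite -deriveE//.
rewrite (@near_eq_derive _ _ _ _ (cst 0)); first by rewrite derive_cst.
have : nbhs p (~` supp f).
  by apply: open_nbhs_nbhs; split => //; apply: closed_openC; exact: closed_closure.
apply: filterS => q qS; rewrite /g /plane_map.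
have -> : f (complex_of q) = 0; last by [].
by apply: contra_notP qS => /eqP fq; exact: (@subset_closure _ [set p | f (complex_of p) != 0]).
Qed.

(** A crude bound, from the compact support and the two partial derivatives. It serves only to make
    the sets in [op_norm] and [diff_sup_norm] bounded, so that their suprema are upper bounds. *)
Lemma diff_bounded : exists2 M : R, 0 <= M & forall p h, plane_norm ('d g p h) <= M * plane_norm h.
Proof.
have [_ hc cS] := hf.
have bnd h : exists2 M : R, 0 <= M & forall p, `|'d g p h| <= M.
  have cK : compact [set 'd g p h | p in supp f].
    by apply: continuous_compact => //; apply: continuous_subspaceT; exact: hc.
  have [M [_ hM]] := compact_bounded cK.
  have M1 : M < `|M| + 1 by rewrite ltr_pwDr// ler_norm.
  exists (`|M| + 1); first by rewrite addr_ge0.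
  move=> p; have [pS|pS] := pselect (supp f p); last by rewrite diff_off_supp// normr0 addr_ge0.
  by apply: hM => //; exists p.
have [M1 M10 h1] := bnd (1, 0); have [M2 M20 h2] := bnd (0, 1).
exists (2 * (M1 + M2)); first by rewrite mulr_ge0// addr_ge0.
move=> p h; have hE : h = h.1 *: (1, 0) + h.2 *: (0, 1).
  case: h => x y /=; apply: (congr2 pair) => /=; rewrite ?[_ *: 1]mulr1 ?[_ *: 0]mulr0 ?addr0 ?add0r//.
have nh : `|'d g p h| <= (M1 + M2) * plane_norm h.
  rewrite {1}hE linearD !linearZ (le_trans (ler_normD _ _))// !normrZ mulrDl.
  apply: lerD; rewrite mulrC.
    exact: (ler_pM (normr_ge0 _) (normr_ge0 _) (h1 p) (plane_norm_fst h)).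
  exact: (ler_pM (normr_ge0 _) (normr_ge0 _) (h2 p) (plane_norm_snd h)).
apply: (le_trans (plane_norm_le _)); rewrite mulr2n -mulrA mulrDl !mul1r.
apply: lerD; apply: le_trans nh; rewrite [X in _ <= X]prod_normE le_max lexx ?orbT//.
Qed.

Let op_ubound p : has_ubound [set plane_norm ('d g p h) | h in [set h | plane_norm h <= 1]].
Proof.
have [M M0 hM] := diff_bounded; exists M => _ [h /= h1 <-].
by rewrite (le_trans (hM _ _))// ler_piMr.
Qed.

Lemma op_norm_le_diff p : op_norm ('d g p) <= diff_sup_norm f.
Proof.
have [M M0 hM] := diff_bounded.
apply: ub_le_sup; last by exists p.
exists M => _ [q _ <-]; apply: ge_sup.
  by exists (plane_norm ('d g q 0)); exists 0 => //=; rewrite /plane_norm /cmod /= !expr0n/= addr0 sqrtr0.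
move=> _ [h /= h1 <-]; by rewrite (le_trans (hM _ _))// ler_piMr.
Qed.

Lemma diff_le p h : plane_norm ('d g p h) <= diff_sup_norm f * plane_norm h.
Proof.
have [h0|h0] := eqVneq (plane_norm h) 0.
  have [M M0 hM] := diff_bounded.
  by apply: (le_trans (hM p h)); rewrite h0 !mulr0.
have hp : 0 < plane_norm h by rewrite lt_def h0 cmod_ge0.
rewrite -ler_pdivrMr// (le_trans _ (op_norm_le_diff p))//.
have hi : `|(plane_norm h)^-1| = (plane_norm h)^-1 by rewrite gtr0_norm// invr_gt0.
apply: ub_le_sup => //; exists ((plane_norm h)^-1 *: h) => /=.
  by rewrite plane_normZ hi mulVf.
by rewrite linearZ plane_normZ hi mulrC.
Qed.

Lemma diff_sup_norm_ge0 : 0 <= diff_sup_norm f.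
Proof.
have := le_trans (cmod_ge0 _) (diff_le 0 (1, 0)).
have -> : plane_norm ((1, 0) : T) = 1.
  transitivity (cmod (1%:C : R[i])); first by [].
  by rewrite cmodr normr1.
by rewrite mulr1.
Qed.

(** Composing with a linear form, here a coordinate, reduces to the real mean value theorem on the
    segment from q to p, and keeps the constant [diff_sup_norm f]. *)
Lemma C1c_lipschitz (l : {linear T -> R}) : continuous l -> (forall h, `|l h| <= plane_norm h) ->
  forall p q, `|l (g p) - l (g q)| <= diff_sup_norm f * plane_norm (p - q).
Proof.
move=> cl hl p q.
have dl x : differentiable l x by exact: linear_differentiable.
have dF x : differentiable (l \o g) x by exact: differentiable_comp.
pose phi (t : R) := (l \o g) (t *: (p - q) + q).
have dphi (t : R) : is_derive t 1 phi ('d (l \o g) (t *: (p - q) + q) (p - q)).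
  exact: is_derive_line.
have [|c _] := @MVT R phi _ 0 1 ltr01 (fun x _ => dphi x).
  apply: derivable_within_continuous => x _; by have [] := dphi x.
rewrite subr0 mulr1 /phi scale1r scale0r subrK add0r /= => ->.
rewrite diff_comp//= diff_lin//; apply: (le_trans (hl _)); exact: diff_le.
Qed.

End TestFunctions.

Lemma bump_max {R : realType} (h : R[i] -> R) (B A : R) :
  (forall z, `|h z| <= B) ->
  (forall z w, `|h z - h w| <= B * cmod (z - w)) ->
  (forall z, A <= cmod z -> h z = 0) -> bump (fun z => Num.max (h z) 0) B A.
Proof.
move=> hB hL hA; split=> [z|z w|z /hA ->]; last by rewrite maxxx.
  have B0 : 0 <= B by apply: le_trans (hB 0).
  by rewrite le_max lexx orbT ge_max B0 andbT (le_trans (ler_norm _)).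
apply: le_trans (hL z w).
have [hz|hz] := leP (h z) 0; have [hw|hw] := leP (h w) 0; rewrite ler_norml;
  apply/andP; split; rewrite ?(ler_norml, ler_normr) ?subrr ?oppr_le0 ?normr_ge0//;
  by have := ler_norm (h z - h w); have := ler_norm (h w - h z); rewrite (distrC (h w)); move: hz hw; lra.
Qed.

Lemma cmod_le_Re_Im {R : realType} (z : R[i]) : cmod z <= `|complex.Re z| + `|complex.Im z|.
Proof. by case: z => x y; exact: cmod_le_sum. Qed.

Section TestFunctionBumps.
Context {R : realType}.
Local Notation T := (R * R)%type.
Variables (f : R[i] -> R[i]) (A : R).
Hypothesis hf : C1c f.
Hypothesis fA : supp f `<=` [set p | plane_norm p < A].
Hypothesis A0 : 0 < A.

Let fst_cont : continuous (fst : T -> R). Proof. by move=> x; exact: cvg_fst. Qed.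
Let snd_cont : continuous (snd : T -> R). Proof. by move=> x; exact: cvg_snd. Qed.

Lemma Re_lipschitz z w :
  `|complex.Re (f z) - complex.Re (f w)| <= diff_sup_norm f * cmod (z - w).
Proof.
have := @C1c_lipschitz _ f hf fst fst_cont (@plane_norm_fst R) (plane_of z) (plane_of w).
by rewrite /plane_map !complex_ofK; case: z w => [x y] [x' y'].
Qed.

Lemma Im_lipschitz z w :
  `|complex.Im (f z) - complex.Im (f w)| <= diff_sup_norm f * cmod (z - w).
Proof.
have := @C1c_lipschitz _ f hf snd snd_cont (@plane_norm_snd R) (plane_of z) (plane_of w).
by rewrite /plane_map !complex_ofK; case: z w => [x y] [x' y'].
Qed.

Lemma C1c_eq0 z : A <= cmod z -> f z = 0.
Proof.
rewrite leNgt => Az; apply: contraNeq Az => fz.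
have /fA : supp f (plane_of z).
  by apply: (@subset_closure _ [set p | f (complex_of p) != 0]); rewrite /= complex_ofK.
by rewrite /= /plane_norm complex_ofK.
Qed.

Lemma cmod_le_sup_norm z : cmod (f z) <= sup_norm f.
Proof.
apply: ub_le_sup; last by exists z.
have D0 := diff_sup_norm_ge0 hf.
exists (2 * (diff_sup_norm f * (2 * A))) => _ [{}z _ <-].
have [Az|zA] := leP A (cmod z).
  by rewrite C1c_eq0// cmod0 !mulr_ge0// ltW.
(* The real point A is a zero of f within 2 A of every point of the disk, so the Lipschitz bounds
   make f bounded; the value of the bound is irrelevant. *)
have fA0 : f A%:C = 0 by apply: C1c_eq0; rewrite cmodr ger0_norm// ltW.
have zA2 : diff_sup_norm f * cmod (z - A%:C) <= diff_sup_norm f * (2 * A).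
  apply: ler_wpM2l => //; rewrite (le_trans (cmodB _ _))// cmodr ger0_norm ?(ltW A0)//.
  by move: zA; lra.
have := Re_lipschitz z A%:C; have := Im_lipschitz z A%:C; rewrite fA0 !subr0 => h1 h2.
apply: (le_trans (cmod_le_Re_Im _)); rewrite mulr2n mulrDl !mul1r.
by apply: lerD; [exact: le_trans h2 zA2|exact: le_trans h1 zA2].
Qed.

Lemma sup_norm_ge0 : 0 <= sup_norm f.
Proof. exact: le_trans (cmod_ge0 _) (cmod_le_sup_norm 0). Qed.

Notation B := (sup_norm f + diff_sup_norm f).

Lemma C1c_bump (k : R) (l : R[i] -> R) : `|k| = 1 -> (forall z w, l (z - w) = l z - l w) ->
  (forall z, `|l z| <= cmod z) ->
  (forall z w, `|l (f z) - l (f w)| <= diff_sup_norm f * cmod (z - w)) ->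
  bump (fun z => Num.max (k * l (f z)) 0) B A.
Proof.
move=> k1 lB lc lL; have D0 := diff_sup_norm_ge0 hf; have S0 := sup_norm_ge0.
apply: bump_max => [z|z w|z Az].
- rewrite normrM k1 mul1r (le_trans (lc _))// (le_trans (cmod_le_sup_norm z))// lerDl//.
- rewrite -mulrBr normrM k1 mul1r (le_trans (lL _ _))// ler_wpM2r ?cmod_ge0// lerDr//.
- by rewrite C1c_eq0// -(subrr 0) lB subrr mulr0.
Qed.

Lemma Re_bump (k : R) : `|k| = 1 -> bump (fun z => Num.max (k * complex.Re (f z)) 0) B A.
Proof.
move=> k1; apply: C1c_bump => //; first by case=> ? ? [].
  by move=> z; have [] := cmod_Re_Im z.
exact: Re_lipschitz.
Qed.

Lemma Im_bump (k : R) : `|k| = 1 -> bump (fun z => Num.max (k * complex.Im (f z)) 0) B A.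
Proof.
move=> k1; apply: C1c_bump => //; first by case=> ? ? [].
  by move=> z; have [] := cmod_Re_Im z.
exact: Im_lipschitz.
Qed.

Lemma Rintegral_parts (h w : R[i] -> R) (a b : R) : (forall z, 0 <= w z) ->
  (\int[Leb R]_z (Num.max (1 * h (complex_of z)) 0 * w (complex_of z))%:E = a%:E)%E ->
  (\int[Leb R]_z (Num.max (-1 * h (complex_of z)) 0 * w (complex_of z))%:E = b%:E)%E ->
  \int[Leb R]_z (h (complex_of z) * w (complex_of z)) = a - b.
Proof.
move=> w0 ha hb; rewrite /Rintegral integralE.
have -> : ((fun z : plane R => (h (complex_of z) * w (complex_of z))%:E)^\+)%E =
    (fun z => (Num.max (1 * h (complex_of z)) 0 * w (complex_of z))%:E).
  by apply/funext => z; rewrite funeposE -EFin_max mul1r maxr_pMl// mul0r.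
have -> : ((fun z : plane R => (h (complex_of z) * w (complex_of z))%:E)^\-)%E =
    (fun z => (Num.max (-1 * h (complex_of z)) 0 * w (complex_of z))%:E).
  by apply/funext => z; rewrite funenegE -EFinN -EFin_max mulN1r maxr_pMl// mul0r mulNr.
by rewrite ha hb.
Qed.

Lemma maxB1 (x : R) : x = Num.max (1 * x) 0 - Num.max (-1 * x) 0.
Proof. by rewrite mul1r mulN1r; case: (leP x 0) => h; case: (leP (- x) 0) => h'; lra. Qed.

(** The real and imaginary parts are each a difference of two bumps, and each of the four bumps
    costs [E]. The weight is arbitrary so that it can be [rho] in the finite regimes and 0 in the
    infinite one. *)
Lemma cintegral_transfer (I J : eqType) (K : R) (ks : seq I) (ns : seq J) (F : I -> J -> R[i])
    (w : R[i] -> R) (E : R) : (forall z, 0 <= w z) ->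
  (forall u, bump u B A ->
     exists2 a, (\int[Leb R]_z (u (complex_of z) * w (complex_of z))%:E = a%:E)%E &
       `|K * \sum_(k <- ks) \sum_(n <- ns) u (F k n) - a| <= E) ->
  cmod (K%:C * \sum_(k <- ks) \sum_(n <- ns) f (F k n) -
        cintegral (Leb R) (fun z => f z * (w z)%:C)) <= 4 * E.
Proof.
move=> w0 H.
have one (h : R[i] -> R) :
    bump (fun z => Num.max (1 * h z) 0) B A -> bump (fun z => Num.max (-1 * h z) 0) B A ->
    `|K * \sum_(k <- ks) \sum_(n <- ns) h (F k n)
       - \int[Leb R]_z (h (complex_of z) * w (complex_of z))| <= 2 * E.
  move=> /H[a ha Ha] /H[b hb Hb]; rewrite (Rintegral_parts w0 ha hb).
  have -> : \sum_(k <- ks) \sum_(n <- ns) h (F k n) =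
     \sum_(k <- ks) \sum_(n <- ns) Num.max (1 * h (F k n)) 0 -
     \sum_(k <- ks) \sum_(n <- ns) Num.max (-1 * h (F k n)) 0.
    rewrite -sumrB; apply: eq_bigr => k _; rewrite -sumrB; apply: eq_bigr => n _; exact: maxB1.
  move: Ha Hb; move: (\sum_(k <- ks) _) (\sum_(k <- ks) _) => X Y Ha Hb.
  rewrite (_ : _ - _ = (K * Y - a) - (K * X - b)) ?(le_trans (ler_normB _ _)) ?mulr_natl ?mulr2n ?lerD//.
  by ring.
have N1 : `|(-1 : R)| = 1 by rewrite normrN normr1.
have hRe := one _ (Re_bump (normr1 _)) (Re_bump N1).
have hIm := one _ (Im_bump (normr1 _)) (Im_bump N1).
have Rsum : complex.Re (\sum_(k <- ks) \sum_(n <- ns) f (F k n)) =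
    \sum_(k <- ks) \sum_(n <- ns) complex.Re (f (F k n)).
  by rewrite raddf_sum; apply: eq_bigr => k _; rewrite raddf_sum.
have Isum : complex.Im (\sum_(k <- ks) \sum_(n <- ns) f (F k n)) =
    \sum_(k <- ks) \sum_(n <- ns) complex.Im (f (F k n)).
  by rewrite raddf_sum; apply: eq_bigr => k _; rewrite raddf_sum.
have RB (z z' : R[i]) : complex.Re (z - z') = complex.Re z - complex.Re z' by case: z z' => ? ? [].
have IB (z z' : R[i]) : complex.Im (z - z') = complex.Im z - complex.Im z' by case: z z' => ? ? [].
have RM (x : R) z : complex.Re (x%:C * z) = x * complex.Re z by case: z => ? ?; rewrite /= mul0r subr0.
have IM (x : R) z : complex.Im (x%:C * z) = x * complex.Im z by case: z => ? ?; rewrite /= mul0r addr0.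
have RMr (x : R) z : complex.Re (z * x%:C) = complex.Re z * x by rewrite mulrC RM mulrC.
have IMr (x : R) z : complex.Im (z * x%:C) = complex.Im z * x by rewrite mulrC IM mulrC.
have ReI : complex.Re (cintegral (Leb R) (fun z => f z * (w z)%:C)) =
    \int[Leb R]_z (complex.Re (f (complex_of z)) * w (complex_of z)).
  by rewrite /cintegral /=; apply: eq_Rintegral => z _; exact: RMr.
have ImI : complex.Im (cintegral (Leb R) (fun z => f z * (w z)%:C)) =
    \int[Leb R]_z (complex.Im (f (complex_of z)) * w (complex_of z)).
  by rewrite /cintegral /=; apply: eq_Rintegral => z _; exact: IMr.
rewrite (_ : 4 * E = 2 * E + 2 * E); last by ring.
apply: (le_trans (cmod_le_Re_Im _)); apply: lerD.
  by rewrite RB RM Rsum ReI.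
by rewrite IB IM Isum ImI.
Qed.

End TestFunctionBumps.

(** * The three regimes *)

Section BumpEstimates.
Context {R : realType}.
Variables (b : R[i] * R[i]) (L : set R[i]) (hb : is_Zbasis L b) (z0 : R[i]).
Hypothesis covE : covol L = lvol b.
Notation Lam := (Zgrid z0 L).
Variable alpha : R.
Hypothesis halpha : 0 < alpha < 1.
Let a0 : 0 < alpha. Proof. by case/andP: halpha. Qed.
Let a1 : alpha < 1. Proof. by case/andP: halpha. Qed.

Definition pair_sum (u : R[i] -> R) (s : R) (N : nat) (ks : seq int) : R :=
  \sum_(k <- ks) \sum_(nm <- fset_set (grid_pairs Lam N))
    u (s%:C * (branch_pow alpha k nm.1 - branch_pow alpha k nm.2)).

Lemma covers_exists (r : R) : exists SP, covers L SP r.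
Proof.
have [S [uS hS]] := lattice_ball_seq hb r.
exists S; split => // p; first by move=> /hS[].
by move=> Lp p0 pT; apply/hS; split => //; exact: ltW.
Qed.

Lemma rho_ge0 (l : R) z : 0 <= l -> 0 <= rho alpha L l z.
Proof.
move=> l0; have v0 := lvol_gt0 hb; have da : 0 < 1 - alpha by rewrite subr_gt0.
have da2 : 0 < 2 - alpha by have := a1; lra.
rewrite /rho covE; case: ifP => _.
  by rewrite divr_ge0 ?pi_ge0// !mulr_ge0 ?exprn_ge0// ltW.
case: ifP => _ //; rewrite mulr_ge0//; last by apply: fsumr_ge0 => p _; exact: powR_ge0.
by rewrite mulr_ge0 ?powR_ge0// divr_ge0 ?powR_ge0// mulr_ge0 ?(ltW v0) ?(ltW da).
Qed.

(** A contributing pair satisfies s |p| |n|^(alpha-1) <= Cr A by [pair_range]; with |p| >= 1 / [lK]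
    and |n| <= N this bounds x by Cr [lK] A. *)
Lemma pair_sum_eq0 : exists C Cs : R, [/\ 0 < C, 0 < Cs &
  forall u B A, 1 <= A -> bump u B A -> forall (s : R) (N : nat) (ks : seq int),
    0 < s -> (0 < N)%N -> Cs * A <= s -> C * A < s / N%:R `^ (1 - alpha) ->
    pair_sum u s N ks = 0].
Proof.
have [Cr [Cs [Cr0 Cs0 range]]] := pair_range hb z0 halpha.
have K0 := lK_gt0 hb.
exists (Cr * lK b), Cs; split => //; first exact: mulr_gt0.
move=> u B A A1 bu s N ks s0 N0 sA xA.
have xE : s * N%:R `^ (alpha - 1) = s / N%:R `^ (1 - alpha) by rewrite -opprB powRN.
have x0 : 0 < s / N%:R `^ (1 - alpha) by rewrite divr_gt0// powR_gt0 ?ltr0n.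
have [S [uS hS]] := grid_ball_seq hb z0 N%:R.
rewrite /pair_sum big1// => k _.
(* The empty list already contains every vector p that contributes, since there is none. *)
rewrite (@pair_sum_reindex _ _ _ hb z0 alpha u s N k [::] S)//; first by rewrite big_nil.
move=> p n Lp p0 Ln pv; exfalso.
have := range u B A A1 bu s N%:R k p n s0 sA Ln pv.
move: pv; rewrite /pair_val; case: ifPn => [/and4P[n0 nN _ _] _|]; last by rewrite eqxx.
apply/negP; rewrite -ltNge.
have h2 := pow_neg_ge halpha (etrans (cmod_gt0 n) n0) nN.
have lp := lattice_min hb Lp p0.
have sp : 0 <= s * cmod p by rewrite mulr_ge0 ?cmod_ge0// ltW.
apply: (lt_le_trans _ (ler_wpM2l sp h2)).
rewrite mulrAC xE -(ltr_pM2l K0) [ltRHS]mulrCA (_ : lK b * (Cr * A) = Cr * lK b * A); last by ring.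
exact: lt_le_trans xA (ler_peMr (ltW x0) lp).
Qed.

Lemma bump_small : exists C Cs : R, [/\ 0 < C, 0 < Cs &
  forall u B A, 1 <= A -> bump u B A ->
  forall (s : R) (N N' N'' : nat), 0 < s -> (0 < N)%N -> Cs * A <= s ->
    ldiam b <= N%:R -> (0 < N' + N'')%N ->
    let x := s / N%:R `^ (1 - alpha) in x <= 1 ->
  exists2 a, (\int[Leb R]_z (u (complex_of z) * rho alpha L 0 (complex_of z))%:E = a%:E)%E &
  `| ((N' + N'')%:R * (N%:R / x) ^+ 2)^-1 * pair_sum u s N (levels N' N'') - a |
  <= C * (A ^+ 4 * B * (x + (x * N%:R)^-1 + (N' + N'')%:R^-1))].
Proof.
have [C1 [Cs [C10 Cs0 est]]] := main_estimate hb z0 halpha.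
have [C2 C20 small] := Phi_small hb halpha.
exists (C1 + C2), Cs; split => //; first exact: addr_gt0.
move=> u B A A1 bu s N N' N'' s0 N0 sA dN K1 x x1.
have [u0 uL uA] := bu.
have B0 : 0 <= B by have /andP[] := u0 0; exact: le_trans.
have A0 : 0 < A by exact: lt_le_trans A1.
have x0 : 0 < x by rewrite divr_gt0// powR_gt0 ?ltr0n.
have K0 : 0 < (N' + N'')%:R :> R by rewrite ltr0n.
have N0' : 0 < N%:R :> R by rewrite ltr0n.
have ax : 0 < alpha * x by exact: mulr_gt0.
pose r := A / (alpha * x).
have xr : A <= alpha * x * r by rewrite /r mulrC divfK// gt_eqF.
have [SP cov] := covers_exists r.
have h1 := est u B A A1 bu s N N' N'' SP r s0 N0 sA dN K1 xr cov.
have h2 := small u B A A1 bu x SP r (introT andP (conj x0 x1)) cov xr.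
rewrite -/x in h1.
have fu := bump_integral_fin (le_trans ler01 A1) bu.
set q := pi / _ in h2.
exists (q * fine (\int[Leb R]_z (u (complex_of z))%:E)%E).
  rewrite EFinM (fineK fu).
  have mue : measurable_fun [set: plane R] (fun z => (u (complex_of z))%:E).
    by apply/measurable_EFinP; exact: (lipschitz_measurable uL).
  have := ge0_integralZl (Leb R) measurableT
     mue
     (fun z _ => bump_ge0E bu (complex_of z)) (k := q%:E).
  have q0 : (0 <= q%:E)%E.
    have := rho_ge0 0 (lexx 0); by rewrite /rho !eqxx covE lee_fin.
  move=> /(_ q0) <-; apply: eq_integral => z _.
  by rewrite /rho eqxx covE -/q EFinM muleC.
move: h1 h2; move: (fine (integral _ _ _)) (\sum_(p <- SP) _) => J S; rewrite -/(pair_sum u s N _).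
move: (pair_sum _ _ _ _) => P h1 h2.
rewrite -(subrKA (x ^+ 2 / lvol b * S)) (le_trans (ler_normD _ _))//.
apply: (le_trans (lerD h1 h2)).
have i0 : 0 <= (x * N%:R)^-1 by rewrite invr_ge0 mulr_ge0// ltW.
have k0 : 0 <= (N' + N'')%:R^-1 :> R by rewrite invr_ge0 ltW.
have A24 : A ^+ 2 <= A ^+ 4 by rewrite ler_weXn2l.
have A40 : 0 <= A ^+ 4 by rewrite exprn_ge0// ltW.
have A23 : A ^+ 2 * x <= A ^+ 4 * x by rewrite ler_pM2r.
move: i0 k0 A24 A23 A40; move: (_ * N%:R)^-1 (_ + _)%:R^-1 (A ^+ 2) (A ^+ 4).
move=> i k A2 A4 i0 k0 A24 A23 A40.
have -> : C1 * B * (A4 * i + A2 * k) + C2 * B * A2 * x =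
  C1 * B * (A4 * i) + C1 * B * k * A2 + C2 * B * (A2 * x) by ring.
have -> : (C1 + C2) * (A4 * B * (x + i + k)) =
  C1 * B * (A4 * i) + C1 * B * k * A4 + C2 * B * (A4 * x) + (C1 * B * A4 * x + C2 * B * A4 * (i + k)).
  by ring.
have C1B : 0 <= C1 * B by rewrite mulr_ge0// ltW.
have C2B : 0 <= C2 * B by rewrite mulr_ge0// ltW.
rewrite -[X in X <= _]addr0 lerD//.
  by rewrite lerD ?ler_wpM2l// lerD2l ler_wpM2l// mulr_ge0.
by rewrite addr_ge0// ?mulr_ge0 ?addr_ge0// ltW.
Qed.

End BumpEstimates.

Section BumpEstimate.
Context {R : realType}.
Variables (b : R[i] * R[i]) (L : set R[i]) (hb : is_Zbasis L b) (z0 : R[i]).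
Hypothesis covE : covol L = lvol b.
Variable alpha : R.
Hypothesis halpha : 0 < alpha < 1.
Let a0 : 0 < alpha. Proof. by case/andP: halpha. Qed.
Let a1 : alpha < 1. Proof. by case/andP: halpha. Qed.

Lemma bump_moderate : exists C Cs : R, [/\ 0 < C, 0 < Cs &
  forall u B A, 1 <= A -> bump u B A ->
  forall (l s : R) (N N' N'' : nat), 0 < s -> (0 < N)%N -> Cs * A <= s ->
    ldiam b <= N%:R -> (0 < N' + N'')%N ->
    let x := s / N%:R `^ (1 - alpha) in 0 < l -> l / 2 <= x <= 2 * l ->
  exists2 a, (\int[Leb R]_z (u (complex_of z) * rho alpha L l (complex_of z))%:E = a%:E)%E &
  `| ((N' + N'')%:R * (N%:R / x) ^+ 2)^-1 * pair_sum L z0 alpha u s N (levels N' N'') - a |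
  <= C * (B * (l + l^-1) `^ ((10 - 8 * alpha) / (1 - alpha)) *
          (A `^ ((8 - 6 * alpha) / (1 - alpha)) * `|x / l - 1|
           + A ^+ 4 / N%:R + A ^+ 2 / (N' + N'')%:R))].
Proof.
have [C1 [Cs [C10 Cs0 est]]] := main_estimate hb z0 halpha.
have [C2 C20 lip] := Phi_lip halpha hb.
exists (2 * C1 + C2), Cs; split => //; first by rewrite addr_gt0// mulr_gt0.
move=> u B A A1 bu l s N N' N'' s0 N0 sA dN K1 x l0 lx.
have [u0 uL uA] := bu.
have B0 : 0 <= B by have /andP[] := u0 0; exact: le_trans.
have A0 : 0 < A by exact: lt_le_trans A1.
have x0 : 0 < x by rewrite divr_gt0// powR_gt0 ?ltr0n.
have K0 : 0 < (N' + N'')%:R :> R by rewrite ltr0n.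
have N0' : 0 < N%:R :> R by rewrite ltr0n.
have da : 0 < 1 - alpha by rewrite subr_gt0.
have ax : 0 < alpha * x by exact: mulr_gt0.
have al : 0 < alpha * l by exact: mulr_gt0.
(* A radius valid at both scales, so that the same list [SP] enters the estimate at x and the
   integral of [rho] at l. *)
pose r := A / (alpha * x) + A / (alpha * l).
have xr : A <= alpha * x * r.
  rewrite /r mulrDr mulrC divfK ?gt_eqF// lerDl mulr_ge0 ?(ltW ax)// divr_ge0// ltW//.
have lr : A <= alpha * l * r.
  rewrite /r mulrDr addrC mulrC divfK ?gt_eqF// lerDl mulr_ge0 ?(ltW al)// divr_ge0// ltW//.
have [SP cov] := covers_exists hb r.
have h1 := est u B A A1 bu s N N' N'' SP r s0 N0 sA dN K1 xr cov.
have h2 := lip u B A A1 bu l x SP r l0 lx cov xr lr.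
rewrite -/x in h1.
eexists; first exact: (integral_rho halpha bu hb covE l0 cov lr).
have final (P X Y : R) :
    `|P - X| <= C1 * B * (A ^+ 4 / (x * N%:R) + A ^+ 2 / (N' + N'')%:R) ->
    `|X - Y| <= C2 * B * A ^+ 3 * `|x / l - 1| ->
    `|P - Y| <= (2 * C1 + C2) *
       (B * (l + l^-1) `^ ((10 - 8 * alpha) / (1 - alpha)) *
          (A `^ ((8 - 6 * alpha) / (1 - alpha)) * `|x / l - 1|
           + A ^+ 4 / N%:R + A ^+ 2 / (N' + N'')%:R)); last exact: (final _ _ _ h1 h2).
move=> {}h1 {}h2; rewrite -(subrKA X) (le_trans (ler_normD _ _))//.
apply: (le_trans (lerD h1 h2)).
set e1 := (10 - 8 * alpha) / (1 - alpha); set e2 := (8 - 6 * alpha) / (1 - alpha).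
(* The estimates give the power 3 of A and a factor 1 / x, at most 2 (l + 1/l). The stated exponents
   are larger and their bases at least 1, so they dominate. *)
have e11 : 1 <= e1 by rewrite /e1 ler_pdivlMr//; have := a1; lra.
have e23 : 3 <= e2 by rewrite /e2 ler_pdivlMr//; have := a1; lra.
have li : 0 < l^-1 by rewrite invr_gt0.
have kap1 : 1 <= l + l^-1.
  have [h|h] := leP 1 l; first by rewrite (le_trans h)// lerDl ltW.
  by rewrite (@le_trans _ _ l^-1) ?lerDr ?(ltW l0)// invf_ge1// ltW.
have kap : l + l^-1 <= (l + l^-1) `^ e1.
  by rewrite -[X in X <= _](powRr1 (le_trans ler01 kap1)) ler_powR.
have A3 : A ^+ 3 <= A `^ e2.
  by rewrite -powR_mulrn ?(ltW A0)// ler_powR.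
have A3p : 0 <= A ^+ 3 by rewrite exprn_ge0// ltW.
move: A3p kap A3; move: (_ `^ e1) (_ `^ e2) => kap A3 A3p hk hA.
have k1 : 1 <= kap by exact: le_trans hk.
have xi : x^-1 <= 2 * kap.
  have /andP[lx1 _] := lx.
  apply: (@le_trans _ _ (2 * l^-1)).
    have -> : 2 * l^-1 = (l / 2)^-1 by rewrite invfM invrK mulrC.
    have l2 : 0 < l / 2 by exact: divr_gt0.
    by rewrite lef_pV2 ?posrE.
  by rewrite ler_pM2l// (le_trans _ hk)// lerDr ltW.
have n0 : 0 <= `|x / l - 1| by exact: normr_ge0.
have i0 : 0 <= N%:R^-1 :> R by rewrite invr_ge0 ltW.
have k0 : 0 <= (N' + N'')%:R^-1 :> R by rewrite invr_ge0 ltW.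
have A40 : 0 <= A ^+ 4 by rewrite exprn_ge0// ltW.
have A20 : 0 <= A ^+ 2 by rewrite exprn_ge0// ltW.
rewrite [(x * _)^-1]invfM.
move: A3p n0 i0 k0 xi A40 A20 hA.
move: `|_ - 1| (N%:R^-1) (_ + _)%:R^-1 (x^-1) (A ^+ 2) (A ^+ 3) (A ^+ 4).
move=> n i k y A2 A3' A4 A3p n0 i0 k0 xi A40 A20 hA.
have -> : C1 * B * (A4 * (y * i) + A2 * k) + C2 * B * A3' * n =
  (C1 * B * A4 * i) * y + (C1 * B * A2 * k) * 1 + (C2 * B * n) * (A3' * 1) by ring.
have C1B : 0 <= C1 by exact: ltW.
have C2B : 0 <= C2 by exact: ltW.
have A30 : 0 <= A3 by exact: le_trans hA.
have kp0 : 0 <= kap by exact: le_trans k1.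

have -> : (2 * C1 + C2) * (B * kap * (A3 * n + A4 * i + A2 * k)) =
  (C1 * B * A4 * i) * (2 * kap) + (C1 * B * A2 * k) * kap + (C2 * B * n) * (A3 * kap) +
  (2 * (C1 * B) * kap * A3 * n + C2 * B * kap * (A4 * i + A2 * k) + C1 * B * kap * A2 * k).
  by ring.
rewrite -[X in X <= _]addr0 lerD//.
  apply: lerD; [apply: lerD|]; apply: ler_wpM2l; rewrite ?mulr_ge0//.
  by apply: ler_pM.
by rewrite !addr_ge0 ?mulr_ge0 ?addr_ge0 ?mulr_ge0.
Qed.

End BumpEstimate.

Lemma covol_lvol {R : realType} (L : set R[i]) (b : R[i] * R[i]) :
  b = xget (0, 0) (is_Zbasis L) -> is_Zbasis L b -> covol L = lvol b.
Proof. by move=> bE hb; rewrite /covol -bE (fundamental_tile hb). Qed.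

Theorem theorem2p4 (R : realType) (alpha : R) (z0 : R[i]) (L : set R[i])
    (halpha : 0 < alpha < 1) (hL : is_Zlattice L) :
  exists2 c : R, 0 < c &
  forall (phi psi : nat -> {posnum R}) (lam : \bar R) (A : R),
    (phi N)%:num @[N --> \oo] --> +oo ->
    (0 <= lam)%E ->
    ((phi N)%:num / N%:R `^ (1 - alpha))%:E @[N --> \oo] --> lam ->
    (forall N : nat, (1 <= N)%N ->
      (psi N)%:num = (N%:R `^ (2 - alpha) / (phi N)%:num) ^+ 2) ->
    1 < A ->
  exists N0 : nat,
  forall f : R[i] -> R[i], C1c f ->
    supp f `<=` [set p | plane_norm p < A] ->
  forall N N' N'' : nat, (1 <= N)%N -> (N0 <= N)%N -> (1 <= N' + N'')%N ->
  let calR := cintegral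
    (lvl_measure alpha (Zgrid z0 L) phi psi N N' N'') f in
  [/\ lam = +oo%E -> calR = 0,
      lam = 0%E ->
        cmod (calR - cintegral (Leb R) (fun z => f z * (rho alpha L 0 z)%:C))
        <= c * (A ^+ 4 * (sup_norm f + diff_sup_norm f) *
                ((phi N)%:num / N%:R `^ (1 - alpha)
                 + (N%:R `^ alpha * (phi N)%:num)^-1
                 + (N' + N'')%:R^-1)) &
      forall l : R, 0 < l -> lam = l%:E ->
        cmod (calR - cintegral (Leb R) (fun z => f z * (rho alpha L l z)%:C))
        <= c * ((sup_norm f + diff_sup_norm f) *
                (l + l^-1) `^ ((10 - 8 * alpha) / (1 - alpha)) *
                (A `^ ((8 - 6 * alpha) / (1 - alpha)) *
                   `|(phi N)%:num / (l * N%:R `^ (1 - alpha)) - 1|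
                 + A ^+ 4 / N%:R + A ^+ 2 / (N' + N'')%:R))].
Proof.
(* The very basis chosen in [covol], so that [covol L] is [lvol b] without comparing bases. *)
pose b := xget (0, 0) (is_Zbasis L).
have hb : is_Zbasis L b by have [b0 hb0] := hL; exact: (xgetPex _ (ex_intro _ b0 hb0)).
have covE : covol L = lvol b by exact: covol_lvol.
have [C0 [Cs0 [C00 Cs00 zero]]] := pair_sum_eq0 hb z0 halpha.
have [C1 [Cs1 [C10 Cs10 small]]] := bump_small hb z0 covE halpha.
have [C2 [Cs2 [C20 Cs20 moderate]]] := bump_moderate hb z0 covE halpha.
(* The factor 4 is that of [cintegral_transfer]; the sum gives one constant for both finite
   regimes. *)
exists (4 * (C1 + C2)); first by rewrite mulr_gt0// addr_gt0.
move=> phi psi lam A phioo lam0 xlam psiE A1.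
pose x N : R := (phi N)%:num / N%:R `^ (1 - alpha).
have A1' := ltW A1; have A0 : 0 < A by exact: lt_trans A1.
pose Cs := Cs0 + Cs1 + Cs2.
have [n1 _ hn1] : \forall N \near \oo, Cs * A <= (phi N)%:num.
  exact: (cvgryPge _).1.
have [n2 _ hn2] : \forall N \near \oo, ldiam b <= N%:R :> R.
  exact: nbhs_infty_ger.
have [n3 _ hn3] : \forall N \near \oo, [/\ lam = +oo%E -> C0 * A < x N,
    lam = 0%E -> x N <= 1 & forall l, 0 < l -> lam = l%:E -> l / 2 <= x N <= 2 * l].
  case: lam lam0 xlam => [l| |]//.
  - rewrite lee_fin => l0 /fine_cvgP[_ /cvgrPdist_lt xl].
    (* A tolerance l / 2 places x between l / 2 and 2 l; for l = 0 the tolerance 1 gives x <= 1. *)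
    have e0 : 0 < (if l == 0 then 1 else l / 2) :> R.
      by case: eqVneq => // ln0; rewrite divr_gt0// lt_def ln0.
    apply: filterS (xl _ e0) => N /=; rewrite -/(x N) => lx; split => //.
      by move=> [l0']; move: lx; rewrite l0' eqxx sub0r normrN => /ltW; exact: le_trans (ler_norm _).
    move=> l' l'0 [ll']; move: lx; rewrite ll' gt_eqF// ltr_norml => /andP[].
    by move=> h1 h2; apply/andP; split; move: h1 h2 l'0; lra.
  - move=> _ /cvgeyPgt xy.
    apply: filterS (xy (C0 * A)) => N /=; rewrite lte_fin => xN; split => //.
(* All three thresholds were obtained before f and the levels were introduced. *)
exists (maxn n1 (maxn n2 n3)) => f hf fA N N' N'' N1 NN K1 calR.
move: NN; rewrite !geq_max => /and3P[/hn1/= sA /hn2/= dN /hn3/= [xoo xsmall xmod]].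
set s : R := (phi N)%:num in sA *; have s0 : 0 < s by rewrite /s.
have CsA C : 0 < C -> C <= Cs -> C * A <= s.
  by move=> _ CC; apply: le_trans sA; rewrite ler_pM2r.
have sA0 : Cs0 * A <= s by apply: CsA => //; rewrite /Cs -addrA lerDl addr_ge0// ltW.
have sA1 : Cs1 * A <= s by apply: CsA => //; rewrite /Cs addrAC lerDr addr_ge0// ltW.
have sA2 : Cs2 * A <= s by apply: CsA => //; rewrite /Cs lerDr addr_ge0// ltW.
have N0 : 0 < N%:R :> R by rewrite ltr0n.
have x0 : 0 < x N by rewrite divr_gt0// powR_gt0.
pose K : R := ((N' + N'')%:R * (N%:R / x N) ^+ 2)^-1.
have RL := Re_lipschitz hf; have IL := Im_lipschitz hf.
have calRE : calR = K%:C * \sum_(k <- levels N' N'')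
    \sum_(nm <- fset_set (grid_pairs (Zgrid z0 L) N))
      f (s%:C * (branch_pow alpha k nm.1 - branch_pow alpha k nm.2)).
  rewrite /calR cintegral_lvl_measure; last 2 first.
  - exact: (lipschitz_measurable RL).
  - exact: (lipschitz_measurable IL).
  (* The normalisation psi(N) is the square of N / x, the form used in [main_estimate]. *)
  congr (_%:C * _); rewrite /K psiE// (_ : N%:R / x N = N%:R `^ (2 - alpha) / s)//.
  rewrite /x invf_div mulrA; congr (_ / _).
  rewrite (_ : 2 - alpha = 1 + (1 - alpha)); last by ring.
  by rewrite [RHS]powRD ?(gt_eqF N0) ?implybT// powRr1.
have transfer := @cintegral_transfer R f A hf fA A0 _ _ K (levels N' N'')
  (fset_set (grid_pairs (Zgrid z0 L) N))
  (fun k nm => s%:C * (branch_pow alpha k nm.1 - branch_pow alpha k nm.2)).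
have B0 : 0 <= sup_norm f + diff_sup_norm f.
  by rewrite addr_ge0 ?(sup_norm_ge0 hf fA)// (diff_sup_norm_ge0 hf).
split.
- move=> /xoo xbig.
  (* Weight 0 and error 0: the comparison integral vanishes and the modulus of [calR] is at most
     0. *)
  have := transfer (fun=> 0) 0 (fun=> lexx 0); rewrite mulr0.
  have H u : bump u (sup_norm f + diff_sup_norm f) A ->
     exists2 a, (\int[Leb R]_z (u (complex_of z) * 0)%:E = a%:E)%E &
       `|K * pair_sum L z0 alpha u s N (levels N' N'') - a| <= 0.
    move=> bu; exists 0.
      by under eq_integral do rewrite mulr0; rewrite integral0.
    by rewrite (zero u _ A A1' bu s N _ s0 N1 sA0 xbig) mulr0 subr0 normr0.
  move=> /(_ H); rewrite -calRE.
  have -> : cintegral (Leb R) (fun z => f z * (0 : R)%:C) = 0.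
    rewrite /cintegral; apply/eqP; rewrite eq_complex /=.
    by under eq_Rintegral do rewrite mulr0/=; under [X in _ && (X == _)]eq_Rintegral do rewrite mulr0/=; rewrite !Rintegral_cst// !mul0r !eqxx.
  by rewrite subr0 => h; apply/eqP; rewrite -cmod_eq0 eq_le h cmod_ge0.
- move=> /xsmall x1.
  have H u (bu : bump u (sup_norm f + diff_sup_norm f) A) :=
    small u _ A A1' bu s N N' N'' s0 N1 sA1 dN K1 x1.
  have := transfer (rho alpha L 0) _ (fun z => rho_ge0 hb covE halpha z (lexx 0)) H.
  rewrite -calRE => /le_trans; apply; rewrite -/(x N).
  have -> : N%:R `^ alpha * s = x N * N%:R.
    rewrite /x mulrAC -{2}(powRr1 (ltW N0)) -mulrA -powRB ?(gt_eqF N0) ?implybT//.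
    by rewrite mulrC; congr (_ * _ `^ _); ring.
  rewrite mulrA; apply: ler_wpM2r; last by rewrite ler_pM2l// lerDl ltW.
  apply: (mulr_ge0 (mulr_ge0 (exprn_ge0 4 (ltW A0)) B0)).
  by rewrite !addr_ge0 ?invr_ge0 ?(ltW x0)// mulr_ge0 ?(ltW x0)// ltW.
- move=> l l0 /(xmod _ l0) lx.
  have H u (bu : bump u (sup_norm f + diff_sup_norm f) A) :=
    moderate u _ A A1' bu l s N N' N'' s0 N1 sA2 dN K1 l0 lx.
  have := transfer (rho alpha L l) _ (fun z => rho_ge0 hb covE halpha z (ltW l0)) H.
  rewrite -calRE => /le_trans; apply.
  have -> : s / (l * N%:R `^ (1 - alpha)) = x N / l by rewrite /x invfM mulrCA mulrC.
  rewrite mulrA; apply: ler_wpM2r; last by rewrite ler_pM2l// lerDr ltW.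
  apply: (mulr_ge0 (mulr_ge0 B0 (powR_ge0 _ _))).
  by rewrite !addr_ge0 ?(mulr_ge0 (powR_ge0 _ _))// divr_ge0 ?exprn_ge0 ?(ltW A0)// ltW.
Qed.
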